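(* Let $V\subset\mathbb{R}^d$ be a non-empty, bounded, open set and let $f:\partial V\to\mathbb{R}$ be continuous. The function $h:\overline{V}\to\mathbb{R}$ given by $h(v)=f(v)$ for $v\in\partial V$ and $h(v)=E[f(X_r^v(\infty))]$ for $v\in V$, where $0<r<1$, is well defined, in the sense that it does not depend on $r$: for every $v\in V$ and all $r,s\in(0,1)$, $E[f(X_r^v(\infty))]=E[f(X_s^v(\infty))]$.
   Context: $\mathbb{R}^d$ carries the Euclidean norm $\|\cdot\|$; $d(x,A)=\inf\{\|x-y\|:y\in A\}$. Let $\vartheta_1,\vartheta_2,\dots$ be independent, identically distributed random variables on a probability space $(\Omega,\mathcal{F},P)$, uniformly distributed on the unit sphere $S_1(0)=\{y\in\mathbb{R}^d:\|y\|=1\}$; $E$ denotes expectation with respect to $P$. For $v\in V$ and $0<r<1$ define $X_r^v(1)=v$ and $X_r^v(n+1)=X_r^v(n)+r\,d(X_r^v(n),\partial V)\,\vartheta_n$ for $n\ge 1$. This sequence converges almost surely, and $X_r^v(\infty)$ denotes its almost sure limit, which lies in $\partial V$ almost surely. *)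

(* Defs.v *)
From HB Require Import structures.
From mathcomp Require Import all_boot all_order all_algebra finmap.
From mathcomp Require Import all_classical all_reals all_analysis.
Import Order.TTheory GRing.Theory Num.Theory numFieldNormedType.Exports.

Set Implicit Arguments.
Unset Strict Implicit.
Unset Printing Implicit Defensive.

Local Open Scope classical_set_scope.
Local Open Scope ring_scope.

Section Euclidean.
Context {R : realType} {d : nat}.
Implicit Types (x : 'rV[R]_d) (A : set 'rV[R]_d).

(* The library norm `|x| on 'rV[R]_d is the sup norm, which induces the same
   topology and the same bounded sets. *)
Definition enorm x : R := Num.sqrt (\sum_(i < d) x ord0 i ^+ 2).

Definition edist_set x A : R := inf [set enorm (x - y) | y in A].

Definition boundary A : set 'rV[R]_d := closure A `\` interior A.

Definition unit_sphere : set 'rV[R]_d := [set y | enorm y = 1].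

Definition borel : set (set 'rV[R]_d) := <<s open >>.

End Euclidean.

Section Hausdorff.
Context {R : realType} {d : nat}.
Implicit Types (A : set 'rV[R]_d) (k : nat).
Local Open Scope ereal_scope.

(* diameter A is -oo when A is empty, whence the case distinction in
   diameter_pow (relevant to the empty sets of a covering, notably for k = 0,
   where the Hausdorff measure is the counting measure). *)
Definition diameter A : \bar R :=
  ereal_sup [set (enorm (x - y)%R)%:E | x in A & y in A].

Definition diameter_pow k A : \bar R :=
  if A == set0 then 0 else diameter A ^+ k.

Definition hausdorff_pre k (delta : R) A : \bar R :=
  ereal_inf [set \sum_(i <oo) diameter_pow k (U i) | U in
    [set U : nat -> set 'rV[R]_d |
      (forall i, diameter (U i) <= delta%:E) /\ A `<=` \bigcup_i U i]].

(* k-dimensional Hausdorff measure without the customary dimensional constant,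
   which cancels in uniform_on_sphere. *)
Definition hausdorff k A : \bar R :=
  ereal_sup [set hausdorff_pre k delta A | delta in [set delta : R | (0 < delta)%R]].

End Hausdorff.

Section RandomVectors.
Context {R : realType} {d : nat} {disp : measure_display}
  {Omega : measurableType disp}.
Variable P : probability Omega R.

Definition random_vector (X : Omega -> 'rV[R]_d) : Prop :=
  forall A, borel A -> measurable (X @^-1` A).

(* The law of X is the normalized surface measure of the sphere, surface measure
   being (d-1)-dimensional Hausdorff measure. *)
Definition uniform_on_sphere (X : Omega -> 'rV[R]_d) : Prop :=
  forall A, borel A ->
    P (X @^-1` A) = (fine (hausdorff d.-1 (unit_sphere `&` A)) /
                     fine (hausdorff d.-1 (@unit_sphere R d)))%:E.

Definition mutually_independent (X : nat -> Omega -> 'rV[R]_d) : Prop :=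
  forall (J : {fset nat}) (A : nat -> set 'rV[R]_d),
    (forall j, j \in J -> borel (A j)) ->
    P (\bigcap_(j in [set` J]) (X j @^-1` A j)) =
    (\prod_(j <- J) P (X j @^-1` A j))%E.

(* Indices start at 0: walk theta V r v n is X_r^v(n+1), and theta n is the
   (n+1)-st direction. *)
Fixpoint walk (theta : nat -> Omega -> 'rV[R]_d) (V : set 'rV[R]_d) (r : R)
    (v : 'rV[R]_d) (n : nat) (w : Omega) : 'rV[R]_d :=
  if n is m.+1 then
    let x := walk theta V r v m w in
    x + (r * edist_set x (boundary V)) *: theta m w
  else v.

Definition walk_lim (theta : nat -> Omega -> 'rV[R]_d) (V : set 'rV[R]_d)
    (r : R) (v : 'rV[R]_d) (w : Omega) : 'rV[R]_d :=
  lim (walk theta V r v n w @[n --> \oo]).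

End RandomVectors.

(* Main.v *)
Require Import Defs.
From HB Require Import structures.
From mathcomp Require Import all_boot all_order all_algebra finmap.
From mathcomp Require Import all_classical all_reals all_analysis.
From mathcomp Require Import measurable_realfun ring lra.
Import Order.TTheory GRing.Theory Num.Theory numFieldNormedType.Exports.

(* By Markov's property, E F(X_n) = (T_r)^n F (v) where T_r F x is the mean of F
   over the sphere of radius r d(x, boundary V) about x; the walk is a bounded
   martingale, so Doob's inequality gives its convergence. Continuous functions
   on the boundary are uniform limits of differences of convex Lipschitz
   functions F, for which (T_r)^n F increases with n, so that it suffices to
   bound (T_s)^n F (v) by sup_N (T_r)^N F (v).

   The comparison goes through walks with a fixed small step eps, frozen within
   distance delta of the complement of V; let u be the expectation of F after
   many such steps. Averaging u over rotations about x gives a radial function,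
   still harmonic for the eps-walk, to which a maximum principle applies: hence
   u x is, up to errors that vanish with eps, the mean of u over any sphere
   about x inside the region where the walk moves, and is at most the mean over
   any sphere. The first property gives (T_s)^n F (v) <= u v + o(1); the second
   gives u v <= (T_r)^N u (v) + o(1), and u = F where the walk is frozen, which
   is where the r-walk is likely to be at a large time N. The variation of u is
   controlled only by moving delta together with the point, which makes every
   estimate independent of the regularity of V. *)

Set Implicit Arguments.
Unset Strict Implicit.
Unset Printing Implicit Defensive.

Local Open Scope classical_set_scope.
Local Open Scope ring_scope.

(** * Euclidean inner product, norm and reflections *)

Section EuclideanNorm.
Context {R : realType} {d : nat}.
Implicit Types (x y u e : 'rV[R]_d).

(** Boundary points of V may be irregular, so no continuity of u up to the boundary is available.
    Every estimate is therefore an inequality between walks frozen at two slightly different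
    thresholds. A jump costs eps of threshold, which is harmless because eps is chosen after the
    numbers n and N of jumps.

    Convexity of F enters as the sub-mean-value property. It yields the monotonicity in n, and it
    survives freezing, so that u is dominated by its means even over spheres that leave the region
    where the walk moves.

    The geometry of surface measure enters through its invariance under reflections, which act
    transitively on each sphere, and under z -> -z; independence enters through probabilities of
    rectangles. Integrands are kept locally Lipschitz: finite sums over small Borel cells of the
    sphere then approximate all integrals uniformly, and the exchange of integrals and Markov's
    property reduce to finite sums. The limit of the walk appears only at the end, where f of it is
    squeezed, up to a null set and a small error, between functions of X_n. *)

Definition dotp x y : R := \sum_(i < d) x ord0 i * y ord0 i.

Lemma dotpC x y : dotp x y = dotp y x.
Proof. by apply: eq_bigr => i _; rewrite mulrC. Qed.

Lemma dotpDl x y u : dotp (x + y) u = dotp x u + dotp y u.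
Proof. by rewrite -big_split; apply: eq_bigr => i _; rewrite !mxE mulrDl. Qed.

Lemma dotpZl a x u : dotp (a *: x) u = a * dotp x u.
Proof. by rewrite mulr_sumr; apply: eq_bigr => i _; rewrite !mxE mulrA. Qed.

Lemma dotpNl x u : dotp (- x) u = - dotp x u.
Proof. by rewrite -scaleN1r dotpZl mulN1r. Qed.

Lemma dotpDr x y u : dotp u (x + y) = dotp u x + dotp u y.
Proof. by rewrite dotpC dotpDl !(dotpC _ u). Qed.

Lemma dotpZr a x u : dotp u (a *: x) = a * dotp u x.
Proof. by rewrite dotpC dotpZl dotpC. Qed.

Lemma dotpNr x u : dotp u (- x) = - dotp u x.
Proof. by rewrite dotpC dotpNl dotpC. Qed.

Lemma dotp_ge0 x : 0 <= dotp x x.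
Proof. by apply: sumr_ge0 => i _; rewrite -expr2 sqr_ge0. Qed.

Lemma enormE x : enorm x = Num.sqrt (dotp x x).
Proof. by congr Num.sqrt; apply: eq_bigr => i _; rewrite expr2. Qed.

Lemma enorm_ge0 x : 0 <= enorm x.
Proof. exact: sqrtr_ge0. Qed.

Lemma enorm_sqr x : enorm x ^+ 2 = dotp x x.
Proof. by rewrite enormE sqr_sqrtr// dotp_ge0. Qed.

Lemma dotp_eq0 x : (dotp x x == 0) = (x == 0).
Proof.
apply/eqP/eqP => [x0|->]; last by apply: big1 => i _; rewrite mxE mul0r.
apply/rowP => i; rewrite mxE; apply/eqP.
have : dotp x x == 0 by rewrite x0.
rewrite psumr_eq0 => [|j _]; last by rewrite -expr2 sqr_ge0.
by move=> /allP/(_ i (mem_index_enum _)); rewrite /= mulf_eq0 orbb.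
Qed.

Lemma enorm_eq0 x : (enorm x == 0) = (x == 0).
Proof. by rewrite -dotp_eq0 -enorm_sqr expf_eq0. Qed.

Lemma enorm0 : enorm (0 : 'rV[R]_d) = 0.
Proof. by apply/eqP; rewrite enorm_eq0. Qed.

Lemma enormZ a x : enorm (a *: x) = `|a| * enorm x.
Proof.
by rewrite !enormE dotpZl dotpZr mulrA -expr2 sqrtrM ?sqr_ge0// sqrtr_sqr.
Qed.

Lemma enormN x : enorm (- x) = enorm x.
Proof. by rewrite -scaleN1r enormZ normrN1 mul1r. Qed.

Lemma enormBC x y : enorm (x - y) = enorm (y - x).
Proof. by rewrite -enormN opprB. Qed.

Lemma CauchySchwarz_dotp x y : dotp x y <= enorm x * enorm y.
Proof.
have [->|x0] := eqVneq x 0.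
  by rewrite enorm0 mul0r -(scale0r 0) dotpZl mul0r.
apply: le_trans (ler_norm _) _.
rewrite -(@ler_pXn2r _ 2)// ?nnegrE ?mulr_ge0 ?enorm_ge0//.
rewrite exprMn real_normK ?num_real// !enorm_sqr.
have xx : 0 < dotp x x by rewrite lt_def dotp_eq0 x0 dotp_ge0.
(* The square norm of this vector is [dotp x x] times the defect
   [dotp x x * dotp y y - dotp x y ^+ 2]. *)
have := dotp_ge0 (dotp x x *: y - dotp x y *: x).
rewrite !(dotpDl, dotpDr, dotpNl, dotpNr, dotpZl, dotpZr) (dotpC y x).
move=> H; rewrite -subr_ge0 -(pmulr_rge0 _ xx); apply: le_trans H _.
by rewrite le_eqVlt; apply/orP; left; apply/eqP; ring.
Qed.

Lemma ler_enormD x y : enorm (x + y) <= enorm x + enorm y.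
Proof.
rewrite -(@ler_pXn2r _ 2)// ?nnegrE ?addr_ge0 ?enorm_ge0// sqrrD !enorm_sqr.
rewrite dotpDl !dotpDr (dotpC y x).
have := CauchySchwarz_dotp x y; lra.
Qed.

Lemma ler_enormB x y : enorm (x - y) <= enorm x + enorm y.
Proof. by rewrite -(enormN y); exact: ler_enormD. Qed.

Lemma ler_enorm_dist x y u : enorm (x - y) <= enorm (x - u) + enorm (u - y).
Proof. by apply: le_trans (ler_enormD _ _); rewrite addrA subrK. Qed.

Lemma enorm_dist x y : `|enorm x - enorm y| <= enorm (x - y).
Proof.
rewrite ler_norml; have := ler_enorm_dist x 0 y; have := ler_enorm_dist y 0 x.
rewrite !subr0 (enormBC y); lra.
Qed.

Lemma normr_le_enorm x : `|x| <= enorm x.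
Proof.
rewrite -[X in X <= _]/(mx_norm x) mx_normrE; apply/bigmax_leP; split=> [|[i j] _].
  exact: enorm_ge0.
rewrite /= (ord1 i) -(@ler_pXn2r _ 2)// ?nnegrE ?enorm_ge0//.
rewrite enorm_sqr real_normK ?num_real// /dotp (bigD1 j)//= -expr2 lerDl.
by apply: sumr_ge0 => k _; rewrite -expr2 sqr_ge0.
Qed.

Lemma enorm_le_normr x : enorm x <= d%:R * `|x|.
Proof.
rewrite -(@ler_pXn2r _ 2)// ?nnegrE ?mulr_ge0 ?enorm_ge0//.
rewrite enorm_sqr exprMn.
apply: (@le_trans _ _ (\sum_(i < d) `|x| ^+ 2)).
  apply: ler_sum => i _; rewrite -expr2 -real_normK ?num_real//.
  rewrite ler_pXn2r// ?nnegrE//.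
  by rewrite -[X in _ <= X]/(mx_norm x) mx_normrE; exact: (le_bigmax _ _ (ord0, i)).
rewrite sumr_const card_ord -[leLHS]mulr_natl ler_wpM2r ?sqr_ge0//.
rewrite -natrX ler_nat.
by case: d => // n; rewrite leq_pmull.
Qed.

(** The mirror is the hyperplane orthogonal to [u]; for [u = 0] the map is the identity, so that
    [reflection_swap] also covers [x = y]. *)
Definition reflection u x := x - (2 * dotp x u / dotp u u) *: u.

Lemma reflectionD u x y :
  reflection u (x + y) = reflection u x + reflection u y.
Proof.
by rewrite /reflection dotpDl mulrDr mulrDl scalerDl opprD addrACA.
Qed.

Lemma reflectionZ u a x : reflection u (a *: x) = a *: reflection u x.
Proof.
by rewrite /reflection dotpZl scalerBr scalerA; congr (_ - _ *: _); ring.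
Qed.

Lemma reflectionB u x y :
  reflection u (x - y) = reflection u x - reflection u y.
Proof. by rewrite -scaleN1r reflectionD reflectionZ scaleN1r. Qed.

Lemma enorm_reflection u x : enorm (reflection u x) = enorm x.
Proof.
have [->|u0] := eqVneq u 0; first by rewrite /reflection scaler0 subr0.
rewrite !enormE; congr Num.sqrt.
have uu : dotp u u != 0 by rewrite dotp_eq0.
rewrite /reflection !(dotpDl, dotpDr, dotpNl, dotpNr, dotpZl, dotpZr).
by rewrite (dotpC u x); field.
Qed.

Lemma reflectionK u : involutive (reflection u).
Proof.
move=> x; have [->|u0] := eqVneq u 0.
  by rewrite /reflection !scaler0 !subr0.
have uu : dotp u u != 0 by rewrite dotp_eq0.
rewrite /reflection !(dotpDl, dotpNl, dotpZl) -addrA -opprD -scalerDl.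
by rewrite [X in X *: u](_ : _ = 0) ?scale0r ?subr0//; field.
Qed.

(** The difference of two vectors of equal norm is normal to the hyperplane that bisects them.
    Reflections thus act transitively on each sphere and can stand for rotations throughout. *)
Lemma reflection_swap x y : enorm x = enorm y -> reflection (x - y) x = y.
Proof.
have [-> _|xy e] := eqVneq x y.
  by rewrite /reflection subrr scaler0 subr0.
rewrite /reflection.
suff -> : 2 * dotp x (x - y) / dotp (x - y) (x - y) = 1.
  by rewrite scale1r opprB addrC subrK.
have uu : dotp (x - y) (x - y) != 0 by rewrite dotp_eq0 subr_eq0.
apply: (mulIf uu); rewrite mulfVK// mul1r.
have : dotp x x = dotp y y by rewrite -!enorm_sqr e.
rewrite !(dotpDl, dotpDr, dotpNl, dotpNr) (dotpC y x) => ->; ring.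
Qed.

End EuclideanNorm.

(** * Locally Lipschitz maps *)

Section LocallyLipschitz.
Context {R : realType}.
Implicit Types (E F G : normedZmodType R).

(** The class is closed under the operations that occur, products and averages over a direction
    included, and it gives a modulus of continuity uniform over the sphere, on which the finite-sum
    approximations rest. *)
Definition loclip E F (f : E -> F) := forall r : R, exists2 L : R, 0 <= L &
  forall x y, `|x| <= r -> `|y| <= r -> `|f x - f y| <= L * `|x - y|.

Lemma loclip_bounded E F (f : E -> F) (r : R) : loclip f ->
  exists2 M : R, 0 <= M & forall x, `|x| <= r -> `|f x| <= M.
Proof.
move=> /(_ `|r|)[L L0 H]; exists (`|f 0| + L * `|r|) => [|x xr].
  by rewrite addr_ge0 ?mulr_ge0.
have xr' : `|x| <= `|r| by rewrite (le_trans xr)// ler_norm.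
have := H x 0 xr'; rewrite normr0 normr_ge0 subr0 => /(_ isT) H0.
rewrite -(subrK (f 0) (f x)) (le_trans (ler_normD _ _))// addrC lerD2l.
by rewrite (le_trans H0)// ler_wpM2l.
Qed.

Lemma loclip_cst E F (c : F) : loclip (fun _ : E => c).
Proof. by move=> r; exists 0 => // x y _ _; rewrite subrr normr0 mul0r. Qed.

Lemma loclip_id E : loclip (fun x : E => x).
Proof. by move=> r; exists 1 => // x y _ _; rewrite mul1r. Qed.

Lemma loclip_comp E F G (g : F -> G) (f : E -> F) :
  loclip g -> loclip f -> loclip (fun x => g (f x)).
Proof.
move=> gl fl r; have [M M0 fM] := loclip_bounded r fl.
have [L L0 fL] := fl r; have [K K0 gK] := gl M.
exists (K * L) => [|x y xr yr]; first exact: mulr_ge0.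
apply: le_trans (gK _ _ (fM _ xr) (fM _ yr)) _.
by rewrite -mulrA ler_wpM2l// fL.
Qed.

Lemma loclip_fst E F G (f : E -> F * G) :
  loclip f -> loclip (fun x => (f x).1).
Proof.
move=> fl r; have [L L0 H] := fl r; exists L => // x y xr yr.
by apply: le_trans (H x y xr yr); rewrite le_max lexx.
Qed.

Lemma loclip_snd E F G (f : E -> F * G) :
  loclip f -> loclip (fun x => (f x).2).
Proof.
move=> fl r; have [L L0 H] := fl r; exists L => // x y xr yr.
by apply: le_trans (H x y xr yr); rewrite le_max lexx orbT.
Qed.

Lemma loclip_pair E F G (f : E -> F) (g : E -> G) :
  loclip f -> loclip g -> loclip (fun x => (f x, g x)).
Proof.
move=> fl gl r; have [L L0 H] := fl r; have [K K0 H'] := gl r.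
exists (L + K) => [|x y xr yr]; first exact: addr_ge0.
rewrite ge_max mulrDl (le_trans (H _ _ xr yr)) ?lerDl ?mulr_ge0//=.
by rewrite (le_trans (H' _ _ xr yr))// lerDr mulr_ge0.
Qed.

Lemma loclipD E F (f g : E -> F) :
  loclip f -> loclip g -> loclip (fun x => f x + g x).
Proof.
move=> fl gl r; have [L L0 H] := fl r; have [K K0 H'] := gl r.
exists (L + K) => [|x y xr yr]; first exact: addr_ge0.
by rewrite opprD addrACA mulrDl (le_trans (ler_normD _ _))// lerD ?H ?H'.
Qed.

Lemma loclipN E F (f : E -> F) : loclip f -> loclip (fun x => - f x).
Proof.
move=> fl r; have [L L0 H] := fl r; exists L => // x y xr yr.
by rewrite -opprD normrN H.
Qed.

Lemma loclip_norm E F (f : E -> F) : loclip f -> loclip (fun x => `|f x| : R).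
Proof.
move=> fl r; have [L L0 H] := fl r; exists L => // x y xr yr.
exact: le_trans (ler_dist_dist _ _) (H _ _ xr yr).
Qed.

Lemma loclipM E (f g : E -> R) :
  loclip f -> loclip g -> loclip (fun x => f x * g x).
Proof.
move=> fl gl r; have [L L0 H] := fl r; have [K K0 H'] := gl r.
have [M M0 fM] := loclip_bounded r fl; have [N N0 gN] := loclip_bounded r gl.
exists (M * K + N * L) => [|x y xr yr]; first by rewrite addr_ge0 ?mulr_ge0.
rewrite (_ : _ - _ = f x * (g x - g y) + g y * (f x - f y)); last by ring.
rewrite (le_trans (ler_normD _ _))// !normrM mulrDl -!mulrA.
by rewrite lerD// ler_pM ?fM ?gN ?H ?H'.
Qed.

Lemma loclip_max E (f g : E -> R) :
  loclip f -> loclip g -> loclip (fun x => Num.max (f x) (g x)).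
Proof.
move=> fl gl.
have h : loclip (fun x => 2^-1 * (f x + g x + `|f x - g x|)).
  apply: loclipM; first exact: loclip_cst.
  apply: loclipD; first exact: loclipD.
  by apply: loclip_norm; apply: loclipD => //; exact: loclipN.
move=> r; have [L L0 H] := h r; exists L => // x y xr yr.
by have := H x y xr yr; rewrite !maxr_absE !(mulrC 2^-1).
Qed.

Lemma loclip_min E (f g : E -> R) :
  loclip f -> loclip g -> loclip (fun x => Num.min (f x) (g x)).
Proof.
move=> fl gl.
have h := loclipN (loclip_max (loclipN fl) (loclipN gl)).
move=> r; have [L L0 H] := h r; exists L => // x y xr yr.
by have := H x y xr yr; rewrite /= !oppr_max !opprK.
Qed.

Lemma loclipV E (f : E -> R) (a : R) : 0 < a -> (forall x, a <= f x) ->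
  loclip f -> loclip (fun x => (f x)^-1).
Proof.
move=> a0 fa fl r; have [L L0 H] := fl r.
exists (L / a ^+ 2) => [|x y xr yr].
  by rewrite mulr_ge0// invr_ge0 exprn_ge0// ltW.
have f0 z : 0 < f z := lt_le_trans a0 (fa z).
rewrite (_ : _ - _ = (f y - f x) / (f x * f y)); last first.
  by field; rewrite ?gt_eqF// f0.
rewrite normrM distrC mulrAC ler_pM ?H// normfV lef_pV2 ?posrE ?exprn_gt0//.
  by rewrite normrM !gtr0_norm// expr2 ler_pM// ltW.
by rewrite normr_gt0 mulf_neq0// gt_eqF.
Qed.

Section RowVectors.
Context {d : nat}.
Implicit Types (T : 'rV[R]_d).

Lemma loclipZ E (f : E -> R) (g : E -> 'rV[R]_d) :
  loclip f -> loclip g -> loclip (fun x => f x *: g x).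
Proof.
move=> fl gl r; have [L L0 H] := fl r; have [K K0 H'] := gl r.
have [M M0 fM] := loclip_bounded r fl; have [N N0 gN] := loclip_bounded r gl.
exists (M * K + N * L) => [|x y xr yr]; first by rewrite addr_ge0 ?mulr_ge0.
rewrite (_ : _ - _ = f x *: (g x - g y) + (f x - f y) *: g y); last first.
  by rewrite scalerBr scalerBl addrA subrK.
rewrite (le_trans (ler_normD _ _))// !normrZ mulrDl -!mulrA.
by rewrite lerD//; [|rewrite mulrC]; rewrite ler_pM ?fM ?gN ?H ?H'.
Qed.

Lemma loclip_lipschitz (f : 'rV[R]_d -> R) (L : R) :
  (forall x y, `|f x - f y| <= L * enorm (x - y)) -> loclip f.
Proof.
move=> H r; exists (`|L| * d%:R) => [|x y _ _]; first by rewrite mulr_ge0.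
apply: le_trans (H _ _) _; rewrite -mulrA.
apply: le_trans (_ : `|L| * enorm (x - y) <= _).
  by rewrite ler_wpM2r ?enorm_ge0 ?ler_norm.
by rewrite ler_wpM2l ?enorm_le_normr.
Qed.

Lemma loclip_enorm E (f : E -> 'rV[R]_d) :
  loclip f -> loclip (fun x => enorm (f x)).
Proof.
apply: (@loclip_comp _ _ _ enorm); apply: (@loclip_lipschitz _ 1) => x y.
by rewrite mul1r enorm_dist.
Qed.

End RowVectors.
End LocallyLipschitz.

(** The interface between probability and analysis. Invariance is asked of involutive isometries,
    which cover reflections and [z -> - z]; the last two fields let an average depend on a parameter
    and give Fubini's theorem for locally Lipschitz integrands. *)
Record spherical_average (R : realType) (d : nat) (J : ('rV[R]_d -> R) -> R) :
  Prop := SphericalAverage {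
  savg_cst : forall c, J (fun _ => c) = c;
  savgD : forall f g, loclip f -> loclip g ->
    J (fun z => f z + g z) = J f + J g;
  savgZ : forall a f, loclip f -> J (fun z => a * f z) = a * J f;
  ler_savg : forall f g, loclip f -> loclip g ->
    (forall z, enorm z = 1 -> f z <= g z) -> J f <= J g;
  savg_isometry : forall S f, involutive S ->
    (forall x y, enorm (S x - S y) = enorm (x - y)) ->
    (forall x, enorm (S x) = enorm x) -> loclip f -> J (fun z => f (S z)) = J f;
  loclip_savg : forall (E : normedZmodType R) (F : E * 'rV[R]_d -> R),
    loclip F -> loclip (fun x => J (fun z => F (x, z)));
  savg_exchange : forall F : 'rV[R]_d * 'rV[R]_d -> R, loclip F ->
    J (fun z => J (fun z' => F (z, z'))) = J (fun z' => J (fun z => F (z, z')))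
}.

Create HintDb loclip.

(** Recursion on the shape of the function. Under a spherical average the variable and the direction
    are packed into a pair, as [loclip_savg] requires; remaining atoms are left to the hint
    database. *)
Ltac loclip_tac := first [exact: loclip_cst | assumption | lazymatch goal with
  | H : spherical_average ?J |- loclip (fun x => ?J (@?f x)) =>
      refine (loclip_savg H (F := fun p => f p.1 p.2) _);
      cbv beta; loclip_tac
  | |- loclip (fun x => x) => exact: loclip_id
  | |- loclip (fun x => @?f x + @?g x) => apply: (@loclipD _ _ _ f g); loclip_tac
  | |- loclip (fun x => - @?f x) => apply: (@loclipN _ _ _ f); loclip_tac
  | |- loclip (fun x => @?f x * @?g x) => apply: (@loclipM _ _ f g); loclip_tac
  | |- loclip (fun x => @?f x ^+ 2) =>
      apply: (@loclipM _ _ f f); loclip_tac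
  | |- loclip (fun x => @?f x *: @?g x) =>
      apply: (@loclipZ _ _ _ f g); loclip_tac
  | |- loclip (fun x => `|@?f x|) => apply: (@loclip_norm _ _ _ f); loclip_tac
  | |- loclip (fun x => enorm (@?f x)) =>
      apply: (@loclip_enorm _ _ _ f); loclip_tac
  | |- loclip (fun x => Num.max (@?f x) (@?g x)) =>
      apply: (@loclip_max _ _ f g); loclip_tac
  | |- loclip (fun x => Num.min (@?f x) (@?g x)) =>
      apply: (@loclip_min _ _ f g); loclip_tac
  | |- loclip (fun x => fst (@?f x)) =>
      apply: (@loclip_fst _ _ _ _ f); loclip_tac
  | |- loclip (fun x => snd (@?f x)) =>
      apply: (@loclip_snd _ _ _ _ f); loclip_tac
  | |- loclip (fun x => (@?f x, @?g x)) =>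
      apply: (@loclip_pair _ _ _ _ f g); loclip_tac
  | |- loclip (fun x => ?g (@?f x)) =>
      apply: (@loclip_comp _ _ _ _ g f); [solve [eauto with loclip] | loclip_tac]
  | |- loclip fst => exact: (loclip_fst (@loclip_id _ _))
  | |- loclip snd => exact: (loclip_snd (@loclip_id _ _))
  | |- _ => try solve [eauto with loclip]
  end].

(** * Bounded random variables and their means *)

Section BoundedRandomVariables.
Context {R : realType} {disp : measure_display} {Omega : measurableType disp}.
Variable P : probability Omega R.
Implicit Types (f g : Omega -> R) (A B : set Omega).

Definition bounded_rv f :=
  measurable_fun setT f /\ exists M : R, forall w, `|f w| <= M.

Definition mean f : R := Rintegral P setT f.

Lemma bounded_rv_integrable f :
  bounded_rv f -> P.-integrable setT (EFin \o f).
Proof.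
move=> [mf [M fM]]; apply: measurable_bounded_integrable => //.
  by have := probability_le1 P (@measurableT _ Omega); move=> /le_lt_trans-> //; rewrite ltry.
exists M; split; first exact: num_real.
by move=> N MN w _ /=; rewrite (le_trans (fM w))// ltW.
Qed.

Lemma bounded_rv_cst a : bounded_rv (fun _ => a).
Proof. by split; [exact: measurable_cst|exists `|a|]. Qed.

Lemma bounded_rvD f g :
  bounded_rv f -> bounded_rv g -> bounded_rv (fun w => f w + g w).
Proof.
move=> [mf [M fM]] [mg [N gN]]; split; first exact: measurable_funD.
by exists (M + N) => w; rewrite (le_trans (ler_normD _ _))// lerD.
Qed.

Lemma bounded_rvM f g :
  bounded_rv f -> bounded_rv g -> bounded_rv (fun w => f w * g w).
Proof.
move=> [mf [M fM]] [mg [N gN]]; split; first exact: measurable_funM.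
by exists (M * N) => w; rewrite normrM ler_pM.
Qed.

Lemma bounded_rvN f : bounded_rv f -> bounded_rv (fun w => - f w).
Proof.
move=> bf; have := bounded_rvM (bounded_rv_cst (-1)) bf.
by congr bounded_rv; apply/funext => w; rewrite mulN1r.
Qed.

Lemma bounded_rv_indic A : measurable A -> bounded_rv (\1_A).
Proof.
move=> mA; split; first exact: measurable_indic.
by exists 1 => w; rewrite indicE; case: (_ \in _); rewrite ?normr1 ?normr0.
Qed.

Lemma bounded_rv_sum n (F : 'I_n -> Omega -> R) :
  (forall i, bounded_rv (F i)) -> bounded_rv (fun w => \sum_i F i w).
Proof.
move=> bF; split; first by apply: measurable_sum => i; exact: (bF i).1.
have /choice[M FM] i : exists M, forall w, `|F i w| <= M := (bF i).2.
by exists (\sum_i M i) => w; rewrite (le_trans (ler_norm_sum _ _ _))// ler_sum.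
Qed.

(** Random vectors are given by preimages of Borel sets, so a function of one is shown to be
    measurable as a uniform limit of finite sums over cells. *)
Lemma bounded_rv_approx f :
  (forall e : R, 0 < e ->
    exists2 g, bounded_rv g & forall w, `|f w - g w| <= e) -> bounded_rv f.
Proof.
move=> H; split; last first.
  have [g [_ [M gM]] fg] := H 1 ltr01; exists (1 + M) => w.
  by rewrite -(subrK (g w) (f w)) (le_trans (ler_normD _ _))// lerD.
have /choice[g Hg] (n : nat) : exists g, bounded_rv g /\
    forall w, `|f w - g w| <= n.+1%:R^-1.
  by have [|g bg fg] := H n.+1%:R^-1; [rewrite invr_gt0 ltr0n|exists g].
apply: (measurable_fun_cvg (h := g)) => [n|w _]; first exact: (Hg n).1.1.
apply/cvgrPdist_le => e e0.
near=> n; rewrite (le_trans ((Hg n).2 w))//.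
by apply/ltW; near: n; exact: (near_infty_natSinv_lt (PosNum e0)).
Unshelve. all: by end_near. Qed.

Lemma mean_cst a : mean (fun _ => a) = a.
Proof. by rewrite /mean Rintegral_cst// [X in fine X](@probability_setT _ _ _ P) mulr1. Qed.

Lemma meanD f g : bounded_rv f -> bounded_rv g ->
  mean (fun w => f w + g w) = mean f + mean g.
Proof. by move=> bf bg; rewrite /mean RintegralD//; exact: bounded_rv_integrable. Qed.

Lemma meanZ a f : bounded_rv f -> mean (fun w => a * f w) = a * mean f.
Proof. by move=> bf; rewrite /mean RintegralZl//; exact: bounded_rv_integrable. Qed.

Lemma meanN f : bounded_rv f -> mean (fun w => - f w) = - mean f.
Proof.
move=> bf; rewrite -mulN1r -meanZ//; congr mean.
by apply/funext => w; rewrite mulN1r.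
Qed.

Lemma ler_mean f g : bounded_rv f -> bounded_rv g ->
  (forall w, f w <= g w) -> mean f <= mean g.
Proof. by move=> bf bg fg; apply: le_Rintegral => //; exact: bounded_rv_integrable. Qed.

Lemma mean_sum n (F : 'I_n -> Omega -> R) : (forall i, bounded_rv (F i)) ->
  mean (fun w => \sum_i F i w) = \sum_i mean (F i).
Proof.
elim: n F => [|n IH] F bF.
  rewrite big_ord0 -[RHS](mean_cst 0); congr mean.
  by apply/funext => w; rewrite big_ord0.
rewrite big_ord_recl -IH// -meanD//; last exact: bounded_rv_sum.
by congr mean; apply/funext => w; rewrite big_ord_recl.
Qed.

Lemma mean_indic A : measurable A -> mean (\1_A) = fine (P A).
Proof. by move=> mA; rewrite /mean /Rintegral integral_indic// setIT. Qed.

Lemma mean_dist f g e : bounded_rv f -> bounded_rv g ->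
  (forall w, `|f w - g w| <= e) -> `|mean f - mean g| <= e.
Proof.
move=> bf bg fg; rewrite -meanN// -meanD//; last exact: bounded_rvN.
have bfg : bounded_rv (fun w => f w - g w).
  by apply: bounded_rvD => //; exact: bounded_rvN.
rewrite ler_norml; apply/andP; split.
  rewrite -[leLHS]mean_cst; apply: ler_mean => // [|w].
    exact: bounded_rv_cst.
  by have := fg w; rewrite ler_norml => /andP[].
rewrite -[leRHS]mean_cst; apply: ler_mean => // [|w].
  exact: bounded_rv_cst.
by have := fg w; rewrite ler_norml => /andP[].
Qed.

End BoundedRandomVariables.

(** * Borel partitions of the sphere into small cells *)

Section BorelCells.
Context {R : realType} {d : nat}.
Implicit Types (A B : set 'rV[R]_d) (x y z e : 'rV[R]_d).

Lemma borel_open A : open A -> borel A.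
Proof. exact: sub_sigma_algebra. Qed.

Lemma borelC A : borel A -> borel (~` A).
Proof.
have [_ + _] := smallest_sigma_algebra setT (@open 'rV[R]_d).
by move=> H /H; rewrite setTD.
Qed.

Lemma borel_bigcup (F : nat -> set 'rV[R]_d) :
  (forall n, borel (F n)) -> borel (\bigcup_n F n).
Proof. by have [_ _] := smallest_sigma_algebra setT (@open 'rV[R]_d); exact. Qed.

Lemma borel0 : borel (@set0 'rV[R]_d).
Proof. by have [] := smallest_sigma_algebra setT (@open 'rV[R]_d). Qed.

Lemma borelU A B : borel A -> borel B -> borel (A `|` B).
Proof.
move=> bA bB; rewrite -bigcup2E; apply: borel_bigcup => -[|[|n]] //=.
exact: borel0.
Qed.

Lemma borelI A B : borel A -> borel B -> borel (A `&` B).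
Proof.
move=> bA bB; rewrite -[A `&` B]setCK setCI; apply: borelC.
by apply: borelU; exact: borelC.
Qed.

Lemma loclip_continuous (U : pseudoMetricNormedZmodType R) (f : 'rV[R]_d -> U) :
  loclip f -> continuous f.
Proof.
move=> fl x; apply/(@cvgrPdist_le _ _ _ (nbhs x) (nbhs_filter x)) => e e0.
have [L L0 H] := fl (`|x| + 1).
apply/nbhs_ballP; exists (Num.min 1 (e / (L + 1))) => /=.
  by rewrite lt_min ltr01 divr_gt0// ltr_wpDl.
move=> y; rewrite -ball_normE /= lt_min => /andP[/ltW xy /ltW xy'].
rewrite (le_trans (H _ _ _ _)) ?lerDl//.
  by rewrite -[y](subrK x) (le_trans (ler_normD _ _))// addrC lerD2l distrC.
apply: le_trans (_ : (L + 1) * `|x - y| <= _).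
  by rewrite ler_wpM2r// lerDl.
by rewrite mulrC -ler_pdivlMr// ltr_wpDl.
Qed.

Lemma open_enorm_ball e (t : R) : open [set z | enorm (z - e) < t].
Proof.
have c : continuous (fun z : 'rV[R]_d => enorm (z - e)).
  by apply: loclip_continuous; loclip_tac.
exact: ((continuousP _).1 c _ (open_lt (y := t))).
Qed.

Lemma closed_enorm_eq (t : R) : closed [set z : 'rV[R]_d | enorm z = t].
Proof.
apply: (@preimage_closed _ _ (@enorm R d) [set t]); last exact: closed_eq.
move=> z _; apply: (@loclip_continuous _ (@enorm R d)).
by apply: loclip_enorm; exact: loclip_id.
Qed.

Lemma borel_enorm_eq (t : R) : borel [set z : 'rV[R]_d | enorm z = t].
Proof.
rewrite -[X in borel X]setCK; apply: borelC.
by apply: borel_open; rewrite openC; exact: closed_enorm_eq.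
Qed.

Lemma borel_find (s : seq 'rV[R]_d) (t : R) (i : nat) :
  borel [set z | find (fun e => enorm (z - e) < t) s = i].
Proof.
elim: s i => [|e s IH] i /=.
  case: i => [|i].
    rewrite (_ : [set _ | _] = setT); last by apply/seteqP; split.
    by rewrite -[setT]setCK setCT; apply: borelC; exact: borel0.
  rewrite (_ : [set _ | _] = set0); first exact: borel0.
  by apply/seteqP; split.
case: i => [|i].
  rewrite (_ : [set _ | _] = [set z | enorm (z - e) < t]).
    apply: borel_open; exact: open_enorm_ball.
  by apply/seteqP; split => z /=; case: ifP.
rewrite (_ : [set _ | _] = ~` [set z | enorm (z - e) < t] `&`
    [set z | find (fun e => enorm (z - e) < t) s = i]).
  by apply: borelI => //; apply: borelC; apply: borel_open; exact: open_enorm_ball.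
apply/seteqP; split => z /=; first by case: ifP => // _ [].
by move=> [/negP/negbTE-> ->].
Qed.

Lemma compact_unit_sphere : compact (@unit_sphere R d).
Proof.
apply: bounded_closed_compact.
  exists 1; split => [|N N1 z /= z1]; first exact: num_real.
  by rewrite (le_trans (normr_le_enorm _))// z1 ltW.
exact: closed_enorm_eq.
Qed.

Lemma compact_net (K : set 'rV[R]_d) (t : R) : compact K -> 0 < t ->
  exists2 s : seq 'rV[R]_d, (forall e, e \in s -> K e) &
    forall z, K z -> has (fun e => enorm (z - e) < t) s.
Proof.
move=> cK t0; move: cK; rewrite compact_cover.
move=> /(_ _ K (fun e => [set z | enorm (z - e) < t])).
case=> [e _|z Kz|D DK KD]; first exact: open_enorm_ball.
  by exists z => //=; rewrite subrr enorm0.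
exists (enum_fset D) => [e /DK|z /KD[e /= De ze]]; first by rewrite inE.
by apply/hasP; exists e.
Qed.

(** Cell [i] consists of the points for which the [i]-th point of a finite net is the first one
    closer than [t]. The final equivalence says that the cells partition the sphere. *)
Lemma sphere_cells (t : R) : 0 < t -> exists n : nat,
  exists2 e : 'I_n -> 'rV[R]_d, (forall i, enorm (e i) = 1) &
  exists2 A : 'I_n -> set 'rV[R]_d, (forall i, borel (A i)) &
    forall z, enorm z = 1 -> exists2 i, enorm (z - e i) <= t &
      forall j, A j z <-> j = i.
Proof.
move=> t0; have [s sS Hs] := @compact_net unit_sphere t compact_unit_sphere t0.
exists (size s), (fun i => nth 0 s i) => [i|].
  by apply: sS; rewrite mem_nth.
exists (fun i => [set z | find (fun e => enorm (z - e) < t) s = i]) => [i|z z1].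
  exact: borel_find.
have := Hs z z1; rewrite has_find => fs; exists (Ordinal fs) => /=.
  by apply/ltW; have := nth_find 0 (Hs z z1).
by move=> j; split=> [jz|->//]; apply/val_inj; rewrite /= jz.
Qed.

End BorelCells.

Lemma eq_small_dist (R : realType) (a b C : R) :
  (forall t, 0 < t -> `|a - b| <= C * t) -> a = b.
Proof.
move=> H; apply/eqP; rewrite -subr_eq0 -normr_le0; apply/ler_addgt0Pr => e e0.
rewrite add0r; have C1 : 0 < `|C| + 1 by rewrite ltr_wpDl.
apply: le_trans (H (e / (`|C| + 1)) _) _; first by rewrite divr_gt0.
rewrite mulrA ler_pdivrMr// mulrC; apply: ler_wpM2l; first exact: ltW.
by apply: le_trans (ler_norm _) _; rewrite lerDl.
Qed.

(** * Approximation of a random direction by finitely many *)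

Section Discretization.
Context {R : realType} {d : nat} {disp : measure_display}
  {Omega : measurableType disp}.
Variable P : probability Omega R.
Implicit Types (phi : 'rV[R]_d -> R) (E : normedZmodType R).

Definition sphere_lipschitz (L : R) phi := forall z z',
  enorm z = 1 -> enorm z' = 1 -> `|phi z - phi z'| <= L * enorm (z - z').

Lemma loclip_sphere E (Phi : E * 'rV[R]_d -> R) (r : R) : loclip Phi ->
  exists2 L, 0 <= L & forall x, `|x| <= r ->
    sphere_lipschitz L (fun z => Phi (x, z)).
Proof.
move=> /(_ (Num.max r 1))[L L0 H]; exists L => // x xr z z' z1 z'1.
have S (y : 'rV[R]_d) : enorm y = 1 -> `|y| <= Num.max r 1.
  by move=> y1; rewrite le_max orbC (le_trans (normr_le_enorm _)) ?y1.
have B (y : 'rV[R]_d) : enorm y = 1 -> `|(x, y)| <= Num.max r 1.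
  by move=> y1; rewrite ge_max S// le_max xr.
have /le_trans := H _ _ (B _ z1) (B _ z'1); apply; rewrite ler_wpM2l//.
by rewrite ge_max /= subrr normr0 enorm_ge0 normr_le_enorm.
Qed.

Lemma loclip_sphere1 phi : loclip phi -> exists2 L, 0 <= L & sphere_lipschitz L phi.
Proof.
move=> fl; have /(loclip_sphere 0)[L L0 H] : loclip (fun p : R * 'rV[R]_d => phi p.2).
  by loclip_tac.
by exists L => //; apply: (H 0); rewrite normr0.
Qed.

Variable X : Omega -> 'rV[R]_d.
Hypotheses (rvX : random_vector X) (X1 : forall w, enorm (X w) = 1).

Section Cells.
Variables (t L : R) (n : nat) (e : 'I_n -> 'rV[R]_d) (A : 'I_n -> set 'rV[R]_d).
Hypotheses (e1 : forall i, enorm (e i) = 1) (bA : forall i, borel (A i)).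
Hypothesis eA : forall z, enorm z = 1 -> exists2 i, enorm (z - e i) <= t &
  forall j, A j z <-> j = i.
Variable H : 'rV[R]_d -> Omega -> R.
Hypotheses (L0 : 0 <= L) (HL : forall w, sphere_lipschitz L (H^~ w)).
Hypothesis bH : forall i, bounded_rv (H (e i)).

Lemma bounded_rv_cells :
  bounded_rv (fun w => \sum_i H (e i) w * \1_(X @^-1` A i) w).
Proof.
apply: bounded_rv_sum => i; apply: bounded_rvM => //.
by apply: bounded_rv_indic; exact: rvX.
Qed.

Lemma cells_dist w :
  `|H (X w) w - \sum_i H (e i) w * \1_(X @^-1` A i) w| <= L * t.
Proof.
have [i Xi Hi] := eA (X1 w).
rewrite (bigD1 i)// big1 => [|j ji].
  rewrite [X in _ - X]addr0 indicE mem_set ?mulr1; last exact/(Hi i).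
  by have /le_trans := HL w (X1 w) (e1 i); apply; rewrite ler_wpM2l.
by rewrite indicE memNset ?mulr0//= => /Hi ji'; rewrite ji' eqxx in ji.
Qed.

End Cells.

(** Freezing the direction at the centres of small cells turns [H (X w) w] into a finite sum with
    uniformly small error, so measurability for each fixed direction suffices. *)
Lemma bounded_rv_discretize (L : R) (H : 'rV[R]_d -> Omega -> R) :
  0 <= L -> (forall w, sphere_lipschitz L (H^~ w)) ->
  (forall z, enorm z = 1 -> bounded_rv (H z)) ->
  bounded_rv (fun w => H (X w) w).
Proof.
move=> L0 HL bH; apply: bounded_rv_approx => t t0.
have [|n [e e1 [A bA eA]]] := @sphere_cells R d (t / (L + 1)).
  by rewrite divr_gt0// ltr_wpDl.
exists (fun w => \sum_i H (e i) w * \1_(X @^-1` A i) w).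
  by apply: bounded_rv_cells => // i; exact: bH.
move=> w; apply: le_trans (cells_dist e1 eA L0 HL w) _.
by rewrite mulrA ler_pdivrMr ?ltr_wpDl// mulrC ler_wpM2l ?ltW// ltrDl.
Qed.

Lemma bounded_rv_sphere phi : loclip phi -> bounded_rv (fun w => phi (X w)).
Proof.
move=> /loclip_sphere1[L L0 H].
apply: (bounded_rv_discretize (H := fun z _ => phi z) L0) => // z _.
exact: bounded_rv_cst.
Qed.

End Discretization.

(** * Means over a random direction *)

Section SphericalMean.
Context {R : realType} {d : nat} {disp : measure_display}
  {Omega : measurableType disp}.
Variable P : probability Omega R.
Implicit Types (phi : 'rV[R]_d -> R) (X Y : Omega -> 'rV[R]_d).
Implicit Types (E : normedZmodType R).

Definition sphere_rv X := random_vector X /\ forall w, enorm (X w) = 1.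

(** The sum depends on [X] only through the probabilities of the cells, so comparison of laws and
    independence can be exploited at the level of such sums. *)
Lemma quadrature (t L : R) n (e : 'I_n -> 'rV[R]_d) (A : 'I_n -> set 'rV[R]_d)
    X phi :
  sphere_rv X ->
  (forall i, enorm (e i) = 1) -> (forall i, borel (A i)) ->
  (forall z, enorm z = 1 -> exists2 i, enorm (z - e i) <= t &
    forall j, A j z <-> j = i) ->
  0 <= L -> loclip phi -> sphere_lipschitz L phi ->
  `|mean P (fun w => phi (X w)) - \sum_i phi (e i) * fine (P (X @^-1` A i))|
    <= L * t.
Proof.
move=> [rvX X1] e1 bA eA L0 fl HL.
have b1 i : bounded_rv (\1_(X @^-1` A i) : Omega -> R).
  by apply: bounded_rv_indic; exact: rvX.
have -> : \sum_i phi (e i) * fine (P (X @^-1` A i)) =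
    mean P (fun w => \sum_i phi (e i) * \1_(X @^-1` A i) w).
  rewrite mean_sum => [|i]; last exact: bounded_rvM (bounded_rv_cst _) _.
  by apply: eq_bigr => i _; rewrite meanZ// mean_indic//; exact: rvX.
apply: mean_dist => [||w]; first exact: bounded_rv_sphere.
  by apply: bounded_rv_sum => i; exact: bounded_rvM (bounded_rv_cst _) _.
exact: (cells_dist X1 e1 eA (H := fun z _ => phi z)).
Qed.

Lemma mean_same_law X Y phi : sphere_rv X -> sphere_rv Y ->
  (forall A, borel A -> P (X @^-1` A) = P (Y @^-1` A)) -> loclip phi ->
  mean P (fun w => phi (X w)) = mean P (fun w => phi (Y w)).
Proof.
move=> sX sY XY fl; have [L L0 HL] := loclip_sphere1 fl.
apply: (@eq_small_dist _ _ _ (2 * L)) => t t0.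
have [n [e e1 [A bA eA]]] := @sphere_cells R d _ t0.
have := quadrature sX e1 bA eA L0 fl HL.
have := quadrature sY e1 bA eA L0 fl HL.
under eq_bigr => i _ do rewrite -XY//.
set S := \sum_i _; rewrite distrC => h1 h2.
rewrite -(subrK S (mean _ _)) -addrA (le_trans (ler_normD _ _))//.
by rewrite -mulrA mulr_natl mulr2n lerD.
Qed.

Lemma loclip_spherical_mean E X (Phi : E * 'rV[R]_d -> R) : sphere_rv X ->
  loclip Phi -> loclip (fun x => mean P (fun w => Phi (x, X w))).
Proof.
move=> [rvX X1] Pl r; have [L L0 HL] := Pl (Num.max r 1).
have b (x : E) : bounded_rv (fun w => Phi (x, X w)).
  by apply: (bounded_rv_sphere rvX X1 (phi := fun z => Phi (x, z))); loclip_tac.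
exists L => // x y xr yr; apply: mean_dist => // w.
have S : `|X w| <= Num.max r 1.
  by rewrite le_max orbC (le_trans (normr_le_enorm _)) ?X1.
apply: le_trans (HL _ _ _ _) _; rewrite ?ge_max ?S ?andbT ?le_max ?xr ?yr//.
by rewrite ler_wpM2l// ge_max /= subrr normr0 lexx normr_ge0.
Qed.

(** Quadrature in the first variable reduces the exchange to linearity of the mean in the second;
    [lip1] makes the error uniform in the second variable. *)
Lemma spherical_mean_exchange X Y (Phi : 'rV[R]_d * 'rV[R]_d -> R) :
  sphere_rv X -> sphere_rv Y -> loclip Phi ->
  mean P (fun w => mean P (fun w' => Phi (X w, Y w'))) =
  mean P (fun w' => mean P (fun w => Phi (X w, Y w'))).
Proof.
move=> sX sY Pl; have [L L0 HL] := Pl 1.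
have l1 z : loclip (fun x => Phi (x, z)) by loclip_tac.
have l2 z : loclip (fun x => Phi (z, x)) by loclip_tac.
have S (z : 'rV[R]_d) : enorm z = 1 -> `|z| <= 1.
  by move=> <-; exact: normr_le_enorm.
have lip1 z : enorm z = 1 -> sphere_lipschitz L (fun x => Phi (x, z)).
  move=> z1 x y x1 y1; apply: le_trans (HL _ _ _ _) _; rewrite ?ge_max ?S//=.
  by rewrite ler_wpM2l// ge_max /= normr_le_enorm subrr normr0 enorm_ge0.
apply: (@eq_small_dist _ _ _ (2 * L)) => t t0.
have [n [e e1 [A bA eA]]] := @sphere_cells R d _ t0.
have lY : loclip (fun x => mean P (fun w' => Phi (x, Y w'))).
  exact: loclip_spherical_mean.
have bX z : bounded_rv (fun w => Phi (X w, z)).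
  exact: (bounded_rv_sphere sX.1 sX.2 (phi := fun x => Phi (x, z))).
have bY z : bounded_rv (fun w => Phi (z, Y w)).
  exact: (bounded_rv_sphere sY.1 sY.2 (phi := fun x => Phi (z, x))).
have lX : loclip (fun z => mean P (fun w => Phi (X w, z))).
  apply: (loclip_spherical_mean (Phi := fun p => Phi (p.2, p.1))) => //.
  by loclip_tac.
have lipY : sphere_lipschitz L (fun x => mean P (fun w' => Phi (x, Y w'))).
  by move=> x y x1 y1; apply: mean_dist => // w; apply: lip1 => //; exact: sY.2.
have h1 := quadrature sX e1 bA eA L0 lY lipY.
set S1 := \sum_i _ in h1.
suff h2 : `|S1 - mean P (fun w' => mean P (fun w => Phi (X w, Y w')))| <= L * t.
  rewrite -(subrK S1 (mean _ _)) -addrA (le_trans (ler_normD _ _))//.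
  by rewrite -mulrA mulr_natl mulr2n lerD.
have -> : S1 = mean P (fun w' => \sum_i fine (P (X @^-1` A i)) * Phi (e i, Y w')).
  rewrite mean_sum => [|i]; last exact: bounded_rvM (bounded_rv_cst _) _.
  by apply: eq_bigr => i _; rewrite meanZ// mulrC.
apply: mean_dist => [||w].
- by apply: bounded_rv_sum => i; exact: bounded_rvM (bounded_rv_cst _) _.
- exact: (bounded_rv_sphere sY.1 sY.2 (phi := fun z => mean P (fun w => Phi (X w, z)))).
rewrite distrC; under eq_bigr => i _ do rewrite mulrC.
exact: (quadrature sX e1 bA eA L0 (l1 _) (lip1 _ (sY.2 w))).
Qed.

End SphericalMean.

(** * Markov's property for chains driven by independent directions *)

Section MarkovProperty.
Context {R : realType} {d : nat} {disp : measure_display}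
  {Omega : measurableType disp}.
Variables (P : probability Omega R) (theta : nat -> Omega -> 'rV[R]_d).
Hypotheses (theta_sphere : forall n, sphere_rv (theta n))
  (theta_indep : mutually_independent P theta).
Variables (E : normedZmodType R) (step : nat -> E * 'rV[R]_d -> E) (y0 : E).
Hypothesis step_lip : forall n, loclip (step n).

Fixpoint chain n w := if n is m.+1 then step m (chain m w, theta m w) else y0.

Lemma chain_bounded n : exists r : R, forall w, `|chain n w| <= r.
Proof.
elim: n => [|n [r IH]] /=; first by exists `|y0|.
have [M _ HM] := loclip_bounded (Num.max r 1) (step_lip n).
exists M => w; apply: HM; rewrite ge_max !le_max IH/=.
by rewrite -((theta_sphere n).2 w) normr_le_enorm orbT.
Qed.


Lemma bounded_rv_chain n (phi : E -> R) :
  loclip phi -> bounded_rv (fun w => phi (chain n w)).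
Proof.
elim: n phi => [|n IH] phi pl /=; first exact: bounded_rv_cst.
have cl : loclip (fun p => phi (step n p)) by loclip_tac.
have [r Hr] := chain_bounded n.
have [L L0 HL] := loclip_sphere r cl.
have [rvX X1] := theta_sphere n.
apply: (bounded_rv_discretize rvX X1
  (H := fun z w => phi (step n (chain n w, z))) L0) => [w|z _].
  exact: HL.
apply: (IH (fun y => phi (step n (y, z)))).
apply: (loclip_comp (g := fun p => phi (step n p))) => //; loclip_tac.
Qed.

Definition rectangle (J : {fset nat}) (A : nat -> set 'rV[R]_d) :=
  \bigcap_(j in [set` J]) (theta j @^-1` A j).

Lemma measurable_rectangle J A : (forall j, j \in J -> borel (A j)) ->
  measurable (rectangle J A).
Proof.
move=> bA; apply: fin_bigcap_measurable => // j /= jJ.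
exact: (theta_sphere j).1 (bA _ jJ).
Qed.

(* Besides the chain at time n, all the directions from time n on are carried
   along, so that the induction can peel off theta n. *)
Lemma mean_chain_rectangle n (phi : E -> R) J A : loclip phi ->
  (forall j, j \in J -> borel (A j)) -> (forall j, j \in J -> (n <= j)%N) ->
  mean P (fun w => phi (chain n w) * \1_(rectangle J A) w) =
  mean P (fun w => phi (chain n w)) * fine (P (rectangle J A)).
Proof.
elim: n phi J A => [|n IH] phi J A pl bA nJ.
  rewrite /= meanZ ?mean_cst; last first.
    by apply: bounded_rv_indic; exact: measurable_rectangle.
  by rewrite mean_indic//; exact: measurable_rectangle.
have bB : bounded_rv (\1_(rectangle J A) : Omega -> R).
  by apply: bounded_rv_indic; exact: measurable_rectangle.
have cl : loclip (fun p => phi (step n p)) by loclip_tac.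
have [r Hr] := chain_bounded n; have [L L0 HL] := loclip_sphere r cl.
have [rvX X1] := theta_sphere n.
apply: (@eq_small_dist _ _ _ (2 * L)) => t t0.
have [m [e e1 [C bC eC]]] := @sphere_cells R d _ t0.
pose psi i y := phi (step n (y, e i)).
have psil i : loclip (psi i).
  by apply: (loclip_comp (g := fun p => phi (step n p))) => //; loclip_tac.
have bpsi i : bounded_rv (fun w => psi i (chain n w)) by exact: bounded_rv_chain.
have bC1 i : bounded_rv (\1_(theta n @^-1` C i) : Omega -> R).
  by apply: bounded_rv_indic; exact: rvX.
pose S w := \sum_i psi i (chain n w) * \1_(theta n @^-1` C i) w.
have bS : bounded_rv S by apply: bounded_rv_sum => i; exact: bounded_rvM.
have Sphi w : `|phi (chain n.+1 w) - S w| <= L * t.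
  apply: (cells_dist X1 e1 eC (H := fun z w => phi (step n (chain n w, z))) L0).
  by move=> w'; exact: HL.
(* The event that [theta n] lies in cell [i] becomes a constraint of the rectangle at the index [n],
   which is not in [J] because the indices in [J] exceed [n]. *)
pose A' i j := if j == n then C i else A j.
have nJ' : n \notin J by apply/negP => /nJ; rewrite ltnn.
have A'J i : {in J, forall j, A' i j = A j}.
  move=> j jJ; rewrite /A'; case: eqP => // jn.
  by move: nJ'; rewrite -jn jJ.
have rect i : rectangle (n |` J)%fset (A' i) =
    theta n @^-1` C i `&` rectangle J A.
  apply/seteqP; split => w /=.
    move=> H; split=> [|j /= jJ].
      by have := H n; rewrite /= fset1U1 /A' eqxx; apply.
    by rewrite -(A'J i)//; apply: H; rewrite /= in_fset1U jJ orbT.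
  move=> [Cw Hw] j /=; rewrite in_fset1U => /orP[/eqP->|jJ].
    by rewrite /A' eqxx.
  by rewrite A'J//; exact: Hw.
have bA' i j : j \in (n |` J)%fset -> borel (A' i j).
  by rewrite in_fset1U /A'; case: eqP => //= _; exact: bA.
have Prect i : fine (P (rectangle (n |` J)%fset (A' i))) =
    fine (P (theta n @^-1` C i)) * fine (P (rectangle J A)).
  rewrite /rectangle !theta_indep//; last exact: bA'.
  rewrite big_fsetU1//= {1}/A' eqxx fineM//; last 2 first.
    exact: fin_num_measure (rvX _ (bC i)).
    rewrite -theta_indep => [|j jJ]; last by apply: bA'; rewrite in_fset1U jJ orbT.
    apply: fin_num_measure; apply: measurable_rectangle => j jJ.
    by apply: bA'; rewrite in_fset1U jJ orbT.
  congr (_ * fine _); rewrite big_seq [RHS]big_seq; apply: eq_bigr => j jJ.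
  by rewrite A'J.
have SB : mean P (fun w => S w * \1_(rectangle J A) w) =
    mean P S * fine (P (rectangle J A)).
  rewrite mean_sum => [|i]; last exact: bounded_rvM.
  transitivity (mean P (fun w => \sum_i psi i (chain n w) *
      \1_(rectangle (n |` J)%fset (A' i)) w)).
    congr mean; apply/funext => w; rewrite mulr_suml; apply: eq_bigr => i _.
    by rewrite rect indicI /= mulrA.
  rewrite mean_sum => [|i]; last first.
    apply: bounded_rvM => //; apply: bounded_rv_indic; apply: measurable_rectangle.
    exact: bA'.
  rewrite mulr_suml; apply: eq_bigr => i _.
  rewrite IH//; last 2 first.
  - exact: bA'.
  - by move=> j; rewrite in_fset1U => /orP[/eqP->//|/nJ/ltnW].
  rewrite Prect mulrA; congr (_ * _).
  (* The induction hypothesis with the single constraint at [n] reassembles the mean of [S]. *)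
  have := IH (psi i) [fset n]%fset (fun=> C i) (psil i).
  have -> : rectangle [fset n]%fset (fun=> C i) = theta n @^-1` C i.
    apply/seteqP; split => w /= H; first by apply: (H n); rewrite /= inE.
    by move=> j /=; rewrite inE => /eqP->.
  by move=> -> // j; rewrite inE => /eqP->.
have bphi := bounded_rv_chain n.+1 pl.
have h1 : `|mean P (fun w => phi (chain n.+1 w) * \1_(rectangle J A) w) -
    mean P (fun w => S w * \1_(rectangle J A) w)| <= L * t.
  apply: mean_dist => [||w]; [exact: bounded_rvM|exact: bounded_rvM|].
  rewrite -mulrBl normrM; apply: le_trans (Sphi w); apply: ler_piMr => //.
  by rewrite indicE; case: (_ \in _); rewrite ?normr1 ?normr0.
have h2 : `|mean P S * fine (P (rectangle J A)) -
   mean P (fun w => phi (chain n.+1 w)) * fine (P (rectangle J A))| <= L * t.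
  rewrite -mulrBl normrM distrC; apply: le_trans (mean_dist P bphi bS Sphi).
  apply: ler_piMr => //; rewrite -mean_indic; last exact: measurable_rectangle.
  have bc (c : R) : bounded_rv (fun _ : Omega => c) by exact: bounded_rv_cst.
  rewrite ger0_norm.
    rewrite -[leRHS](mean_cst P); apply: ler_mean => //.
  rewrite -(mean_cst P 0); exact: ler_mean.
rewrite SB in h1; have := lerD h1 h2; rewrite -mulrDl -mulr2n -[L *+ 2]mulr_natl.
move=> h; apply: le_trans h; apply: le_trans (ler_normD _ _).
by rewrite addrA subrK.
Qed.

(** The current direction may be averaged with the chain held fixed: on a finite sum over cells this
    is the independence of [chain n] and the single direction [theta n]. *)
Lemma mean_chain_step n (H : E * 'rV[R]_d -> R) : loclip H ->
  mean P (fun w => H (chain n w, theta n w)) =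
  mean P (fun w => mean P (fun w' => H (chain n w, theta n w'))).
Proof.
move=> Hl.
have [r Hr] := chain_bounded n; have [L L0 HL] := loclip_sphere r Hl.
have [rvX X1] := theta_sphere n.
apply: (@eq_small_dist _ _ _ (2 * L)) => t t0.
have [m [e e1 [C bC eC]]] := @sphere_cells R d _ t0.
have l2 y : loclip (fun z => H (y, z)) by loclip_tac.
have l1 z : loclip (fun y => H (y, z)) by loclip_tac.
have lm : loclip (fun y => mean P (fun w' => H (y, theta n w'))).
  exact: loclip_spherical_mean.
have bpsi i : bounded_rv (fun w => H (chain n w, e i)).
  exact: (bounded_rv_chain n (l1 (e i))).
have bC1 i : bounded_rv (\1_(theta n @^-1` C i) : Omega -> R).
  by apply: bounded_rv_indic; exact: rvX.
pose S w := \sum_i H (chain n w, e i) * \1_(theta n @^-1` C i) w.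
have bS : bounded_rv S by apply: bounded_rv_sum => i; exact: bounded_rvM.
have SH w : `|H (chain n w, theta n w) - S w| <= L * t.
  apply: (cells_dist X1 e1 eC (H := fun z w => H (chain n w, z)) L0).
  by move=> w'; exact: HL.
have bH : bounded_rv (fun w => H (chain n w, theta n w)).
  apply: (bounded_rv_discretize rvX X1 (H := fun z w => H (chain n w, z)) L0).
    by move=> w; exact: HL.
  by move=> z _; exact: (bounded_rv_chain n (l1 z)).
have h1 := mean_dist P bH bS SH.
pose S' w := \sum_i fine (P (theta n @^-1` C i)) * H (chain n w, e i).
have bS' : bounded_rv S'.
  by apply: bounded_rv_sum => i; exact: bounded_rvM (bounded_rv_cst _) _.
have SS' : mean P S = mean P S'.
  rewrite !mean_sum => [|i|i]; last 2 first.
  - exact: bounded_rvM (bounded_rv_cst _) _.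
  - exact: bounded_rvM.
  apply: eq_bigr => i _; rewrite meanZ// mulrC.
  have := @mean_chain_rectangle n (fun y => H (y, e i)) [fset n]%fset (fun=> C i).
  have -> : rectangle [fset n]%fset (fun=> C i) = theta n @^-1` C i.
    apply/seteqP; split => w /= Hw; first by apply: (Hw n); rewrite /= inE.
    by move=> j /=; rewrite inE => /eqP->.
  by move=> -> //= j; rewrite inE => /eqP->.
have h2 : `|mean P S' - mean P (fun w => mean P (fun w' =>
    H (chain n w, theta n w')))| <= L * t.
  apply: mean_dist => // [|w]; first exact: (bounded_rv_chain n lm).
  rewrite distrC /S'; under eq_bigr => i _ do rewrite mulrC.
  exact: (quadrature P (theta_sphere n) e1 bC eC L0 (l2 _) (HL _ (Hr w))).
rewrite -SS' in h2; have := lerD h1 h2; rewrite -mulrDl -mulr2n -[L *+ 2]mulr_natl.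
move=> h; apply: le_trans h; apply: le_trans (ler_normD _ _).
by rewrite addrA subrK.
Qed.

End MarkovProperty.

(** * Spherical averages and cap kernels *)

Section SphericalAverages.
Context {R : realType} {d : nat}.
Variable J : ('rV[R]_d -> R) -> R.
Hypothesis sJ : spherical_average J.
Implicit Types (f g : 'rV[R]_d -> R) (u x y z e : 'rV[R]_d).

Lemma eq_savg f g : loclip f -> loclip g ->
  (forall z, enorm z = 1 -> f z = g z) -> J f = J g.
Proof.
move=> fl gl fg; apply/eqP; rewrite eq_le.
by apply/andP; split; apply: (ler_savg sJ) => // z z1; rewrite fg.
Qed.

Lemma savgN f : loclip f -> J (fun z => - f z) = - J f.
Proof.
move=> fl; rewrite -mulN1r -(savgZ sJ)//; congr J.
by apply/funext => z; rewrite mulN1r.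
Qed.

Lemma savgB f g : loclip f -> loclip g ->
  J (fun z => f z - g z) = J f - J g.
Proof. by move=> fl gl; rewrite (savgD sJ)// ?savgN//; exact: loclipN. Qed.

Lemma savg_le_cst f (c : R) : loclip f ->
  (forall z, enorm z = 1 -> f z <= c) -> J f <= c.
Proof.
move=> fl fc; rewrite -[leRHS](savg_cst sJ).
by apply: (ler_savg sJ) => //; exact: loclip_cst.
Qed.

Lemma savg_ge_cst f (c : R) : loclip f ->
  (forall z, enorm z = 1 -> c <= f z) -> c <= J f.
Proof.
move=> fl fc; rewrite -[leLHS](savg_cst sJ).
by apply: (ler_savg sJ) => //; exact: loclip_cst.
Qed.

Lemma savg_reflection u f : loclip f -> J (fun z => f (reflection u z)) = J f.
Proof.
apply: (savg_isometry sJ); first exact: reflectionK.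
  by move=> x y; rewrite -reflectionB enorm_reflection.
by move=> x; rewrite enorm_reflection.
Qed.

Lemma savg_opp f : loclip f -> J (fun z => f (- z)) = J f.
Proof.
apply: (savg_isometry sJ); first exact: opprK.
  by move=> x y; rewrite -opprD enormN.
by move=> x; rewrite enormN.
Qed.

Lemma loclip_reflection u : loclip (reflection u).
Proof.
move=> r.
have : loclip (fun x => x - (2 * dotp x u / dotp u u) *: u).
  have dl : loclip (fun x => dotp x u).
    apply: (@loclip_lipschitz _ _ _ (enorm u)) => x y.
    have D a b : dotp a u - dotp b u = dotp (a - b) u by rewrite dotpDl dotpNl.
    rewrite ler_norml D mulrC CauchySchwarz_dotp andbT -[leRHS]opprK -dotpNl.
    by rewrite lerN2 -(enormN (x - y)) CauchySchwarz_dotp.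
  have zl : loclip (fun x => 2 * dotp x u / dotp u u) by loclip_tac.
  by loclip_tac.
exact.
Qed.

Variable e0 : 'rV[R]_d.
Hypothesis e01 : enorm e0 = 1.

(** As a function of [z] on the sphere, a tent around the direction of [x]. The scaling by [enorm x]
    keeps it locally Lipschitz at [x = 0], where the direction is undefined. *)
Definition cap (t : R) z x : R :=
  Num.max 0 (t * enorm x - enorm (enorm x *: z - x)).

Lemma cap_ge0 t z x : 0 <= cap t z x.
Proof. by rewrite /cap le_max lexx. Qed.

Lemma cap_reflection t u z x :
  cap t (reflection u z) (reflection u x) = cap t z x.
Proof.
by rewrite /cap enorm_reflection -reflectionZ -reflectionB enorm_reflection.
Qed.

Lemma cap_dist t z x : cap t z x != 0 -> enorm (enorm x *: z - x) <= t * enorm x.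
Proof.
rewrite /cap leNgt; apply: contra => h.
by rewrite max_l// subr_le0 ltW.
Qed.

Lemma loclip_cap (E : normedZmodType R) t (f g : E -> 'rV[R]_d) :
  loclip f -> loclip g -> loclip (fun p => cap t (f p) (g p)).
Proof. by move=> fl gl; rewrite /cap; loclip_tac. Qed.

(** Homogeneity and reflection invariance reduce the mass to the case [x = e0]. It is positive
    because finitely many tents, all of mass [b], cover the sphere. *)
Lemma savg_cap t : 0 < t ->
  exists2 b : R, 0 < b & forall x, J (fun z => cap t z x) = enorm x * b.
Proof.
move=> t0; pose b := J (fun z => cap t z e0).
have l x : loclip (fun z => cap t z x) by apply: loclip_cap; loclip_tac.
have Jb x : J (fun z => cap t z x) = enorm x * b.
  pose u := x - enorm x *: e0.
  have ux : reflection u x = enorm x *: e0.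
    by apply: reflection_swap; rewrite enormZ e01 mulr1 ger0_norm// enorm_ge0.
  have bl : loclip (fun z => enorm x * cap t z e0).
    by apply: loclipM => //; exact: loclip_cst.
  rewrite /b -(savgZ sJ)// -(savg_reflection u bl).
  congr J; apply/funext => z.
  rewrite -(cap_reflection _ u) ux /cap e01 enormZ e01 !mulr1.
  rewrite (ger0_norm (enorm_ge0 x)) maxr_pMr ?enorm_ge0// mulr0.
  rewrite scale1r mulrBr (mulrC (enorm x)); congr (Num.max _ (_ - _)).
  by rewrite -scalerBr enormZ ger0_norm ?enorm_ge0.
exists b => //.
have t2 : 0 < t / 2 by rewrite divr_gt0.
have [s s1 Hs] := @compact_net R d unit_sphere (t / 2) compact_unit_sphere t2.
have [sl Jsum] : loclip (fun z => \sum_(e <- s) cap t z e) /\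
    J (fun z => \sum_(e <- s) cap t z e) = (size s)%:R * b.
  elim: s s1 {Hs} => [|e s IH] s1.
    under eq_fun do rewrite big_nil.
    by rewrite (savg_cst sJ) mul0r; split=> //; exact: loclip_cst.
  under eq_fun do rewrite big_cons.
  have [l1 l2] := IH (fun x xs => s1 x (mem_behead (s := e :: s) xs)).
  split; first exact: loclipD.
  rewrite (savgD sJ)// l2 Jb -natr1 mulrDl mul1r addrC.
  by rewrite (s1 e (mem_head _ _) : enorm e = 1) mul1r.
(* Some centre lies within [t / 2] of [z], and its tent has height at least [t - t / 2] there. *)
have : t / 2 <= J (fun z => \sum_(e <- s) cap t z e).
  apply: savg_ge_cst => // z z1.
  have /hasP[e es ze] := Hs z z1.
  rewrite (big_rem e es)/= -[leLHS]addr0 lerD//; last first.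
    by apply: sumr_ge0 => x _; exact: cap_ge0.
  rewrite /cap (s1 e es : enorm e = 1) scale1r mulr1 le_max; apply/orP; right.
  by move: ze; lra.
rewrite Jsum => h; have : 0 < (size s)%:R * b by apply: lt_le_trans h.
rewrite ltNge => h'; rewrite ltNge; apply: contra h' => b0.
by rewrite mulr_ge0_le0.
Qed.

End SphericalAverages.

(** * Radial averaging under a rotation-invariant law *)

Section InvariantLaw.
Context {R : realType} {d : nat}.
Variable J : ('rV[R]_d -> R) -> R.
Hypothesis sJ : spherical_average J.
Variable e0 : 'rV[R]_d.
Hypothesis e01 : enorm e0 = 1.
Implicit Types (f g : 'rV[R]_d -> R) (u w x y z : 'rV[R]_d).
Variables (a eps : R).

(** Mean of [f] under the law of the sum of two independent jumps from the origin, of sizes [a] and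
    [eps]. *)
Definition two_step f := J (fun z => J (fun z' => f (a *: z + eps *: z'))).

Let r := `|a| + `|eps|.

Lemma two_step_range z z' : enorm z = 1 -> enorm z' = 1 ->
  enorm (a *: z + eps *: z') <= r.
Proof.
by move=> z1 z'1; rewrite (le_trans (ler_enormD _ _))// !enormZ z1 z'1 !mulr1.
Qed.

Lemma loclip_two_step (E : normedZmodType R) (F : E * 'rV[R]_d -> R) :
  loclip F -> loclip (fun x : E => two_step (fun w => F (x, w))).
Proof. by move=> Fl; rewrite /two_step; loclip_tac. Qed.

Lemma ler_two_step f g : loclip f -> loclip g ->
  (forall w, enorm w <= r -> f w <= g w) -> two_step f <= two_step g.
Proof.
move=> fl gl fg; apply: (ler_savg sJ) => [||z z1]; [by loclip_tac..|].
apply: (ler_savg sJ) => [||z' z'1]; [by loclip_tac..|].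
exact/fg/two_step_range.
Qed.

Lemma two_stepD f g : loclip f -> loclip g ->
  two_step (fun w => f w + g w) = two_step f + two_step g.
Proof.
move=> fl gl; rewrite /two_step -(savgD sJ); [|by loclip_tac..].
congr J; apply/funext => z; rewrite (savgD sJ)//; by loclip_tac.
Qed.

Lemma two_stepZ c f : loclip f ->
  two_step (fun w => c * f w) = c * two_step f.
Proof.
move=> fl; rewrite /two_step -(savgZ sJ); last by loclip_tac.
congr J; apply/funext => z; rewrite (savgZ sJ)//; by loclip_tac.
Qed.

Lemma two_stepN f : loclip f -> two_step (fun w => - f w) = - two_step f.
Proof.
move=> fl; rewrite -mulN1r -two_stepZ//; congr two_step.
by apply/funext => w; rewrite mulN1r.
Qed.

Lemma two_step_reflection u f : loclip f ->
  two_step (fun w => f (reflection u w)) = two_step f.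
Proof.
move=> fl; have lr := @loclip_reflection R d u; rewrite /two_step.
rewrite -(savg_reflection sJ u (f := fun z => J (fun z' => f (a *: z + eps *: z'))));
  last by loclip_tac.
congr J; apply/funext => z.
rewrite -(savg_reflection sJ u (f := fun z' => f (a *: reflection u z + eps *: z')));
  last by loclip_tac.
by congr J; apply/funext => z'; rewrite reflectionD !reflectionZ.
Qed.

Lemma two_step_exchange (F : 'rV[R]_d * 'rV[R]_d -> R) : loclip F ->
  two_step (fun w => J (fun z => F (z, w))) = J (fun z => two_step (fun w => F (z, w))).
Proof.
move=> Fl; rewrite /two_step.
rewrite (savg_exchange sJ (F := fun p =>
  J (fun z' => F (p.1, a *: p.2 + eps *: z')))); last by loclip_tac.
congr J; apply/funext => z.
by rewrite (savg_exchange sJ (F := fun p => F (p.2, a *: z + eps *: p.1))); last by loclip_tac.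
Qed.

(* Averaging against the kernel [cap t] compares f w with f on the sphere of
   radius |w| near w; by invariance the kernel decouples from the law of w. *)
Lemma two_step_radial_weighted_le f : loclip f ->
  two_step (fun w => f w * enorm w) <=
  two_step (fun w => J (fun z => f (enorm w *: z)) * enorm w).
Proof.
move=> fl; have r0 : 0 <= r by rewrite addr_ge0.
have [L L0 HL] := fl r.
apply/ler_addgt0Pr => c c0.
(* The kernel compares points at distance at most [t * r], so after division by [b] the error is
   [L * (t * r) * r], which is at most [c]; adding 1 keeps the denominator positive. *)
pose t := c / (L * r * r + 1).
have t0 : 0 < t by rewrite divr_gt0// ltr_wpDl// !mulr_ge0.
have [b b0 Hb] := savg_cap sJ e01 t0.
have cl (E : normedZmodType R) (g h : E -> 'rV[R]_d) : loclip g -> loclip h ->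
    loclip (fun p => cap t (g p) (h p)) by exact: loclip_cap.
have near z w : enorm z = 1 -> enorm w <= r ->
    f w * cap t z w <= f (enorm w *: z) * cap t z w + L * (t * r) * cap t z w.
  move=> z1 wr; have [->|k0] := eqVneq (cap t z w) 0; first by rewrite !mulr0 addr0.
  rewrite -mulrDl ler_wpM2r ?cap_ge0// -lerBlDl.
  rewrite (le_trans (ler_norm _))// (le_trans (HL _ _ _ _))//.
  - by rewrite (le_trans (normr_le_enorm _)).
  - by rewrite (le_trans (normr_le_enorm _))// enormZ z1 mulr1 ger0_norm ?enorm_ge0.
  rewrite ler_wpM2l// (le_trans (normr_le_enorm _))// enormBC.
  by rewrite (le_trans (cap_dist k0))// ler_wpM2l// ltW.
have cl1 : loclip (fun p : 'rV[R]_d * 'rV[R]_d => cap t p.1 p.2).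
  by apply: cl; loclip_tac.
have fcl : loclip (fun p : 'rV[R]_d * 'rV[R]_d =>
    f (enorm p.2 *: p.1) * cap t p.1 p.2).
  by apply: loclipM => //; loclip_tac.
have el : loclip (@enorm R d) by apply: loclip_enorm; exact: loclip_id.
have step1 : two_step (fun w => f w * enorm w) * b <=
    two_step (fun w => J (fun z => f (enorm w *: z) * cap t z w)) +
    L * (t * r) * r * b.
  rewrite mulrC -two_stepZ; last by loclip_tac.
  have -> : L * (t * r) * r * b = two_step (fun _ => L * (t * r) * r * b).
    by rewrite /two_step !(savg_cst sJ).
  have l1 : loclip (fun w => J (fun z => f (enorm w *: z) * cap t z w)).
    apply: (loclip_savg sJ (F := fun p => f (enorm p.1 *: p.2) * cap t p.2 p.1)).
    by apply: loclipM; [loclip_tac|apply: cl; loclip_tac].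
  rewrite -two_stepD//; last exact: loclip_cst.
  apply: ler_two_step => [||w wr]; [by loclip_tac..|].
  have -> : b * (f w * enorm w) = J (fun z => f w * cap t z w).
    rewrite (savgZ sJ) ?Hb; first by ring.
    by apply: cl; loclip_tac.
  have -> : L * (t * r) * r * b = L * (t * r) * (r * b) by ring.
  apply: (@le_trans _ _ (J (fun z => f (enorm w *: z) * cap t z w) +
      L * (t * r) * (enorm w * b))); last first.
    have Ltr : 0 <= L * (t * r) by rewrite mulr_ge0// mulr_ge0// ltW.
    by rewrite lerD2l ler_wpM2l// ler_wpM2r// ltW.
  have cw : loclip (fun z => cap t z w) by apply: cl; loclip_tac.
  have fw : loclip (fun z => f (enorm w *: z) * cap t z w).
    by apply: loclipM => //; loclip_tac.
  have cw' : loclip (fun z => L * (t * r) * cap t z w).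
    by apply: loclipM => //; exact: loclip_cst.
  rewrite -Hb -(savgZ sJ)// -(savgD sJ)//.
  apply: (ler_savg sJ) => [||z z1]; last exact: near.
    by apply: loclipM => //; exact: loclip_cst.
  exact: loclipD.
pose G z' z := two_step (fun w => f (enorm w *: z') * cap t z w).
have Gl z' z : loclip (fun w => f (enorm w *: z') * cap t z w).
  by apply: loclipM; [loclip_tac|apply: cl; loclip_tac].
(* Reflecting [w] moves the centre of the tent from [z] to [e0] without changing [enorm w]. The
   diagonal [G z z] thus becomes [G z e0], which separates the value of [f] from the direction of
   [w]. *)
have Gz z' z : enorm z = 1 -> G z' z = G z' e0.
  move=> z1; rewrite /G -(two_step_reflection (z - e0) (Gl z' e0)).
  congr two_step; apply/funext => w; rewrite enorm_reflection.
  rewrite -(@cap_reflection _ _ t (z - e0) z w) reflection_swap//.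
  by rewrite z1.
have lG1 : loclip (fun z => G z z).
  by apply: (loclip_two_step (F := fun p => f (enorm p.2 *: p.1) * cap t p.1 p.2)).
have lG2 : loclip (fun z => G z e0).
  apply: (loclip_two_step (F := fun p => f (enorm p.2 *: p.1) * cap t e0 p.2)).
  by apply: loclipM; [loclip_tac|apply: cl; loclip_tac].
have step2 : two_step (fun w => J (fun z => f (enorm w *: z) * cap t z w)) =
    two_step (fun w => J (fun z => f (enorm w *: z)) * enorm w) * b.
  rewrite (two_step_exchange fcl) (eq_savg sJ lG1 lG2)//; last by move=> z /Gz.
  transitivity (J (fun z' => two_step (fun w => b * (f (enorm w *: z') * enorm w)))).
    congr J; apply/funext => z'.
    transitivity (J (fun z => G z' z)).
      rewrite -[LHS](savg_cst sJ); apply: (eq_savg sJ) => [||z z1].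
      - exact: loclip_cst.
      - apply: (loclip_two_step (F := fun p => f (enorm p.2 *: z') * cap t p.1 p.2)).
        by apply: loclipM => //; loclip_tac.
      - by rewrite Gz.
    rewrite -(two_step_exchange (F := fun p => f (enorm p.2 *: z') * cap t p.1 p.2));
      last by apply: loclipM => //; loclip_tac.
    congr two_step; apply/funext => w; rewrite /= (savgZ sJ) ?Hb; first by ring.
    by apply: cl; loclip_tac.
  rewrite -(two_step_exchange (F := fun p => b * (f (enorm p.2 *: p.1) * enorm p.2)));
    last by loclip_tac.
  rewrite mulrC -two_stepZ; last by loclip_tac.
  congr two_step; apply/funext => w.
  rewrite /= (savgZ sJ); last by loclip_tac.
  congr (_ * _); rewrite mulrC -(savgZ sJ); last by loclip_tac.
  by congr J; apply/funext => z; rewrite mulrC.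
move: step1; rewrite step2 -mulrDl ler_pM2r// => /le_trans; apply.
rewrite lerD2l.
have -> : L * (t * r) * r = c * (L * r * r / (L * r * r + 1)).
  rewrite /t; move: (L * r * r + 1) => k; ring.
have Lrr : 0 <= L * r * r by rewrite !mulr_ge0.
apply: ler_piMr; first exact: ltW.
by rewrite ler_pdivrMr ?mul1r ?lerDl// ltr_wpDl.
Qed.

Lemma two_step_radial_weighted f : loclip f ->
  two_step (fun w => f w * enorm w) =
  two_step (fun w => J (fun z => f (enorm w *: z)) * enorm w).
Proof.
move=> fl; apply/eqP; rewrite eq_le two_step_radial_weighted_le//=.
have el : loclip (@enorm R d) by apply: loclip_enorm; exact: loclip_id.
have := two_step_radial_weighted_le (loclipN fl).
rewrite (_ : (fun w => - f w * _) = (fun w => - (f w * enorm w))); last first.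
  by apply/funext => w; rewrite mulNr.
rewrite (_ : (fun w => J _ * _) =
    (fun w => - (J (fun z => f (enorm w *: z)) * enorm w))); last first.
  by apply/funext => w; rewrite savgN ?mulNr//; loclip_tac.
by rewrite !two_stepN ?lerN2//; loclip_tac.
Qed.

(** The weight is removed by applying the weighted identity to [f w / (enorm w + h)]: once
    [f 0 = 0], the bound [L * enorm w] on [f] makes the error at most [L * h]. *)
Lemma two_step_radial f : loclip f ->
  two_step f = two_step (fun w => J (fun z => f (enorm w *: z))).
Proof.
move=> fl; have r0 : 0 <= r by rewrite addr_ge0.
have el : loclip (@enorm R d) by apply: loclip_enorm; exact: loclip_id.
wlog f0 : f fl / f 0 = 0.
  move=> H; have gl : loclip (fun w => f w - f 0) by loclip_tac.
  have := H _ gl (subrr _); rewrite two_stepD//; last exact: loclip_cst.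
  rewrite (_ : (fun w => J _) = (fun w => J (fun z => f (enorm w *: z)) + - f 0)).
    rewrite two_stepD; [|by loclip_tac..].
    by move=> /addIr.
  by apply/funext => w; rewrite (savgD sJ) ?(savg_cst sJ)//; loclip_tac.
have [L L0 HL] := fl r.
apply: (@eq_small_dist _ _ _ (2 * L)) => h h0.
have fw w : enorm w <= r -> `|f w| <= L * enorm w.
  move=> wr; rewrite -[f w]subr0 -f0 (le_trans (HL _ _ _ _))//.
  - by rewrite (le_trans (normr_le_enorm _)).
  - by rewrite normr0.
  - by rewrite subr0 ler_wpM2l// normr_le_enorm.
have il : loclip (fun w : 'rV[R]_d => (enorm w + h)^-1).
  apply: (loclipV h0) => [w|]; first by rewrite lerDr enorm_ge0.
  by loclip_tac.
have ih w : 0 < enorm w + h by rewrite ltr_wpDl// enorm_ge0.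
pose q w := f w * (enorm w + h)^-1.
have ql : loclip q by rewrite /q; exact: loclipM.
have key g : loclip g -> (forall w, enorm w <= r -> `|g w| <= L * enorm w) ->
   `|two_step g - two_step (fun w => g w * (enorm w + h)^-1 * enorm w)| <= L * h.
  move=> gl gw.
  have gil : loclip (fun w => g w * (enorm w + h)^-1 * enorm w).
    by apply: loclipM => //; apply: loclipM.
  have D w : enorm w <= r ->
      `|g w - g w * (enorm w + h)^-1 * enorm w| <= L * h.
    move=> wr; rewrite (_ : _ - _ = g w * (h / (enorm w + h))); last first.
      by field; rewrite gt_eqF.
    rewrite normrM (gtr0_norm (divr_gt0 h0 (ih w))).
    rewrite mulrA ler_pdivrMr// mulrAC ler_wpM2r ?(ltW h0)//.
    by rewrite (le_trans (gw _ wr))// ler_wpM2l// lerDl ltW.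
  have lh : loclip (fun _ : 'rV[R]_d => L * h) by exact: loclip_cst.
  have tc : two_step (fun _ => L * h) = L * h by rewrite /two_step !(savg_cst sJ).
  rewrite ler_distl lerBlDr -tc -!two_stepD//.
  apply/andP; split; apply: ler_two_step; rewrite ?tc//.
  - exact: loclipD.
  - by move=> w /D; rewrite ler_norml => /andP[]; lra.
  - exact: loclipD.
  - by move=> w /D; rewrite ler_norml => /andP[]; lra.
have h1 := key f fl fw.
have pl : loclip (fun w => J (fun z => f (enorm w *: z))) by loclip_tac.
have pw w : enorm w <= r -> `|J (fun z => f (enorm w *: z))| <= L * enorm w.
  move=> wr.
  have B z : enorm z = 1 -> `|f (enorm w *: z)| <= L * enorm w.
    have E : enorm z = 1 -> enorm (enorm w *: z) = enorm w.
      by move=> z1; rewrite enormZ z1 mulr1 ger0_norm// enorm_ge0.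
    by move=> /E Ez; have := fw (enorm w *: z); rewrite Ez; exact.
  have fwl : loclip (fun z => f (enorm w *: z)) by loclip_tac.
  rewrite ler_norml; apply/andP; split.
    by apply: savg_ge_cst => // z /B; rewrite ler_norml => /andP[].
  by apply: savg_le_cst => // z /B; rewrite ler_norml => /andP[].
have h2 := key _ pl pw.
have := two_step_radial_weighted ql.
rewrite (_ : (fun w => J _ * _) = (fun w => J (fun z => f (enorm w *: z)) *
   (enorm w + h)^-1 * enorm w)); last first.
  apply/funext => w; congr (_ * _); rewrite mulrC -(savgZ sJ); last by loclip_tac.
  apply: (eq_savg sJ) => [||z z1]; [by loclip_tac..|].
  by rewrite /q enormZ z1 mulr1 (ger0_norm (enorm_ge0 _)) mulrC.
move=> e; rewrite -e distrC in h2.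
have := lerD h1 h2; rewrite -mulrDl -mulr2n -[L *+ 2]mulr_natl.
move=> h'; apply: le_trans h'; apply: le_trans (ler_normD _ _).
by rewrite addrA subrK.
Qed.

End InvariantLaw.

(** * A maximum principle for averages over small spheres *)

Section MaximumPrinciple.
Context {R : realType} {d : nat}.
Variable J : ('rV[R]_d -> R) -> R.
Hypothesis sJ : spherical_average J.
Variable e0 : 'rV[R]_d.
Hypothesis e01 : enorm e0 = 1.
Implicit Types (f g : 'rV[R]_d -> R) (u w x y z : 'rV[R]_d).

(* The rotational average of f about x, as a function of x + y, commutes with
   the averages over spheres of radius eps. *)
Lemma radial_mean_step f x y eps : loclip f ->
  J (fun z' => J (fun z => f (x + enorm (y + eps *: z') *: z))) =
  J (fun z => J (fun z' => f (x + enorm y *: z + eps *: z'))).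
Proof.
move=> fl; have fxl : loclip (fun w => f (x + w)) by loclip_tac.
have := two_step_radial sJ e01 (enorm y) eps fxl; rewrite /two_step.
under eq_fun do under eq_fun do rewrite addrA.
move=> ->; rewrite -[LHS](savg_cst sJ).
apply: (eq_savg sJ) => [||z z1]; [by loclip_tac..|].
(* The radial mean sees its starting point only through the norm, so a reflection carrying
   [enorm y *: z] to [y] gives the same value for every direction [z]. *)
pose u := enorm y *: z - y.
have uz : reflection u (enorm y *: z) = y.
  by apply: reflection_swap; rewrite enormZ z1 mulr1 ger0_norm// enorm_ge0.
have yl : loclip (fun z' => J (fun z => f (x + enorm (y + eps *: z') *: z))).
  by loclip_tac.
rewrite -(savg_reflection sJ u yl); congr J; apply/funext => z'.
by rewrite -{1}uz -reflectionZ -reflectionD enorm_reflection.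
Qed.

(** Adding the values at [z] and [- z] cancels the cross term. *)
Lemma savg_enorm_sqr y eps :
  J (fun z => enorm (y + eps *: z) ^+ 2) = enorm y ^+ 2 + eps ^+ 2.
Proof.
pose h z := enorm (y + eps *: z) ^+ 2.
have hl : loclip h by rewrite /h; loclip_tac.
have hl' : loclip (fun z => h (- z)) by loclip_tac.
suff : J h + J h = (enorm y ^+ 2 + eps ^+ 2) + (enorm y ^+ 2 + eps ^+ 2).
  by rewrite -/h; lra.
rewrite -{2}(savg_opp sJ hl) -(savgD sJ)// -[RHS](savg_cst sJ).
apply: (eq_savg sJ) => [||z z1]; [exact: loclipD|exact: loclip_cst|].
have zz : dotp z z = 1 by rewrite -enorm_sqr z1 expr1n.
rewrite /h !enorm_sqr !(dotpDl, dotpDr, dotpZl, dotpZr, dotpNl, dotpNr) zz.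
by ring.
Qed.

Section Comparison.
Variables (g : nat -> 'rV[R]_d -> R) (rho eps G m c : R).
Hypotheses (rho0 : 0 <= rho) (eps0 : 0 <= eps) (c0 : 0 <= c).
Hypothesis gl : forall j, loclip (g j).
Hypothesis g_step : forall j y, enorm y <= rho ->
  J (fun z => g j (y + eps *: z)) <= g j.+1 y.
Hypothesis g_shell : forall j y, rho < enorm y -> enorm y <= rho + eps -> G <= g j y.
Hypothesis g_init : forall y, enorm y <= rho + eps -> m <= g 0 y.

Let bound := c * (rho + eps) ^+ 2.

Lemma max_principle_ind j y : enorm y <= rho + eps ->
  Num.min (G - bound) (m - bound + j%:R * (c * eps ^+ 2)) <=
  g j y - c * enorm y ^+ 2.
Proof.
have cb w : enorm w <= rho + eps -> c * enorm w ^+ 2 <= bound.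
  by move=> wr; rewrite ler_wpM2l// ler_pXn2r// nnegrE ?enorm_ge0// addr_ge0.
elim: j y => [|j IH] y yr.
  by rewrite ge_min mul0r addr0 (lerB (g_init yr) (cb _ yr)) orbT.
have [yrho|yrho] := leP (enorm y) rho; last first.
  by rewrite ge_min (lerB (g_shell j.+1 yrho yr) (cb _ yr)).
set mn := Num.min _ _ in IH.
have Jgl : loclip (fun z => g j (y + eps *: z)) by loclip_tac.
have ql : loclip (fun z => c * enorm (y + eps *: z) ^+ 2) by loclip_tac.
have : mn <= J (fun z => g j (y + eps *: z) - c * enorm (y + eps *: z) ^+ 2).
  apply: savg_ge_cst => // [|z z1]; first by apply: loclipD => //; exact: loclipN.
  apply: IH; rewrite (le_trans (ler_enormD _ _))// enormZ z1 mulr1.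
  by rewrite (ger0_norm eps0) lerD.
rewrite savgB// (savgZ sJ); last by loclip_tac.
rewrite savg_enorm_sqr => h; have := g_step j yrho.
have ce : 0 <= c * eps ^+ 2 by rewrite mulr_ge0// sqr_ge0.
have : Num.min (G - bound) (m - bound + j.+1%:R * (c * eps ^+ 2)) <=
    mn + c * eps ^+ 2.
  rewrite /mn addr_minl le_min; apply/andP; split.
    by rewrite ge_min lerDl ce.
  by rewrite -natr1 mulrDl mul1r addrA ge_min lexx orbT.
by move: h; rewrite mulrDr; lra.
Qed.

(* Adding -c|y|^2 makes the functions strictly superharmonic, which forces the
   minimum out to the shell. *)
Lemma max_principle j : G - m <= j%:R * (c * eps ^+ 2) -> G - bound <= g j 0.
Proof.
move=> h; have := @max_principle_ind j 0.
rewrite enorm0 addr_ge0// expr0n/= mulr0 subr0 => /(_ isT).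
by apply: le_trans; rewrite le_min lexx/=; move: h; lra.
Qed.

End Comparison.
End MaximumPrinciple.

Section FineWalk.
Context {R : realType} {d : nat}.
Variable J : ('rV[R]_d -> R) -> R.
Hypothesis sJ : spherical_average J.
Variable e0 : 'rV[R]_d.
Hypothesis e01 : enorm e0 = 1.
Implicit Types (f g : 'rV[R]_d -> R) (w x y z : 'rV[R]_d).

Definition sphere_mean (rho : R) f x := J (fun z => f (x + rho *: z)).

Lemma loclip_sphere_mean rho f : loclip f -> loclip (sphere_mean rho f).
Proof. by move=> fl; rewrite /sphere_mean; loclip_tac. Qed.

Lemma ler_sphere_mean rho f g x : loclip f -> loclip g ->
  (forall y, f y <= g y) -> sphere_mean rho f x <= sphere_mean rho g x.
Proof.
by move=> fl gl fg; apply: (ler_savg sJ) => [||z _]; [loclip_tac..|].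
Qed.

Variables (dd F : 'rV[R]_d -> R) (B L : R).
Hypotheses (dd_ge0 : forall x, 0 <= dd x)
  (dd_lip : forall x y, `|dd x - dd y| <= enorm (x - y))
  (dd_supp : forall x, 0 < dd x -> enorm x <= B)
  (L0 : 0 <= L) (F_lip : forall x y, `|F x - F y| <= L * enorm (x - y))
  (F_sub : forall x rho, F x <= sphere_mean rho F x).

Lemma loclip_dd : loclip dd.
Proof. by apply: (@loclip_lipschitz _ _ _ 1) => x y; rewrite mul1r. Qed.

Lemma loclip_F : loclip F.
Proof. exact: (loclip_lipschitz F_lip). Qed.

#[local] Hint Resolve loclip_dd loclip_F : loclip.

Lemma dd_shift x y : dd x - enorm (x - y) <= dd y.
Proof. by have := dd_lip x y; rewrite ler_norml => /andP[]; lra. Qed.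

Lemma F_shift x y : F x <= F y + L * enorm (x - y).
Proof. by have := F_lip x y; rewrite ler_norml => /andP[]; lra. Qed.

Variables (eps d0 : R).
Hypotheses (eps0 : 0 < eps) (d00 : 0 < d0).

(** The probability of moving instead of staying. The linear ramp over a layer of width [d0] keeps
    the iterates locally Lipschitz. *)
Definition cutoff delta x := Num.min 1 (Num.max 0 ((dd x - delta) * d0^-1)).

Fixpoint fine_walk delta k x := if k is j.+1 then
  fine_walk delta j x + cutoff delta x *
    (sphere_mean eps (fine_walk delta j) x - fine_walk delta j x) else F x.

Lemma cutoff_ge0 delta x : 0 <= cutoff delta x.
Proof. by rewrite /cutoff le_min ler01 le_max lexx. Qed.

Lemma cutoff_le1 delta x : cutoff delta x <= 1.
Proof. by rewrite /cutoff ge_min lexx. Qed.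

Lemma cutoff_out delta x : dd x <= delta -> cutoff delta x = 0.
Proof.
move=> xd; rewrite /cutoff (_ : Num.max _ _ = 0) ?min_r//.
by rewrite max_l// mulr_le0_ge0 ?subr_le0// invr_ge0 ltW.
Qed.

Lemma cutoff_in delta x : delta + d0 <= dd x -> cutoff delta x = 1.
Proof.
move=> xd; rewrite /cutoff min_l// le_max; apply/orP; right.
by rewrite ler_pdivlMr// mul1r lerBrDl.
Qed.

Lemma cutoff_mono delta delta' x y : dd x - delta <= dd y - delta' ->
  cutoff delta x <= cutoff delta' y.
Proof.
move=> h; rewrite /cutoff le_min !ge_min lexx/= ge_max.
rewrite !le_max !lexx/=; apply/orP; right; apply/orP; right.
by rewrite ler_wpM2r// invr_ge0 ltW.
Qed.

Lemma loclip_fine_walk delta k : loclip (fine_walk delta k).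
Proof.
elim: k => [|k IH] /=; first exact: loclip_F.
have ml := loclip_sphere_mean eps IH.
by rewrite /cutoff; loclip_tac.
Qed.

#[local] Hint Resolve loclip_fine_walk : loclip.

(** Averaging does not commute with the cutoff. Instead, the new iterate is a convex combination
    bounded by the mean of the old one, and that mean is below the mean of the new one because the
    iterates increase. *)
Lemma fine_walk_sub delta k x :
  fine_walk delta k x <= sphere_mean eps (fine_walk delta k) x.
Proof.
elim: k x => [|k IH] x; first exact: F_sub.
have step y : fine_walk delta k y <= fine_walk delta k.+1 y.
  by rewrite /= lerDl mulr_ge0 ?cutoff_ge0// subr_ge0.
apply: le_trans (_ : _ <= sphere_mean eps (fine_walk delta k) x) _.
  rewrite /= -lerBrDl ler_piMl ?cutoff_le1// subr_ge0; exact: IH.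
by apply: ler_sphere_mean => //; exact: loclip_fine_walk.
Qed.

Lemma fine_walk_mono delta k x : fine_walk delta k x <= fine_walk delta k.+1 x.
Proof. by rewrite /= lerDl mulr_ge0 ?cutoff_ge0// subr_ge0 fine_walk_sub. Qed.

Lemma fine_walk_homo delta k j x :
  fine_walk delta k x <= fine_walk delta (k + j) x.
Proof.
elim: j => [|j IH]; first by rewrite addn0.
by rewrite addnS (le_trans IH)// fine_walk_mono.
Qed.

Lemma fine_walk_out delta k x : dd x <= delta -> fine_walk delta k x = F x.
Proof. by move=> xd; elim: k => //= k ->; rewrite cutoff_out// mul0r addr0. Qed.

Lemma fine_walk_in delta k x : delta + d0 <= dd x ->
  fine_walk delta k.+1 x = sphere_mean eps (fine_walk delta k) x.
Proof. by move=> xd; rewrite /= cutoff_in// mul1r addrC subrK. Qed.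

(* Moving the threshold with the point compensates for the variation of the
   cutoff, so no regularity of the fine walk itself is needed. *)
Lemma fine_walk_shift delta t k x y : enorm (x - y) <= t ->
  fine_walk (delta + t) k x <= fine_walk delta k y + L * t.
Proof.
elim: k x y => [|k IH] x y xy.
  by rewrite /= (le_trans (F_shift x y))// lerD2l ler_wpM2l.
set u := fine_walk (delta + t) k; set v := fine_walk delta k.
have uv : u x <= v y + L * t := IH x y xy.
have Muv : sphere_mean eps u x <= sphere_mean eps v y + L * t.
  rewrite -[L * t](savg_cst sJ) /sphere_mean -(savgD sJ); last 2 first.
  - by rewrite /v; loclip_tac.
  - exact: loclip_cst.
  apply: (ler_savg sJ) => [||z _]; [by rewrite /u /v; loclip_tac..|].
  by apply: IH; rewrite opprD addrACA subrr addr0.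
have cc : cutoff (delta + t) x <= cutoff delta y.
  by apply: cutoff_mono; have := dd_shift x y; move: xy; lra.
have vM : v y <= sphere_mean eps v y := fine_walk_sub _ _ _.
rewrite /= -/u -/v.
have := cutoff_ge0 (delta + t) x; have := cutoff_le1 (delta + t) x.
move: (cutoff _ x) (cutoff _ y) cc => a b ab a1 a0.
have h1 : a * (sphere_mean eps u x) <= a * (sphere_mean eps v y + L * t).
  by rewrite ler_wpM2l.
have h2 : (1 - a) * u x <= (1 - a) * (v y + L * t).
  by rewrite ler_wpM2l// subr_ge0.
(* By [vM] the increment at [y] is non-negative, so the larger cutoff at [y] only helps. *)
have h3 : a * (sphere_mean eps v y - v y) <= b * (sphere_mean eps v y - v y).
  by rewrite ler_wpM2r// subr_ge0.
by move: h1 h2 h3; rewrite !mulrDr !mulrBl !mul1r !mulrN; lra.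
Qed.

Lemma radial_dist x rho y z : 0 <= rho -> enorm z = 1 ->
  rho < enorm y -> enorm y <= rho + eps ->
  enorm ((x + enorm y *: z) - (x + rho *: z)) <= eps /\
  enorm ((x + rho *: z) - (x + enorm y *: z)) <= eps.
Proof.
move=> r0 z1 yr yre; rewrite [X in _ /\ X <= _]enormBC.
suff h : enorm ((x + enorm y *: z) - (x + rho *: z)) <= eps by [].
rewrite opprD addrACA subrr add0r -scalerBl enormZ z1 mulr1 ger0_norm ?subr_ge0//.
  by rewrite lerBlDl.
exact: ltW.
Qed.

(** The maximum principle for minus the rotational average about [x], constant in [j]. The
    sub-mean-value property holds everywhere, so the sphere may leave the region where the walk
    moves. On the shell, radii in []rho, rho + eps]] are traded for [rho] at the price of a
    threshold shift. *)
Lemma fine_walk_le_sphere_mean delta k x rho : 0 <= rho ->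
  fine_walk (delta + eps) k x <=
  sphere_mean rho (fine_walk delta k) x + L * eps.
Proof.
move=> rho0; set u := fine_walk (delta + eps) k; set v := fine_walk delta k.
have ul : loclip u by exact: loclip_fine_walk.
have vl : loclip v by exact: loclip_fine_walk.
pose g y := - J (fun z => u (x + enorm y *: z)).
have gl : loclip g by rewrite /g; loclip_tac.
have [M M0 HM] := loclip_bounded (rho + eps) gl.
set S := sphere_mean rho v x + L * eps.
suff key c : 0 < c -> u x <= S + c by apply/ler_addgt0Pr.
move=> c0; pose c' := c / (rho + eps) ^+ 2.
have re : 0 < rho + eps by rewrite ltr_wpDl.
have c'0 : 0 < c' by rewrite divr_gt0// exprn_gt0.
have ce : 0 < c' * eps ^+ 2 by rewrite mulr_gt0// exprn_gt0.
(* Enough steps for the gain per step to exhaust the gap between the level on the shell and the a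
   priori bound. *)
pose j := Num.truncn ((- S + M) / (c' * eps ^+ 2)).
have := @max_principle _ _ _ sJ (fun=> g) rho eps (- S) (- M) c' rho0
  (ltW eps0) (ltW c'0) (fun=> gl) _ _ _ j.+1.
rewrite /g enorm0.
have -> : J (fun z => u (x + 0 *: z)) = u x.
  rewrite -[RHS](savg_cst sJ); congr J; apply/funext => z.
  by rewrite scale0r addr0.
rewrite /c' divfK ?gt_eqF ?exprn_gt0// => H.
suff : - S - c <= - u x by lra.
apply: H => [_ y _|_ y yr yre|y yre|].
- rewrite /g (savgN sJ); last by loclip_tac.
  rewrite (radial_mean_step sJ e01)// lerN2; apply: (ler_savg sJ); [by loclip_tac..|].
  by move=> z _; exact: fine_walk_sub.
- rewrite /g lerN2 /S -[L * eps](savg_cst sJ) /sphere_mean -(savgD sJ).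
  + apply: (ler_savg sJ) => [||z z1]; [by loclip_tac..|].
    by apply: fine_walk_shift; have [] := radial_dist x rho0 z1 yr yre.
  + by loclip_tac.
  + exact: loclip_cst.
- have /HM : `|y| <= rho + eps by rewrite (le_trans (normr_le_enorm _)).
  by rewrite /g ler_norml => /andP[].
- rewrite opprK -ler_pdivrMr//.
  by apply/ltW; rewrite truncnS_gt.
Qed.

(** This direction uses the equation of the walk where the cutoff is 1, and each use costs one more
    step: hence a family [g] that depends on time and the [j] extra steps. One [j] serves all [x]
    and [rho], because it comes from a bound [M] on a ball that contains every point in reach. *)
Lemma sphere_mean_le_fine_walk delta k c rmax : 0 < c -> 0 <= rmax ->
  exists j, forall x rho, enorm x <= B -> 0 <= rho -> rho <= rmax ->
    (forall y, enorm (x - y) <= rho -> delta + d0 <= dd y) ->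
    sphere_mean rho (fine_walk (delta + eps) k) x <=
    fine_walk delta (k + j) x + L * eps + c.
Proof.
move=> c0 rm0.
have [M M0 HM] := loclip_bounded (`|B| + rmax + eps) (loclip_fine_walk delta k).
have re : 0 < rmax + eps by rewrite ltr_wpDl.
pose c' := c / (rmax + eps) ^+ 2.
have c'0 : 0 < c' by rewrite divr_gt0// exprn_gt0.
have ce : 0 < c' * eps ^+ 2 by rewrite mulr_gt0// exprn_gt0.
exists (Num.truncn ((M + M) / (c' * eps ^+ 2))).+1 => x rho xB rho0 rhom xin.
set j := _.+1; set v := fine_walk (delta + eps) k.
have vl : loclip v by exact: loclip_fine_walk.
pose u i := fine_walk delta (k + i).
have ul i : loclip (u i) by exact: loclip_fine_walk.
pose g i y := J (fun z => u i (x + enorm y *: z)).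
have gl i : loclip (g i) by have := ul i; rewrite /g => ?; loclip_tac.
set S := sphere_mean rho v x - L * eps.
have bd y : enorm (x - y) <= rmax + eps -> `|u 0 y| <= M.
  move=> xy; rewrite /u addn0; apply: HM; apply: le_trans (normr_le_enorm _) _.
  rewrite -[y](subrK x) (le_trans (ler_enormD _ _))// enormBC -addrA addrC.
  by rewrite lerD// (le_trans xB)// ler_norm.
(* The target is bounded by [M] too, so its gap to the initial bound [- M] is at most [M + M],
   whatever [x] and [rho]. *)
have SM : S <= M.
  rewrite /S lerBlDr -[L * eps](savg_cst sJ) -[M](savg_cst sJ) -(savgD sJ).
  - apply: (ler_savg sJ) => [||z z1]; [by loclip_tac| |].
      by apply: loclipD; exact: loclip_cst.
    apply: (@le_trans _ _ (u 0 (x + rho *: z) + L * eps)).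
      by rewrite /u addn0; apply: fine_walk_shift; rewrite subrr enorm0 ltW.
    rewrite lerD2r (le_trans (ler_norm _))// bd// opprD addrA subrr sub0r enormN.
    by rewrite enormZ z1 mulr1 ger0_norm// (le_trans rhom)// lerDl ltW.
  - exact: loclip_cst.
  - exact: loclip_cst.
have := @max_principle _ _ _ sJ g rho eps S (- M) c' rho0 (ltW eps0)
  (ltW c'0) gl _ _ _ j.
have -> : g j 0 = u j x.
  rewrite /g enorm0 -[RHS](savg_cst sJ); congr J; apply/funext => z.
  by rewrite scale0r addr0.
have cb : c' * (rho + eps) ^+ 2 <= c.
  rewrite /c' mulrAC ler_pdivrMr ?exprn_gt0//.
  apply: ler_wpM2l; first exact: ltW.
  rewrite ler_pXn2r// ?nnegrE; first by rewrite lerD2r.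
    by rewrite addr_ge0// ltW.
  exact: ltW.
move=> H; suff : S - c' * (rho + eps) ^+ 2 <= u j x by rewrite /S /u; lra.
apply: H => [i y yr|i y yr yre|y yre|].
- rewrite /g (radial_mean_step sJ e01)//.
  have uil := ul i; have uil' := ul i.+1.
  apply: (ler_savg sJ); [by loclip_tac..|].
  move=> z z1; rewrite /u addnS fine_walk_in//; apply: xin.
  rewrite opprD addrA subrr sub0r enormN enormZ z1 mulr1.
  by rewrite ger0_norm ?enorm_ge0.
- rewrite /S lerBlDr -[L * eps](savg_cst sJ) /g -(savgD sJ).
  + apply: (ler_savg sJ) => [||z z1]; [by have := ul i; move=> ?; loclip_tac..|].
    apply: (@le_trans _ _ (u 0 (x + enorm y *: z) + L * eps)).
      rewrite /u addn0; apply: fine_walk_shift.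
      by have [] := radial_dist x rho0 z1 yr yre.
    by rewrite lerD2r /u addn0; exact: fine_walk_homo.
  + by have := ul i; move=> ?; loclip_tac.
  + exact: loclip_cst.
- rewrite /g; apply: (savg_ge_cst sJ) => // [|z z1]; first by have := ul 0%N; move=> ?; loclip_tac.
  have : `|u 0 (x + enorm y *: z)| <= M; last by rewrite ler_norml => /andP[].
  apply: bd; rewrite opprD addrA subrr sub0r enormN enormZ z1 mulr1.
  by rewrite ger0_norm ?enorm_ge0// (le_trans yre)// lerD2r.
- rewrite opprK -ler_pdivrMr//; apply/ltW.
  apply: le_lt_trans (_ : (M + M) / (c' * eps ^+ 2) < _).
    by rewrite ler_wpM2r ?invr_ge0 ?(ltW ce)// lerD2r.
  by rewrite /j truncnS_gt.
Qed.

End FineWalk.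

(** * Jumps proportional to the distance, and comparison of two ratios *)

Section Jumps.
Context {R : realType} {d : nat}.
Variable J : ('rV[R]_d -> R) -> R.
Hypothesis sJ : spherical_average J.
Variable e0 : 'rV[R]_d.
Hypothesis e01 : enorm e0 = 1.
Implicit Types (f g : 'rV[R]_d -> R) (w x y z : 'rV[R]_d).
Variables (dd F : 'rV[R]_d -> R) (B L : R).
Hypotheses (dd_ge0 : forall x, 0 <= dd x)
  (dd_lip : forall x y, `|dd x - dd y| <= enorm (x - y))
  (B0 : 0 <= B) (dd_supp : forall x, 0 < dd x -> enorm x <= B)
  (L0 : 0 <= L) (F_lip : forall x y, `|F x - F y| <= L * enorm (x - y))
  (F_sub : forall x rho, F x <= sphere_mean J rho F x).

Let ddl : loclip dd. Proof. exact: loclip_dd. Qed.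
Let Fl : loclip F. Proof. exact: loclip_F. Qed.

Definition jump s f x := sphere_mean J (s * dd x) f x.
Definition jumps s n f := iter n (jump s) f.

Lemma loclip_jump s f : loclip f -> loclip (jump s f).
Proof. by move=> fl; rewrite /jump /sphere_mean; loclip_tac. Qed.

Lemma loclip_jumps s n f : loclip f -> loclip (jumps s n f).
Proof. by move=> fl; elim: n => //= n IH; exact: loclip_jump. Qed.

Lemma jumpD s f g : loclip f -> loclip g ->
  jump s (fun x => f x + g x) = (fun x => jump s f x + jump s g x).
Proof.
move=> fl gl; apply/funext => x.
by rewrite /jump /sphere_mean (savgD sJ)//; loclip_tac.
Qed.

Lemma jumpZ s c f : loclip f ->
  jump s (fun x => c * f x) = (fun x => c * jump s f x).
Proof.
move=> fl; apply/funext => x.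
by rewrite /jump /sphere_mean (savgZ sJ)//; loclip_tac.
Qed.

Lemma jumpsD s n f g : loclip f -> loclip g ->
  jumps s n (fun x => f x + g x) = (fun x => jumps s n f x + jumps s n g x).
Proof.
by move=> fl gl; elim: n => //= n ->; rewrite jumpD//; exact: loclip_jumps.
Qed.

Lemma jumpsZ s n c f : loclip f ->
  jumps s n (fun x => c * f x) = (fun x => c * jumps s n f x).
Proof.
by move=> fl; elim: n => //= n ->; rewrite jumpZ//; exact: loclip_jumps.
Qed.

Lemma ler_jumps s n f g : loclip f -> loclip g -> (forall x, f x <= g x) ->
  forall x, jumps s n f x <= jumps s n g x.
Proof.
move=> fl gl fg; elim: n => //= n IH x.
by apply: ler_sphere_mean => //; exact: loclip_jumps.
Qed.

Lemma dd_jump s x z : 0 <= s -> enorm z = 1 ->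
  (1 - s) * dd x <= dd (x + (s * dd x) *: z).
Proof.
move=> s0 z1; have := dd_shift dd_lip x (x + (s * dd x) *: z).
rewrite opprD addrA subrr sub0r enormN enormZ z1 mulr1 ger0_norm ?mulr_ge0//.
by rewrite mulrBl mul1r.
Qed.

(** Each jump costs [eps] of threshold and [L * eps + c] of value. The hypothesis on [dd x] keeps
    all balls met during [n] jumps where [dd] is at least [2 * d0], hence where the cutoff is 1 for
    every threshold up to [d0]. *)
Lemma jumps_le_fine_walk s eps d0 c n delta : 0 <= s -> s < 1 -> 0 < eps ->
  0 < d0 -> 0 < c -> delta + n%:R * eps <= d0 ->
  exists k, forall x, 2 * d0 <= (1 - s) ^+ n * dd x ->
    jumps s n F x <= fine_walk J dd F eps d0 delta k x + n%:R * (L * eps + c).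
Proof.
move=> s0 s1 eps0 d00 c0; have [D D0 HD] := loclip_bounded B ddl.
elim: n delta => [|n IH] delta dn.
  by exists 0%N => x _; rewrite mul0r addr0.
have [|k Hk] := IH (delta + eps); first by move: dn; rewrite -natr1; lra.
have [j Hj] := sphere_mean_le_fine_walk sJ e01 B dd_lip L0 F_lip F_sub eps0 d00
  delta k c0 D0.
have s1' : 0 < 1 - s by rewrite subr_gt0.
have s1'' : 1 - s <= 1 by rewrite gerBl.
exists (k + j)%N => x hx.
have ddx : 0 < dd x.
  have : 0 < (1 - s) ^+ n.+1 * dd x by apply: lt_le_trans hx; rewrite mulr_gt0.
  by rewrite pmulr_rgt0// exprn_gt0.
have xB := dd_supp ddx.
have dx : 2 * d0 <= (1 - s) * dd x.
  apply: le_trans hx _; rewrite exprS -mulrA ler_wpM2l ?(ltW s1')//.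
  by rewrite ler_piMl ?dd_ge0// exprn_ile1// (ltW s1').
have ul := loclip_fine_walk sJ dd_lip F_lip eps d0 (delta + eps) k.
apply: (@le_trans _ _ (sphere_mean J (s * dd x)
    (fine_walk J dd F eps d0 (delta + eps) k) x + n%:R * (L * eps + c))).
  have Jl := loclip_jumps s n Fl.
  rewrite -[n%:R * _](savg_cst sJ) /sphere_mean -(savgD sJ).
  - rewrite /= /jump /sphere_mean; apply: (ler_savg sJ) => [||z z1].
    + by rewrite -/(jumps s n F); loclip_tac.
    + by loclip_tac.
    + apply: Hk; apply: le_trans hx _; rewrite exprSr -mulrA ler_wpM2l//.
        by rewrite exprn_ge0// ltW.
      exact: dd_jump.
  - by loclip_tac.
  - exact: loclip_cst.
have := Hj x (s * dd x) xB (mulr_ge0 s0 (ltW ddx)).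
have -> : s * dd x <= D.
  rewrite (le_trans (ler_piMl _ (ltW s1)))// (le_trans (ler_norm _))// HD//.
  exact: le_trans (normr_le_enorm _) xB.
move=> /(_ isT) H; rewrite -natr1 mulrDl mul1r.
suff : sphere_mean J (s * dd x) (fine_walk J dd F eps d0 (delta + eps) k) x <=
   fine_walk J dd F eps d0 delta (k + j) x + L * eps + c by lra.
apply: H => y xy; have := dd_shift dd_lip x y.
have : 0 <= n.+1%:R * eps by rewrite mulr_ge0// ltW.
by move: dx xy dn; rewrite mulrBl mul1r; lra.
Qed.

(** The bound by sphere means also holds near the boundary, so the number [N] of jumps is free; each
    jump lowers the threshold by [eps]. *)
Lemma fine_walk_le_jumps r eps d0 delta k N x : 0 <= r -> 0 < eps -> 0 < d0 ->
  fine_walk J dd F eps d0 (delta + N%:R * eps) k x <=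
  jumps r N (fine_walk J dd F eps d0 delta k) x + N%:R * (L * eps).
Proof.
move=> r0 eps0 d00; elim: N x => [|N IH] x; first by rewrite !mul0r !addr0.
have -> : delta + N.+1%:R * eps = delta + N%:R * eps + eps by rewrite -natr1; ring.
have rd : 0 <= r * dd x by rewrite mulr_ge0.
have := fine_walk_le_sphere_mean sJ e01 dd_lip L0 F_lip F_sub eps0 d00
  (delta + N%:R * eps) k x rd.
move=> /le_trans; apply; rewrite -natr1 mulrDl mul1r addrA lerD2r.
have ul delta' := loclip_fine_walk sJ dd_lip F_lip eps d0 delta' k.
have Jl := loclip_jumps r N (ul delta).
rewrite -[N%:R * (L * eps)](savg_cst sJ) /= /jump /sphere_mean -(savgD sJ).
- apply: (ler_savg sJ) => [||z z1]; [| |exact: IH].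
  + by have := ul (delta + N%:R * eps) => ?; loclip_tac.
  + by rewrite -/(jumps r N _); loclip_tac.
- by rewrite -/(jumps r N _); loclip_tac.
- exact: loclip_cst.
Qed.

(** A point that moves has norm at most [B], so a step of size at most 1 ends in the ball of radius
    [B + 1], on which [F] has this bound. *)
Lemma fine_walk_le_max eps d0 delta k x : 0 < eps -> eps <= 1 -> 0 < d0 ->
  0 <= delta -> enorm x <= B + 1 ->
  fine_walk J dd F eps d0 delta k x <= F 0 + L * (B + 1).
Proof.
move=> eps0 eps1 d00 de0; have F0 y : enorm y <= B + 1 -> F y <= F 0 + L * (B + 1).
  move=> yB; apply: le_trans (F_shift F_lip y 0) _.
  by rewrite subr0 lerD2l ler_wpM2l.
elim: k x => [|k IH] x xB; first exact: F0.
have [xd|xd] := leP (dd x) delta; first by rewrite fine_walk_out ?F0.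
have xB' : enorm x <= B by apply: dd_supp; exact: le_lt_trans xd.
have M1 : sphere_mean J eps (fine_walk J dd F eps d0 delta k) x <= F 0 + L * (B + 1).
  have ul := loclip_fine_walk sJ dd_lip F_lip eps d0 delta k.
  apply: (savg_le_cst sJ); first by loclip_tac.
  move=> z z1; apply: IH; rewrite (le_trans (ler_enormD _ _))// lerD//.
  by rewrite enormZ z1 mulr1 gtr0_norm.
have := IH x xB; rewrite /=.
have := cutoff_ge0 dd d0 delta x; have := cutoff_le1 dd d0 delta x.
move: (cutoff _ _ _ x) M1 => a; set S := _ + _.
move: (sphere_mean _ _ _ _) (fine_walk _ _ _ _ _ _ _ _) => m u mS a1 a0 uS.
have : a * m <= a * S by rewrite ler_wpM2l.
have : (1 - a) * u <= (1 - a) * S by rewrite ler_wpM2l// subr_ge0.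
by rewrite !mulrBl mulrBr; lra.
Qed.

(** Where the walk is frozen the value is [F]; elsewhere [dd x / delta] exceeds 1 and
    [2 * L * (B + 1)] bounds the oscillation of [F]. As in Chebyshev's inequality, the quadratic
    majorant is what [jumps_dd_small] makes small in the mean. *)
Lemma fine_walk_le_obstacle eps d0 delta k x : 0 < eps -> eps <= 1 -> 0 < d0 ->
  0 < delta ->
  fine_walk J dd F eps d0 delta k x <=
  F x + (2 * L * (B + 1) / delta ^+ 2) * dd x ^+ 2.
Proof.
move=> eps0 eps1 d00 de0; have B1 : 0 <= B + 1 by rewrite addr_ge0.
have C0 : 0 <= 2 * L * (B + 1) by rewrite mulr_ge0// mulr_ge0.
have [xd|xd] := leP (dd x) delta.
  rewrite fine_walk_out// lerDl; apply: mulr_ge0; last exact: sqr_ge0.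
  by apply: divr_ge0 => //; exact: sqr_ge0.
have xB : enorm x <= B by apply: dd_supp; exact: lt_trans de0 xd.
have xB' : enorm x <= B + 1 by apply: (le_trans xB); rewrite lerDl.
apply: le_trans (fine_walk_le_max k eps0 eps1 d00 (ltW de0) xB') _.
have := F_shift F_lip 0 x; rewrite sub0r enormN => h.
have : L * enorm x <= L * (B + 1) by rewrite ler_wpM2l.
have : 2 * L * (B + 1) <= 2 * L * (B + 1) / delta ^+ 2 * dd x ^+ 2.
  rewrite -[leRHS]mulrA ler_peMr// mulrC ler_pdivlMr ?exprn_gt0// mul1r.
  by apply: lerXn2r; rewrite ?nnegrE ?dd_ge0//; exact: ltW.
by move: h; lra.
Qed.

Lemma jumps_le_cst r n f c x : 0 <= r -> r < 1 -> loclip f ->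
  (forall y, enorm y <= B -> f y <= c) -> enorm x <= B -> jumps r n f x <= c.
Proof.
move=> r0 r1 fl fc; elim: n x => [|n IH] x xB; first exact: fc.
rewrite /= /jump /sphere_mean; apply: (savg_le_cst sJ) => [|z z1].
  by have := loclip_jumps r n fl => ?; rewrite -/(jumps r n f); loclip_tac.
apply: IH; have [x0|x0] := ltP 0 (dd x); last first.
  by rewrite (@le_anti _ _ (dd x) 0) ?dd_ge0 ?x0// mulr0 scale0r addr0.
apply: dd_supp; apply: lt_le_trans (dd_jump x r0 z1).
by rewrite mulr_gt0// subr_gt0.
Qed.

(** Each jump adds the square of its length to the mean square norm, as the cross term vanishes by
    symmetry. *)
Lemma jumps_enorm_sqr r n x :
  jumps r n (fun y => enorm y ^+ 2) x =
  enorm x ^+ 2 + r ^+ 2 * \sum_(j < n) jumps r j (fun y => dd y ^+ 2) x.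
Proof.
elim: n => [|n IH]; first by rewrite big_ord0 mulr0 addr0.
have ql : loclip (fun y : 'rV[R]_d => enorm y ^+ 2) by loclip_tac.
have dl : loclip (fun y : 'rV[R]_d => dd y ^+ 2) by loclip_tac.
rewrite [in LHS]/jumps iterSr -/(jumps r n _).
have -> : jump r (fun y => enorm y ^+ 2) =
    (fun y => enorm y ^+ 2 + r ^+ 2 * dd y ^+ 2).
  apply/funext => y; rewrite /jump /sphere_mean (savg_enorm_sqr sJ).
  by rewrite exprMn.
rewrite jumpsD//; last by loclip_tac.
by rewrite jumpsZ// big_ord_recr /= mulrDr addrA -IH.
Qed.

(** The mean squares of the jump lengths have partial sums at most [B ^+ 2], so they cannot all
    exceed [r ^+ 2 * c]. *)
Lemma jumps_dd_small r x c : 0 < r -> r < 1 -> enorm x <= B -> 0 < c ->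
  exists n, jumps r n (fun y => dd y ^+ 2) x <= c.
Proof.
move=> r0 r1 xB c0; apply: contrapT => /forallNP H.
have H' n : c <= jumps r n (fun y => dd y ^+ 2) x.
  by apply/ltW; rewrite ltNge; apply/negP/H.
have rc : 0 < r ^+ 2 * c by rewrite mulr_gt0// exprn_gt0.
pose n := (Num.truncn (B ^+ 2 / (r ^+ 2 * c))).+1.
have : jumps r n (fun y => enorm y ^+ 2) x <= B ^+ 2.
  apply: jumps_le_cst => // [||y yB]; [exact: ltW|by loclip_tac|].
  by rewrite ler_pXn2r// nnegrE enorm_ge0.
have : B ^+ 2 < n%:R * (r ^+ 2 * c) by rewrite -ltr_pdivrMr// truncnS_gt.
rewrite jumps_enorm_sqr => h1 h2.
have : n%:R * (r ^+ 2 * c) <= B ^+ 2.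
  apply: le_trans h2; rewrite -[leLHS]add0r lerD ?sqr_ge0//.
  rewrite mulrCA ler_wpM2l ?sqr_ge0// mulr_natl -[n in c *+ n]card_ord -sumr_const.
  by apply: ler_sum => j _; exact: H'.
by rewrite leNgt h1.
Qed.

(** The order of the choices matters: [n] fixes [d0] and [delta], these fix [N] through the decay of
    [dd] along the walk of ratio [r], and only then is [eps] taken small against [n + N]. The errors
    from the obstacle, the threshold shifts and the maximum principle are at most [c / 3] each. *)
Theorem jumps_le_jumps r s n v c : 0 < r < 1 -> 0 < s < 1 -> 0 < dd v -> 0 < c ->
  exists N, jumps s n F v <= jumps r N F v + c.
Proof.
move=> /andP[r0 r1] /andP[s0 s1] v0 c0.
have s1' : 0 < 1 - s by rewrite subr_gt0.
(* [2 * d0] is a lower bound for the distance left after [n] jumps of ratio [s] from [v]. *)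
pose d0 := (1 - s) ^+ n * dd v / 2.
have d00 : 0 < d0 by rewrite divr_gt0// mulr_gt0// exprn_gt0.
pose delta := d0 / 2; have de0 : 0 < delta by rewrite divr_gt0.
pose C := 2 * L * (B + 1) / delta ^+ 2.
have C0 : 0 <= C by rewrite divr_ge0 ?sqr_ge0// !mulr_ge0// addr_ge0.
have [|N HN] := @jumps_dd_small r v (c / 3 / (C + 1)) r0 r1 (dd_supp v0).
  by rewrite !divr_gt0// ltr_wpDl.
pose m : R := (n + N).+1%:R; have m0 : 0 < m by rewrite ltr0n.
have nm : n%:R <= m by rewrite ler_nat ltnW// ltnS leq_addr.
have nNm : n%:R + N%:R <= m by rewrite -natrD ler_nat.
pose eps := Num.min 1 (Num.min (delta / m) (c / 3 / (m * (L + 1)))).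
have L1 : 0 < L + 1 by rewrite ltr_wpDl.
have c3 : 0 < c / 3 by rewrite divr_gt0.
have eps0 : 0 < eps.
  rewrite !lt_min ltr01 (divr_gt0 de0 m0) /=.
  by apply: divr_gt0 => //; exact: mulr_gt0.
have eps1 : eps <= 1 by rewrite ge_min lexx.
have epsd : m * eps <= delta.
  by rewrite mulrC -ler_pdivlMr// !ge_min lexx orbT.
have epsL : m * (L * eps) <= c / 3.
  have : eps <= c / 3 / (m * (L + 1)) by rewrite !ge_min lexx !orbT.
  rewrite ler_pdivlMr ?mulr_gt0//; apply: le_trans.
  rewrite [leRHS]mulrC -mulrA ler_wpM2l ?(ltW m0)// ler_wpM2r ?(ltW eps0)//.
  by rewrite lerDl.
pose c' := c / 3 / m; have c'0 : 0 < c' by exact: divr_gt0.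
have n_le a : 0 <= a -> n%:R * a <= m * a by move=> a0; rewrite ler_wpM2r.
have nN_le a : 0 <= a -> n%:R * a + N%:R * a <= m * a.
  by move=> a0; rewrite -mulrDl ler_wpM2r.
(* The jumps of ratio [s] use thresholds from [delta + N%:R * eps] up to at most [2 * delta], which
   is [d0]; those of ratio [r] then bring the threshold down to [delta]. *)
have [|k Hk] := @jumps_le_fine_walk s eps d0 c' n (delta + N%:R * eps) (ltW s0)
  s1 eps0 d00 c'0.
  have := nN_le eps (ltW eps0); move: epsd; rewrite /delta; lra.
exists N.
have /Hk H1 : 2 * d0 <= (1 - s) ^+ n * dd v by rewrite /d0 mulrC divfK.
have H2 := fine_walk_le_jumps delta k N v (ltW r0) eps0 d00.
have dl : loclip (fun y : 'rV[R]_d => dd y ^+ 2) by loclip_tac.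
have cdl : loclip (fun y : 'rV[R]_d => C * dd y ^+ 2) by loclip_tac.
have H3 : jumps r N (fine_walk J dd F eps d0 delta k) v <=
    jumps r N F v + C * jumps r N (fun y => dd y ^+ 2) v.
  have := @ler_jumps r N (fine_walk J dd F eps d0 delta k)
    (fun x => F x + C * dd x ^+ 2).
  rewrite jumpsD// jumpsZ//; apply.
  - exact: (loclip_fine_walk sJ dd_lip F_lip).
  - exact: loclipD.
  - by move=> x; exact: fine_walk_le_obstacle.
have H4 : C * jumps r N (fun y => dd y ^+ 2) v <= c / 3.
  apply: (@le_trans _ _ (C * (c / 3 / (C + 1)))); first by rewrite ler_wpM2l.
  rewrite mulrA ler_pdivrMr ?ltr_wpDl// mulrC.
  by apply: ler_wpM2l; [exact: ltW|rewrite lerDl].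
have H5 := nN_le (L * eps) (mulr_ge0 L0 (ltW eps0)).
have H6 := n_le c' (ltW c'0).
have H7 : m * c' = c / 3 by rewrite /c' mulrC divfK// gt_eqF.
by move: H1 H2; rewrite mulrDr; lra.
Qed.

End Jumps.

(** * Invariance of Hausdorff measure under isometries *)

Section HausdorffInvariance.
Context {R : realType} {d : nat}.
Variable S : 'rV[R]_d -> 'rV[R]_d.
Hypotheses (SK : involutive S)
  (S_isometry : forall x y, enorm (S x - S y) = enorm (x - y)).
Local Open Scope ereal_scope.

Lemma diameter_isometry (A : set 'rV[R]_d) : diameter (S @` A) = diameter A.
Proof.
congr ereal_sup; apply/seteqP; split => [_ [_ [x Ax <-] [_ [y Ay <-] <-]]|].
  by exists x => //; exists y => //; rewrite S_isometry.
move=> _ [x Ax [y Ay <-]]; exists (S x); first by exists x.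
by exists (S y); [exists y|rewrite S_isometry].
Qed.

Lemma diameter_pow_isometry k (A : set 'rV[R]_d) :
  diameter_pow k (S @` A) = diameter_pow k A.
Proof.
rewrite /diameter_pow diameter_isometry (_ : (_ == set0) = (A == set0))//.
by apply/eqP/eqP => [/image_set0_set0//|->]; rewrite image_set0.
Qed.

Lemma hausdorff_pre_isometry_le k (delta : R) (A : set 'rV[R]_d) :
  hausdorff_pre k delta (S @` A) <= hausdorff_pre k delta A.
Proof.
apply: le_ereal_inf_tmp => _ [U [Ud AU] <-].
apply: ereal_inf_lbound; exists (fun i => S @` U i).
  split=> [i|_ [x Ax <-]]; first by rewrite diameter_isometry.
  by have [i _ Ux] := AU x Ax; exists i => //; exists x.
by apply: eq_eseriesr => i _; rewrite diameter_pow_isometry.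
Qed.

Lemma hausdorff_isometry_le k (A : set 'rV[R]_d) :
  hausdorff k (S @` A) <= hausdorff k A.
Proof.
apply: ge_ereal_sup => _ [delta delta0 <-].
apply: le_trans (hausdorff_pre_isometry_le _ _ _) _.
by apply: ereal_sup_ubound; exists delta.
Qed.

(** Since [S] is its own inverse, the inequality applied to the image gives the converse. *)
Lemma hausdorff_isometry k (A : set 'rV[R]_d) :
  hausdorff k (S @` A) = hausdorff k A.
Proof.
apply/eqP; rewrite eq_le hausdorff_isometry_le/=.
have {1}-> : A = S @` (S @` A); last exact: hausdorff_isometry_le.
apply/seteqP; split => [x Ax|_ [_ [x Ax <-] <-]]; last by rewrite SK.
by exists (S x); [exists x|rewrite SK].
Qed.

End HausdorffInvariance.

(** * Borel preimages and the projection of directions to the sphere *)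

Section BorelPreimage.
Context {R : realType} {d : nat}.
Implicit Types (A : set 'rV[R]_d) (h : 'rV[R]_d -> 'rV[R]_d).

Lemma borelT : borel (@setT 'rV[R]_d).
Proof. by rewrite -setC0; apply: borelC; exact: borel0. Qed.

Lemma borel_preimage h A : continuous h -> borel A -> borel (h @^-1` A).
Proof.
move=> hc bA; apply: (bA [set B | borel (h @^-1` B)]); split; last first.
  by move=> U oU; apply: borel_open; exact: ((continuousP h).1 hc).
split=> [|B bB|F bF] /=.
- by rewrite preimage_set0; exact: borel0.
- by rewrite setTD preimage_setC; exact: borelC.
- by rewrite preimage_bigcup; exact: borel_bigcup.
Qed.

Lemma isometry_continuous h :
  (forall x y, enorm (h x - h y) = enorm (x - y)) -> continuous h.
Proof.
move=> hi; apply: loclip_continuous => r; exists d%:R => // x y _ _.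
by rewrite (le_trans (normr_le_enorm _))// hi enorm_le_normr.
Qed.

Lemma borel_sphere : borel (@unit_sphere R d).
Proof. exact: borel_enorm_eq. Qed.

(* Composing with this map makes random directions, which lie on the sphere
   almost surely, lie on it surely without changing their law. *)
Definition to_sphere (e : 'rV[R]_d) x := if enorm x == 1 then x else e.

Lemma to_sphere1 e x : enorm e = 1 -> enorm (to_sphere e x) = 1.
Proof. by move=> e1; rewrite /to_sphere; case: eqP. Qed.

Lemma borel_to_sphere e A : borel A -> borel (to_sphere e @^-1` A).
Proof.
move=> bA.
have -> : to_sphere e @^-1` A = (unit_sphere `&` A) `|`
    (~` unit_sphere `&` [set _ | A e]).
  apply/seteqP; split => x /=; rewrite /to_sphere /unit_sphere /=.
    by case: eqP => h Ax; [left|right].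
  by case: eqP => h [[]|[]].
apply: borelU; first by apply: borelI => //; exact: borel_sphere.
apply: borelI; first by apply: borelC; exact: borel_sphere.
have [Ae|Ae] := pselect (A e).
  by rewrite (_ : [set _ | A e] = setT); [exact: borelT|apply/seteqP; split].
by rewrite (_ : [set _ | A e] = set0); [exact: borel0|apply/seteqP; split].
Qed.

End BorelPreimage.

(** * The uniform law as a spherical average *)

Section UniformLaw.
Context {R : realType} {d : nat} {disp : measure_display}
  {Omega : measurableType disp}.
Variable P : probability Omega R.
Implicit Types (X Y : Omega -> 'rV[R]_d).

Lemma uniform_to_sphere X e : uniform_on_sphere P X ->
  uniform_on_sphere P (fun w => to_sphere e (X w)).
Proof.
move=> uX A bA.
have := uX _ (borel_to_sphere e bA).
have -> : unit_sphere `&` to_sphere e @^-1` A = unit_sphere `&` A.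
  by apply/seteqP; split => x []; rewrite /unit_sphere /= /to_sphere => ->;
    rewrite eqxx.
by [].
Qed.

Lemma random_vector_to_sphere X e : random_vector X ->
  random_vector (fun w => to_sphere e (X w)).
Proof. by move=> rX A bA; exact: rX (borel_to_sphere e bA). Qed.

(** The law takes the same quotient as value at the whole space and at the sphere, and at the whole
    space it is 1. *)
Lemma uniform_sphere_ae X : random_vector X -> uniform_on_sphere P X ->
  P (X @^-1` ~` unit_sphere) = 0%E.
Proof.
move=> rX uX; rewrite -preimage_setC probability_setC; last exact: rX borel_sphere.
have := uX _ borelT; rewrite preimage_setT [X in X = _](@probability_setT _ _ _ P) setIT.
by rewrite uX ?setIid; [move=> <-; rewrite subee|exact: borel_sphere].
Qed.

Lemma spherical_average_uniform X : sphere_rv X -> uniform_on_sphere P X ->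
  spherical_average (fun phi : 'rV[R]_d -> R => mean P (fun w => phi (X w))).
Proof.
move=> sX uX; have [rX X1] := sX.
have b phi : loclip phi -> bounded_rv (fun w => phi (X w)).
  by move=> ?; exact: bounded_rv_sphere.
split.
- by move=> c; exact: mean_cst.
- by move=> f g fl gl; rewrite meanD//; exact: b.
- by move=> a f fl; rewrite meanZ//; exact: b.
- move=> f g fl gl fg; apply: ler_mean => [||w]; [exact: b|exact: b|exact: fg].
(* Since [S] maps the sphere onto itself and preserves Hausdorff measure, [S \o X] has the law of
   [X]. *)
- move=> S f SK Si S1 fl; have Sc := isometry_continuous Si.
  apply: (@mean_same_law _ _ _ _ P (S \o X) X) => //.
    split=> [A bA|w]; last by rewrite /= S1.
    by rewrite comp_preimage; apply: rX; exact: borel_preimage.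
  move=> A bA; rewrite comp_preimage !uX//; last exact: borel_preimage.
  rewrite -(hausdorff_isometry SK Si); congr (fine (hausdorff _ _) / _)%:E.
  apply/seteqP; split => [_ [x [xs Ax] <-]|x [xs Ax]].
    by split => //; rewrite /unit_sphere /= S1.
  by exists (S x); rewrite ?SK//; split; rewrite /unit_sphere/= ?S1// SK.
- by move=> E F Fl; exact: loclip_spherical_mean.
- by move=> F Fl; exact: spherical_mean_exchange.
Qed.

Lemma uniform_same_mean X Y (phi : 'rV[R]_d -> R) : sphere_rv X -> sphere_rv Y ->
  uniform_on_sphere P X -> uniform_on_sphere P Y -> loclip phi ->
  mean P (fun w => phi (X w)) = mean P (fun w => phi (Y w)).
Proof.
by move=> sX sY uX uY fl; apply: mean_same_law => // A bA; rewrite uX// uY.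
Qed.

Lemma indep_to_sphere (theta : nat -> Omega -> 'rV[R]_d) e :
  mutually_independent P theta ->
  mutually_independent P (fun n w => to_sphere e (theta n w)).
Proof.
move=> H J A bA; apply: (H J (fun j => to_sphere e @^-1` A j)) => j /bA.
exact: borel_to_sphere.
Qed.

End UniformLaw.

Lemma nat_ind_from (N : nat) (Q : nat -> Prop) : Q N ->
  (forall n, (N <= n)%N -> Q n -> Q n.+1) -> forall n, (N <= n)%N -> Q n.
Proof.
by move=> QN QS n /subnK <-; elim: (n - N)%N => // k; apply: QS; exact: leq_addl.
Qed.

(** * The walk as a Markov chain, and its maximal inequality *)

Section WalkEstimates.
Context {R : realType} {d : nat} {disp : measure_display}
  {Omega : measurableType disp}.
Variables (P : probability Omega R) (theta : nat -> Omega -> 'rV[R]_d).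
Hypotheses (theta_sphere : forall n, sphere_rv (theta n))
  (theta_unif : forall n, uniform_on_sphere P (theta n))
  (theta_indep : mutually_independent P theta).
Variables (dd : 'rV[R]_d -> R) (B r : R) (v : 'rV[R]_d).
Hypotheses (dd_ge0 : forall x, 0 <= dd x)
  (dd_lip : forall x y, `|dd x - dd y| <= enorm (x - y))
  (dd_supp : forall x, 0 < dd x -> enorm x <= B)
  (r0 : 0 < r) (r1 : r < 1) (v0 : 0 < dd v).
Implicit Types (f g : 'rV[R]_d -> R) (x y z : 'rV[R]_d).

Definition theta_mean f := mean P (fun w => f (theta 0%N w)).

Let J := theta_mean.

Lemma theta_mean_average : spherical_average J.
Proof. exact: spherical_average_uniform. Qed.

Let sJ := theta_mean_average.
Let ddl : loclip dd. Proof. exact: loclip_dd. Qed.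

Definition walk_step (p : 'rV[R]_d * 'rV[R]_d) := p.1 + (r * dd p.1) *: p.2.

Lemma loclip_walk_step : loclip walk_step.
Proof. by rewrite /walk_step; loclip_tac. Qed.

Fixpoint position n w := if n is m.+1 then walk_step (position m w, theta m w) else v.

Lemma position_pos n w : 0 < dd (position n w).
Proof.
elim: n => //= n IH; rewrite /walk_step /=.
apply: lt_le_trans (dd_jump dd_ge0 dd_lip _ (ltW r0) ((theta_sphere n).2 w)).
by rewrite mulr_gt0// subr_gt0.
Qed.

Lemma position_bounded n w : enorm (position n w) <= B.
Proof. exact/dd_supp/position_pos. Qed.

(** All directions have the law of [theta 0], so the one average [J] serves every step. *)
Lemma mean_chain_theta (E : normedZmodType R) (step : nat -> E * 'rV[R]_d -> E) (y0 : E)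
    n (H : E * 'rV[R]_d -> R) : (forall k, loclip (step k)) -> loclip H ->
  mean P (fun w => H (chain theta step y0 n w, theta n w)) =
  mean P (fun w => J (fun z => H (chain theta step y0 n w, z))).
Proof.
move=> sl Hl; rewrite mean_chain_step//; congr mean; apply/funext => w.
apply: (@uniform_same_mean _ _ _ _ P (theta n) (theta 0%N)
  (fun z => H (chain theta step y0 n w, z))) => //.
by loclip_tac.
Qed.

Lemma position_chain n w : position n w = chain theta (fun=> walk_step) v n w.
Proof. by elim: n => //= n ->. Qed.

Lemma bounded_rv_position n f : loclip f -> bounded_rv (fun w => f (position n w)).
Proof.
move=> fl; under eq_fun do rewrite position_chain.
by apply: bounded_rv_chain => // _; exact: loclip_walk_step.
Qed.

Lemma mean_position n f : loclip f ->
  mean P (fun w => f (position n w)) = jumps J dd r n f v.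
Proof.
elim: n f => [|n IH] f fl; first by rewrite /= mean_cst.
rewrite /jumps iterSr -/(jumps J dd r n _) -IH; last exact: loclip_jump.
have := @mean_chain_theta _ (fun=> walk_step) v n (fun p => f (walk_step p))
  (fun=> loclip_walk_step) (loclip_comp fl loclip_walk_step).
under [X in mean P X = _]eq_fun do rewrite -position_chain.
by under [X in _ = mean P X]eq_fun do rewrite -position_chain.
Qed.

Section RunningMaximum.
Variable N : nat.

(* The components are the position, the position at time N, and the largest
   distance to the latter reached since time N. *)
Let state := ('rV[R]_d * 'rV[R]_d * R)%type.

Definition excursion_step n (p : state * 'rV[R]_d) : state :=
  let x := walk_step (p.1.1.1, p.2) in
  if (n < N)%N then (x, x, 0)
  else (x, p.1.1.2, Num.max p.1.2 (enorm (x - p.1.1.2))).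

Lemma loclip_excursion_step n : loclip (excursion_step n).
Proof.
have xl : loclip (fun p : state * 'rV[R]_d => walk_step (p.1.1.1, p.2)).
  by rewrite /walk_step /=; loclip_tac.
by rewrite /excursion_step; case: ltnP => _; loclip_tac.
Qed.

Let st := chain theta excursion_step ((v, v, 0) : state).

Definition excursion n w : R := (st n w).2.

Lemma excursion_stE n w : st n w =
  (position n w, if (n < N)%N then position n w else position N w, excursion n w).
Proof.
elim: n => [|n IH]; first by rewrite /excursion /=; case: ltnP => //; rewrite leqn0 => /eqP->.
rewrite /excursion /st /= -/st IH /excursion_step /=.
case: ltnP => nN /=; last first.
  by rewrite ifF//; apply/negbTE; rewrite -leqNgt ltnW.
by move: nN; rewrite leq_eqVlt => /orP[/eqP<-|->]; rewrite ?ltnn.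
Qed.

Lemma excursionN w : excursion N w = 0.
Proof.
suff H n : n = N -> excursion n w = 0 by exact: H.
by case: n => // n nN; rewrite /excursion /st /= /excursion_step -nN ltnSn.
Qed.

Lemma excursionS n w : (N <= n)%N ->
  excursion n.+1 w = Num.max (excursion n w) (enorm (position n.+1 w - position N w)).
Proof.
move=> Nn; rewrite {1}/excursion /st /= -/st excursion_stE /excursion_step /=.
by rewrite ltnNge Nn.
Qed.

Lemma excursion_ge0 n w : (N <= n)%N -> 0 <= excursion n w.
Proof.
move: n; apply: nat_ind_from => [|n Nn IH]; first by rewrite excursionN.
by rewrite excursionS// le_max IH.
Qed.

Lemma excursion_ge n w : (N <= n)%N ->
  enorm (position n w - position N w) <= excursion n w.
Proof.
move: n; apply: nat_ind_from => [|n Nn _].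
  by rewrite excursionN subrr enorm0.
by rewrite excursionS// le_max lexx orbT.
Qed.

Lemma excursion_mono n w : (N <= n)%N -> excursion n w <= excursion n.+1 w.
Proof. by move=> Nn; rewrite excursionS// le_max lexx. Qed.

Lemma bounded_rv_state n (f : state -> R) :
  loclip f -> bounded_rv (fun w => f (st n w)).
Proof.
by move=> fl; apply: bounded_rv_chain => // k; exact: loclip_excursion_step.
Qed.

Lemma bounded_rv_excursion n : bounded_rv (excursion n).
Proof. by apply: (@bounded_rv_state n snd); loclip_tac. Qed.

Lemma mean_state_step n (H : state * 'rV[R]_d -> R) : loclip H ->
  mean P (fun w => H (st n w, theta n w)) = mean P (fun w => J (fun z => H (st n w, z))).
Proof. by move=> Hl; apply: mean_chain_theta => // k; exact: loclip_excursion_step. Qed.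

Lemma ler_enorm_average y rho : enorm y <= J (fun z => enorm (y + rho *: z)).
Proof.
have hl : loclip (fun z => enorm (y + rho *: z)) by loclip_tac.
have hl' : loclip (fun z => enorm (y + rho *: - z)) by loclip_tac.
have : enorm y + enorm y <= J (fun z => enorm (y + rho *: z) + enorm (y + rho *: - z)).
  apply: (savg_ge_cst sJ) => [|z _]; first exact: loclipD.
  have := ler_enormD (y + rho *: z) (y + rho *: - z).
  rewrite scalerN addrACA subrr addr0 -mulr2n -scaler_nat enormZ.
  by rewrite ger0_norm// mulr_natl mulr2n.
by rewrite (savgD sJ)// (savg_opp sJ hl); lra.
Qed.

(** Orthogonality of martingale increments: at each step both mean squares gain the mean square of
    the jump length. *)
Lemma mean_dist_sqr n : (N <= n)%N ->
  mean P (fun w => enorm (position n w - position N w) ^+ 2) =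
  mean P (fun w => enorm (position n w) ^+ 2) -
  mean P (fun w => enorm (position N w) ^+ 2).
Proof.
have q : loclip (fun x : 'rV[R]_d => enorm x ^+ 2) by loclip_tac.
have qs : loclip (fun p : state => enorm (p.1.1 - p.1.2) ^+ 2) by loclip_tac.
have ds : loclip (fun p : state => (r * dd p.1.1) ^+ 2) by loclip_tac.
have stp n' w : (N <= n')%N -> enorm (position n' w - position N w) ^+ 2 =
    enorm ((st n' w).1.1 - (st n' w).1.2) ^+ 2.
  by move=> Nn; rewrite excursion_stE /= ltnNge Nn.
move: n; apply: nat_ind_from => [|n Nn IH].
  rewrite subrr -[RHS](mean_cst P); congr mean.
  by apply/funext => w; rewrite subrr enorm0 expr0n.
have e1 : mean P (fun w => enorm (position n.+1 w - position N w) ^+ 2) =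
    mean P (fun w => enorm (position n w - position N w) ^+ 2) +
    mean P (fun w => (r * dd (position n w)) ^+ 2).
  pose H (p : state * 'rV[R]_d) := enorm (walk_step (p.1.1.1, p.2) - p.1.1.2) ^+ 2.
  have Hl : loclip H by rewrite /H /walk_step /=; loclip_tac.
  transitivity (mean P (fun w => H (st n w, theta n w))).
    by congr mean; apply/funext => w; rewrite /H excursion_stE /= ltnNge Nn.
  rewrite mean_state_step//.
  transitivity (mean P (fun w => enorm ((st n w).1.1 - (st n w).1.2) ^+ 2 +
      (r * dd (st n w).1.1) ^+ 2)).
    congr mean; apply/funext => w; rewrite /H /walk_step /=.
    by rewrite -(savg_enorm_sqr sJ); congr J; apply/funext => z; rewrite addrAC.
  rewrite meanD; [|exact: (bounded_rv_state n qs)|exact: (bounded_rv_state n ds)].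
  by congr (_ + _); congr mean; apply/funext => w; rewrite excursion_stE /= ?ltnNge ?Nn.
have e2 : mean P (fun w => enorm (position n.+1 w) ^+ 2) =
    mean P (fun w => enorm (position n w) ^+ 2) +
    mean P (fun w => (r * dd (position n w)) ^+ 2).
  have dl : loclip (fun x => (r * dd x) ^+ 2) by loclip_tac.
  rewrite -meanD; [|exact: (bounded_rv_position n q)|exact: (bounded_rv_position n dl)].
  have := @mean_chain_theta _ (fun=> walk_step) v n
    (fun p => enorm (walk_step p) ^+ 2) (fun=> loclip_walk_step)
    (loclip_comp q loclip_walk_step).
  under [X in mean P X = _]eq_fun do rewrite -position_chain.
  move=> ->; congr mean; apply/funext => w; rewrite -position_chain /walk_step /=.
  by rewrite (savg_enorm_sqr sJ).
by rewrite e1 e2 IH; ring.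
Qed.

(* Doob's maximal inequality in L2: with m the running maximum of the
   submartingale s, the process m s - m^2 / 2 is a submartingale. *)
Lemma mean_excursion_sqr n : (N <= n)%N ->
  mean P (fun w => excursion n w ^+ 2) <=
  4 * (mean P (fun w => enorm (position n w) ^+ 2) -
       mean P (fun w => enorm (position N w) ^+ 2)).
Proof.
move=> Nn; rewrite -mean_dist_sqr//.
pose phi (p : state) := p.2 * enorm (p.1.1 - p.1.2) - 2^-1 * (p.2 * p.2).
have phil : loclip phi by rewrite /phi; loclip_tac.
have phi_ge0 k : (N <= k)%N -> 0 <= mean P (fun w => phi (st k w)).
  move: k; apply: nat_ind_from => [|k Nk IH].
    rewrite -[leLHS](mean_cst P) le_eqVlt; apply/orP; left.
    apply/eqP; congr mean; apply/funext => w; rewrite /phi excursion_stE /=.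
    by rewrite excursionN !mul0r mulr0 subrr.
  apply: le_trans IH _.
  (* [H] is the value at the next time with the old maximum [m]; raising [m] to a larger [s'] then
     adds half the square of [s' - m]. *)
  pose H (p : state * 'rV[R]_d) := p.1.2 * enorm (walk_step (p.1.1.1, p.2) - p.1.1.2)
    - 2^-1 * (p.1.2 * p.1.2).
  have Hl : loclip H by rewrite /H /walk_step /=; loclip_tac.
  have bH : bounded_rv (fun w => H (st k w, theta k w)).
    have [R' HR'] := chain_bounded theta_sphere ((v, v, 0) : state) loclip_excursion_step k.
    have [L L0 HL] := loclip_sphere R' Hl.
    have [rX X1] := theta_sphere k.
    apply: (bounded_rv_discretize rX X1 (H := fun z w => H (st k w, z)) L0) => [w|z _].
      exact: HL.
    by apply: (bounded_rv_state k (f := fun p => H (p, z))); loclip_tac.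
  apply: (@le_trans _ _ (mean P (fun w => H (st k w, theta k w)))).
    rewrite mean_state_step//; apply: ler_mean.
    - exact: bounded_rv_state.
    - apply: (bounded_rv_state k (f := fun p => J (fun z => H (p, z)))).
      exact: (loclip_savg sJ).
    move=> w; rewrite /H /phi excursion_stE ltnNge Nk /=.
    have e0 : 0 <= excursion k w by exact: excursion_ge0.
    have l1 : loclip (fun z => enorm (walk_step (position k w, z) - position N w)).
      by rewrite /walk_step /=; loclip_tac.
    rewrite (savgB sJ); [|by loclip_tac..].
    rewrite (savg_cst sJ) lerB// (savgZ sJ)// ler_wpM2l//.
    apply: le_trans (ler_enorm_average _ (r * dd (position k w))) _.
    rewrite le_eqVlt; apply/orP; left; apply/eqP; congr J; apply/funext => z.
    by rewrite /walk_step /= addrAC.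
  apply: ler_mean => //; first exact: bounded_rv_state.
  move=> w; rewrite /H /phi !excursion_stE /= ltnNge Nk /= ltnNge (leqW Nk) /=.
  rewrite excursionS//=; set m := excursion k w; set s' := enorm _.
  rewrite maxEle; case: ifP => // ms; rewrite -subr_ge0.
  rewrite (_ : _ - _ = 2^-1 * (s' - m) ^+ 2); last by field.
  by rewrite mulr_ge0// sqr_ge0.
have bm2 : bounded_rv (fun w => excursion n w ^+ 2).
  by apply: (@bounded_rv_state n (fun p => p.2 ^+ 2)); loclip_tac.
have bs2 : bounded_rv (fun w => enorm (position n w - position N w) ^+ 2).
  have -> : (fun w => enorm (position n w - position N w) ^+ 2) =
      (fun w => enorm ((st n w).1.1 - (st n w).1.2) ^+ 2).
    by apply/funext => w; rewrite excursion_stE /= ltnNge Nn.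
  by apply: (@bounded_rv_state n (fun p => enorm (p.1.1 - p.1.2) ^+ 2)); loclip_tac.
(* Expanding the square of [s - m / 2] bounds [m s - m^2 / 2] by [s^2 - m^2 / 4]; this is the origin
   of the factor 4. *)
have : mean P (fun w => phi (st n w)) <=
    mean P (fun w => enorm (position n w - position N w) ^+ 2 +
     - 4^-1 * excursion n w ^+ 2).
  apply: ler_mean; first exact: bounded_rv_state.
    by apply: bounded_rvD => //; apply: bounded_rvM => //; exact: bounded_rv_cst.
  move=> w; rewrite /phi excursion_stE /= ltnNge Nn /=.
  have := sqr_ge0 (enorm (position n w - position N w) - 2^-1 * excursion n w).
  by rewrite !expr2; lra.
have bm2' : bounded_rv (fun w => - 4^-1 * excursion n w ^+ 2).
  by apply: bounded_rvM => //; exact: bounded_rv_cst.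
rewrite (meanD P bs2 bm2') (meanZ P _ bm2); have := phi_ge0 n Nn; lra.
Qed.

End RunningMaximum.
End WalkEstimates.

(** * Almost sure convergence to a point at distance zero *)

Section WalkConvergence.
Context {R : realType} {d : nat} {disp : measure_display}
  {Omega : measurableType disp}.
Variables (P : probability Omega R) (theta : nat -> Omega -> 'rV[R]_d).
Hypotheses (theta_sphere : forall n, sphere_rv (theta n))
  (theta_unif : forall n, uniform_on_sphere P (theta n))
  (theta_indep : mutually_independent P theta).
Variables (dd : 'rV[R]_d -> R) (B r : R) (v : 'rV[R]_d).
Hypotheses (dd_ge0 : forall x, 0 <= dd x)
  (dd_lip : forall x y, `|dd x - dd y| <= enorm (x - y))
  (dd_supp : forall x, 0 < dd x -> enorm x <= B)
  (r0 : 0 < r) (r1 : r < 1) (v0 : 0 < dd v).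
Implicit Types (x y z : 'rV[R]_d).

Let X := position theta dd r v.
Let ex N := excursion theta dd r v N.
Let ddl : loclip dd. Proof. exact: loclip_dd. Qed.

Lemma measurable_gt (g : Omega -> R) (e : R) : bounded_rv g ->
  measurable [set w | e < g w].
Proof.
move=> [mg _]; rewrite (_ : [set w | (e < g w)%R] = setT `&` g @^-1` `]e, +oo[).
  by apply: mg => //; exact: measurable_itv.
by rewrite setTI; apply/seteqP; split => w /=; rewrite in_itv /= andbT.
Qed.

Lemma probability_gt_le (g : Omega -> R) (e c : R) : bounded_rv g -> 0 < e ->
  mean P (fun w => g w ^+ 2) <= c -> (P [set w | (e < g w)%R] <= (c / e ^+ 2)%:E)%E.
Proof.
move=> bg e0 gc; have mA := measurable_gt e bg.
rewrite -[X in (X <= _)%E]fineK; last exact: fin_num_measure.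
rewrite lee_fin -mean_indic// ler_pdivlMr ?exprn_gt0// mulrC.
have bA : bounded_rv (\1_[set w | e < g w] : Omega -> R) by exact: bounded_rv_indic.
rewrite -meanZ//; apply: le_trans gc; apply: ler_mean.
- by apply: bounded_rvM => //; exact: bounded_rv_cst.
- exact: (bounded_rvM bg bg).
move=> w; rewrite indicE; case: (boolP (w \in _)); last by rewrite mulr0 sqr_ge0.
rewrite inE /= => eg; rewrite mulr1; apply: lerXn2r; rewrite ?nnegrE; apply: ltW => //.
exact: lt_trans e0 eg.
Qed.

Let Q n := mean P (fun w => enorm (X n w) ^+ 2).

Lemma bounded_rv_X n f : loclip f -> bounded_rv (fun w => f (X n w)).
Proof. exact: bounded_rv_position. Qed.

Lemma bounded_rv_ex N n : bounded_rv (ex N n).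
Proof. exact: bounded_rv_excursion. Qed.

Lemma mean_ex_sqr N n : (N <= n)%N ->
  mean P (fun w => ex N n w ^+ 2) <= 4 * (Q n - Q N).
Proof. exact: mean_excursion_sqr. Qed.

Lemma second_moment_mono : {homo Q : m n / (m <= n)%N >-> m <= n}.
Proof.
move=> N n Nn; have h := mean_ex_sqr Nn; rewrite -subr_ge0.
rewrite -(@pmulr_rge0 _ 4)//; apply: le_trans h; rewrite -[leLHS](mean_cst P).
apply: ler_mean => [||w]; [exact: bounded_rv_cst| |exact: sqr_ge0].
exact: (bounded_rvM (bounded_rv_ex N n) (bounded_rv_ex N n)).
Qed.

(** The second moments increase and are bounded by [B ^+ 2]. *)
Lemma second_moment_cauchy c : 0 < c -> exists N0, forall N n,
  (N0 <= N)%N -> (N <= n)%N -> Q n - Q N <= c.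
Proof.
move=> c0.
have ql : loclip (fun x : 'rV[R]_d => enorm x ^+ 2) by loclip_tac.
have QB n : Q n <= B ^+ 2.
  rewrite -[leRHS](mean_cst P); apply: ler_mean => // [||w].
  - exact: (bounded_rv_X n ql).
  - exact: bounded_rv_cst.
  have XB : enorm (X n w) <= B by exact: position_bounded.
  by apply: lerXn2r; rewrite ?nnegrE ?enorm_ge0// (le_trans (enorm_ge0 _) XB).
have sQ : has_sup (range Q).
  by split; [exists (Q 0%N), 0%N|exists (B ^+ 2) => _ [n _ <-]].
have [_ [N0 _ <-] hN0] := sup_adherent c0 sQ.
exists N0 => N n N0N Nn; have := second_moment_mono N0N.
have : Q n <= sup (range Q) by apply: ub_le_sup; [exact: sQ.2|exists n].
by move: hN0; lra.
Qed.

(** The event that after time [N] the walk is ever farther than [e] from its position at [N],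
    written as an increasing union so that its probability is a limit. *)
Definition excursion_gt N e := \bigcup_k [set w | e < ex N (N + k)%N w].

Lemma measurable_excursion_gt N e : measurable (excursion_gt N e).
Proof.
by apply: bigcup_measurable => k _; apply: measurable_gt; exact: bounded_rv_ex.
Qed.

Lemma excursion_gtPn N e w n : ~ excursion_gt N e w -> (N <= n)%N ->
  enorm (X n w - X N w) <= e.
Proof.
move=> h Nn; rewrite leNgt; apply/negP => lt_e; apply: h.
exists (n - N)%N => //=; rewrite subnKC//; apply: lt_le_trans lt_e _.
exact: excursion_ge.
Qed.

Lemma probability_excursion_gt e c : 0 < e -> 0 < c -> exists N0, forall N,
  (N0 <= N)%N -> (P (excursion_gt N e) <= c%:E)%E.
Proof.
move=> e0 c0; have [|N0 HN0] := @second_moment_cauchy (c * e ^+ 2 / 4).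
  by rewrite divr_gt0// mulr_gt0// exprn_gt0.
exists N0 => N N0N.
pose F k := [set w | e < ex N (N + k)%N w].
have mF k : measurable (F k) by apply: measurable_gt; exact: bounded_rv_ex.
have mU : measurable (\bigcup_k F k) by exact: bigcup_measurable.
have Fmono : {homo F : n m / (n <= m)%N >-> (n <= m)%O}.
  apply: homo_leq => [A|A B' C|n]; [exact: lexx|exact: le_trans|].
  apply/subsetPset => w; rewrite /F /= addnS => /lt_le_trans; apply.
  by apply: excursion_mono; exact: leq_addr.
have cv := @nondecreasing_cvg_mu _ _ _ P F mF mU Fmono.
rewrite /excursion_gt -(cvg_lim _ cv)//; apply: lime_le.
  by apply/cvg_ex; eexists; exact: cv.
apply: nearW => k /=; rewrite (_ : c = (c * e ^+ 2) / e ^+ 2); last first.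
  by rewrite mulfK// gt_eqF// exprn_gt0.
apply: probability_gt_le => //; first exact: bounded_rv_ex.
have := mean_ex_sqr (leq_addr k N); have := HN0 N (N + k)%N N0N (leq_addr k N).
lra.
Qed.

(** [r ^+ 2] times this mean is the increment of the second moment at step [n]. *)
Lemma mean_dd_sqr c : 0 < c -> exists N0, forall n, (N0 <= n)%N ->
  mean P (fun w => dd (X n w) ^+ 2) <= c.
Proof.
move=> c0; have [|N0 HN0] := @second_moment_cauchy (r ^+ 2 * c).
  by rewrite mulr_gt0// exprn_gt0.
exists N0 => n N0n; have := HN0 n n.+1 N0n (leqnSn n).
have ql : loclip (fun x : 'rV[R]_d => enorm x ^+ 2) by loclip_tac.
have dl : loclip (fun x : 'rV[R]_d => dd x ^+ 2) by loclip_tac.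
have mp f n' : loclip f -> mean P (fun w => f (X n' w)) =
    jumps (theta_mean P theta) dd r n' f v by move=> fl; exact: mean_position.
rewrite /Q !(mp _ _ ql) !(jumps_enorm_sqr (theta_mean_average theta_sphere theta_unif) dd_lip).
rewrite (mp _ _ dl) big_ord_recr /= mulrDr => h.
by rewrite -(@ler_pM2l _ (r ^+ 2)) ?exprn_gt0//; move: h; lra.
Qed.

(** Failure lies in two null sets. In the first, for some [k], excursions beyond [1 / (k + 1)] occur
    after every [N]; it contains every failure of Cauchy's criterion. In the second, the distance
    eventually stays above some [1 / (k + 1)]; it contains convergence to a point of positive
    distance. *)
Lemma walk_converges_ae : P.-negligible [set w |
  ~ (cvg (X n w @[n --> \oo]) /\ dd (lim (X n w @[n --> \oo])) = 0)].
Proof.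
have k0 k : 0 < (k.+1%:R^-1 : R) by rewrite invr_gt0.
have bdd n : bounded_rv (fun w => dd (X n w)) by exact: (bounded_rv_X n ddl).
have null (D : set Omega) : measurable D ->
    (forall c : R, 0 < c -> (P D <= c%:E)%E) -> P.-negligible D.
  move=> mD H; exists D; split => //; apply/eqP; rewrite eq_le measure_ge0 andbT.
  by apply/lee_addgt0Pr => c c0; rewrite add0e H.
have mono (D D' : set Omega) : measurable D -> measurable D' -> D `<=` D' ->
    (P D <= P D')%E.
  by move=> mD mD' DD'; apply: le_measure; rewrite ?inE.
have A10 : P.-negligible (\bigcup_k \bigcap_N excursion_gt N k.+1%:R^-1).
  apply: negligible_bigcup => k.
  have mA : measurable (\bigcap_N excursion_gt N k.+1%:R^-1).
    by apply: bigcap_measurableType => N _; exact: measurable_excursion_gt.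
  apply: null => // c c0.
  have [N0 HN0] := probability_excursion_gt (k0 k) c0.
  apply: le_trans (HN0 N0 (leqnn _)); apply: mono => //.
    exact: measurable_excursion_gt.
  by move=> w; exact.
have A20 : P.-negligible (\bigcup_k \bigcup_N
    \bigcap_(n in [set n | (N <= n)%N]) [set w | (k.+1%:R^-1 : R) < dd (X n w)]).
  apply: negligible_bigcup => k; apply: negligible_bigcup => N.
  have mA : measurable (\bigcap_(n in [set n | (N <= n)%N])
      [set w | (k.+1%:R^-1 : R) < dd (X n w)]).
    by apply: bigcap_measurableType => n _; exact: measurable_gt.
  apply: null => // c c0.
  have [|N0 HN0] := @mean_dd_sqr (c * k.+1%:R^-1 ^+ 2).
    by rewrite mulr_gt0// exprn_gt0.
  (* This index is late enough both for the intersection and for the mean-square bound. *)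
  have := probability_gt_le (bdd (maxn N N0)) (k0 k) (HN0 _ (leq_maxr _ _)).
  rewrite mulfK; last by rewrite gt_eqF// exprn_gt0.
  apply: le_trans; apply: mono => //; first exact: measurable_gt.
  by move=> w; apply; rewrite /= leq_maxl.
apply: negligibleS (negligibleU A10 A20) => w.
apply: contra_notP; rewrite /= not_orP => -[n1 n2].
have cX : cvg (X n w @[n --> \oo]).
  apply: cauchy_cvg; apply: cauchy_exP => e e0.
  pose k := Num.truncn e^-1.
  have ke : k.+1%:R^-1 < e.
    by rewrite invf_plt ?posrE// truncnS_gt.
  have [N HN] : exists N, ~ excursion_gt N k.+1%:R^-1 w.
    by apply: contra_notP n1 => /forallNP h; exists k => // N _; apply: contrapT; exact: h.
  exists (X N w); exists N => // n /= Nn; rewrite -ball_normE /=.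
  rewrite distrC; apply: le_lt_trans ke; apply: le_trans (normr_le_enorm _) _.
  exact: excursion_gtPn HN Nn.
split=> //; apply/eqP; rewrite eq_le dd_ge0 andbT leNgt; apply/negP => l0.
apply: n2; set l := lim _ in l0.
pose k := Num.truncn (dd l)^-1; exists k => //.
have ke : k.+1%:R^-1 < dd l by rewrite invf_plt ?posrE// truncnS_gt.
have ddX : dd (X n w) @[n --> \oo] --> dd l.
  by apply: continuous_cvg => //; exact: loclip_continuous.
have [N _ HN] := cvgr_gt _ ddX _ ke.
by exists N => // n /= Nn; exact: HN.
Qed.

End WalkConvergence.

(** * Distance to the boundary and to the complement *)

Section DistanceToBoundary.
Context {R : realType} {d : nat}.
Implicit Types (A V : set 'rV[R]_d) (x y z : 'rV[R]_d).

Lemma nbhs_enorm_ball x A : nbhs x A ->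
  exists2 e : R, 0 < e & forall y, enorm (x - y) < e -> A y.
Proof.
move=> /nbhs_ballP[e /= e0 H]; exists e => // y xy; apply: H.
by rewrite -ball_normE /=; exact: le_lt_trans (normr_le_enorm _) xy.
Qed.

Lemma closure_enorm A x :
  (forall e : R, 0 < e -> exists2 y, A y & enorm (x - y) < e) -> closure A x.
Proof.
move=> H U /nbhs_enorm_ball[e e0 Ue]; have [y Ay xy] := H e e0.
by exists y; split=> //; exact: Ue.
Qed.

Lemma boundary_open V : open V -> boundary V = closure V `\` V.
Proof. by move=> oV; rewrite /boundary (interior_id V).1. Qed.

Lemma edist_set_ge0 x A : 0 <= edist_set x A.
Proof.
rewrite /edist_set; have [->|/set0P A0] := eqVneq A set0.
  by rewrite image_set0 inf0.
by apply: lb_le_inf; [case: A0 => y Ay; exists (enorm (x - y)), y|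
  move=> _ [y _ <-]; exact: enorm_ge0].
Qed.

Lemma edist_set_le x y A : A y -> edist_set x A <= enorm (x - y).
Proof.
move=> Ay; apply: ge_inf; last by exists y.
by exists 0 => _ [z _ <-]; exact: enorm_ge0.
Qed.

Lemma edist_set_lip x y A : A !=set0 ->
  edist_set x A <= edist_set y A + enorm (x - y).
Proof.
move=> A0; rewrite -lerBlDr; apply: lb_le_inf.
  by case: A0 => z Az; exists (enorm (y - z)), z.
move=> _ [z Az <-]; rewrite lerBlDr addrC.
exact: le_trans (edist_set_le x Az) (ler_enorm_dist _ _ _).
Qed.

(** The point sits at the supremum of the parameters whose point on the segment is in [V]. It is a
    limit of points of [V], and if it were in [V], openness would push the supremum further. *)
Lemma segment_boundary V x y : open V -> V x -> ~ V y ->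
  exists2 z, boundary V z & enorm (x - z) <= enorm (x - y).
Proof.
move=> oV Vx Vy; rewrite boundary_open//.
pose p t := x + t *: (y - x).
have pd s t : enorm (p s - p t) = `|s - t| * enorm (y - x).
  by rewrite /p opprD addrACA subrr add0r -scalerBl enormZ.
pose E := [set t | 0 <= t <= 1 /\ V (p t)].
have p0 : p 0 = x by rewrite /p scale0r addr0.
have E0 : E 0 by split; [rewrite lexx ler01|rewrite p0].
have sE : has_sup E by split; [exists 0|exists 1 => t [/andP[]]].
pose s := sup E.
have s0 : 0 <= s by apply: ub_le_sup => //; exact: sE.2.
have s1 : s <= 1 by apply: ge_sup; [exists 0|move=> t [/andP[]]].
have D0 : 0 < enorm (y - x) + 1 by rewrite ltr_wpDl ?enorm_ge0.
exists (p s); last first.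
  rewrite -{1}p0 pd sub0r normrN ger0_norm// enormBC.
  by rewrite ler_piMl ?enorm_ge0.
have close e : 0 < e -> forall t, `|s - t| < e / (enorm (y - x) + 1) ->
    enorm (p s - p t) < e.
  move=> e0 t; rewrite ltr_pdivlMr// => h; rewrite pd; apply: le_lt_trans h.
  by rewrite ler_wpM2l// lerDl.
split.
  apply: closure_enorm => e e0.
  have e0' : 0 < e / (enorm (y - x) + 1) by rewrite divr_gt0.
  have [t [t01 Vt] st] := sup_adherent e0' sE.
  exists (p t) => //; apply: close => //.
  have ts : t <= s by apply: ub_le_sup; [exact: sE.2|].
  by rewrite ger0_norm ?subr_ge0//; move: st; rewrite -/s; lra.
move=> Vs.
have s1' : s < 1.
  rewrite lt_neqAle s1 andbT; apply/eqP => s1'.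
  by apply: Vy; move: Vs; rewrite s1' /p scale1r addrC subrK.
have /nbhs_enorm_ball[e e0 He] : nbhs (p s) V by exact: open_nbhs_nbhs.
pose h := Num.min (1 - s) (e / (enorm (y - x) + 1) / 2).
have e0' : 0 < e / (enorm (y - x) + 1) by rewrite divr_gt0.
have h0 : 0 < h by rewrite lt_min subr_gt0 s1' divr_gt0.
have h1 : h <= 1 - s by rewrite ge_min lexx.
have h2 : h <= e / (enorm (y - x) + 1) / 2 by rewrite ge_min lexx orbT.
have : E (s + h).
  split; first by apply/andP; split; lra.
  apply/He/close => //; rewrite opprD addrA subrr sub0r normrN gtr0_norm//.
  by apply: le_lt_trans h2 _; rewrite ltr_pdivrMr// ltr_pMr// ltr1n.
by move=> /(ub_le_sup sE.2); rewrite -/s; lra.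
Qed.

Section Distance.
Variable V : set 'rV[R]_d.
Hypotheses (oV : open V) (bV : bounded_set V).

(** The distance to the complement of [V]. It agrees with the distance to the boundary on [V] but
    vanishes outside, so that its positivity characterizes [V]. *)
Definition bdist x := if pselect (V x) then edist_set x (boundary V) else 0.

Lemma bdistE x : V x -> bdist x = edist_set x (boundary V).
Proof. by move=> Vx; rewrite /bdist; case: pselect. Qed.

Lemma bdist_out x : ~ V x -> bdist x = 0.
Proof. by move=> Vx; rewrite /bdist; case: pselect. Qed.

Lemma bdist_ge0 x : 0 <= bdist x.
Proof.
have [Vx|Vx] := pselect (V x); last by rewrite bdist_out.
by rewrite bdistE// edist_set_ge0.
Qed.

Lemma bounded_set_enorm : exists B, forall x, V x -> enorm x <= B.
Proof.
have [M [_ HM]] := bV; exists (d%:R * (M + 1)) => x Vx.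
by rewrite (le_trans (enorm_le_normr _))// ler_wpM2l// (HM (M + 1))// ltrDl.
Qed.

Lemma boundary_nonempty (e0 : 'rV[R]_d) : enorm e0 = 1 -> V !=set0 ->
  boundary V !=set0.
Proof.
move=> e01 [x Vx]; have [B HB] := bounded_set_enorm.
have [|z bz _] := @segment_boundary V x ((`|B| + 1) *: e0) oV Vx; last by exists z.
move=> /HB; rewrite enormZ e01 mulr1 ger0_norm ?addr_ge0// leNgt => /negP; apply.
by rewrite (le_lt_trans (ler_norm B))// ltrDl.
Qed.

Hypothesis bV0 : boundary V !=set0.

Lemma bdist_lip x y : `|bdist x - bdist y| <= enorm (x - y).
Proof.
have out u w : V u -> ~ V w -> `|bdist u - bdist w| <= enorm (u - w).
  move=> Vu Vw; rewrite bdistE// (bdist_out Vw) subr0 ger0_norm ?edist_set_ge0//.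
  have [z bz uz] := segment_boundary oV Vu Vw.
  exact: le_trans (edist_set_le u bz) uz.
have [Vx|Vx] := pselect (V x); have [Vy|Vy] := pselect (V y).
- rewrite !bdistE// ler_norml; have := edist_set_lip x y bV0.
  by have := edist_set_lip y x bV0; rewrite (enormBC y); lra.
- exact: out.
- by rewrite distrC enormBC; exact: out.
- by rewrite !bdist_out// subrr normr0 enorm_ge0.
Qed.

Lemma bdist_gt0 x : V x -> 0 < bdist x.
Proof.
move=> Vx; rewrite bdistE//.
have /nbhs_enorm_ball[e e0 He] : nbhs x V by exact: open_nbhs_nbhs.
apply: lt_le_trans e0 _; apply: lb_le_inf.
  by case: bV0 => z bz; exists (enorm (x - z)), z.
move=> _ [z bz <-]; rewrite leNgt; apply/negP => /He Vz.
by move: bz; rewrite boundary_open// => -[].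
Qed.

Lemma bdist_in x : 0 < bdist x -> V x.
Proof. by apply: contraPP => /bdist_out->; rewrite ltxx. Qed.

Lemma bdist0_boundary x : closure V x -> bdist x = 0 -> boundary V x.
Proof.
move=> cx x0; rewrite boundary_open//; split=> // Vx.
by have := bdist_gt0 Vx; rewrite x0 ltxx.
Qed.

Lemma compact_boundary : compact (boundary V).
Proof.
have [B HB] := bounded_set_enorm.
have cB x : closure V x -> enorm x <= B.
  move=> cx; apply/ler_addgt0Pr => e e0.
  have [|y [Vy xy]] := cx [set y | enorm (y - x) < e].
    apply: open_nbhs_nbhs; split; first exact: open_enorm_ball.
    by rewrite /= subrr enorm0.
  have := HB y Vy; have := ler_enorm_dist x 0 y; rewrite !subr0 enormBC.
  by move: xy => /=; lra.
apply: bounded_closed_compact.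
  exists B; split => [|N N1 z /= [cz _]]; first exact: num_real.
  by rewrite (le_trans (normr_le_enorm _))// (le_trans (cB _ cz))// ltW.
rewrite boundary_open// setDE; apply: closedI; first exact: closed_closure.
exact: open_closedC.
Qed.

End Distance.
End DistanceToBoundary.

(** * Bounds for expectations of arbitrary functions *)

Section ArbitraryIntegrands.
Context {R : realType} {disp : measure_display} {Omega : measurableType disp}.
Variable P : probability Omega R.
Local Open Scope ereal_scope.

(* No measurability is required: for an arbitrary integrand, the integral is a
   difference of suprema over simple functions, which is monotone. *)
Lemma le_integral_nonmeasurable (f g : Omega -> \bar R) :
  (forall w, f w <= g w) -> \int[P]_w f w <= \int[P]_w g w.
Proof.
move=> fg; rewrite /integral !patch_setT; apply: leeB; apply: ereal_sup_le.
  move=> _ [h hf <-]; exists h => // w; apply: le_trans (hf w) _.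
  by rewrite !funeposE ge_max !le_max lexx orbT fg.
move=> _ [h hf <-]; exists h => // w; apply: le_trans (hf w) _.
by rewrite !funenegE ge_max !le_max lexx orbT leeN2 fg.
Qed.

(** [g] is raised to [+oo] on a null set containing [N]. Its integral is unchanged and the
    inequality now holds everywhere, so monotonicity for arbitrary integrands applies to [h]. *)
Lemma expectation_le_mean (h g : Omega -> R) (N : set Omega) :
  bounded_rv g -> P.-negligible N -> (forall w, ~ N w -> (h w <= g w)%R) ->
  'E_P[h] <= (mean P g)%:E.
Proof.
move=> bg [A [mA PA NA]] hg; rewrite unlock.
have -> : (mean P g)%:E = \int[P]_w (g w)%:E.
  rewrite /mean /Rintegral fineK//; apply: integrable_fin_num => //.
  exact: bounded_rv_integrable.
pose g' w := (g w)%:E + +oo * (\1_A w)%:E.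
have mg : measurable_fun setT (fun w => (g w)%:E).
  by apply/measurable_EFinP; exact: bg.1.
have mg' : measurable_fun setT g'.
  apply: emeasurable_funD => //; apply: emeasurable_funM => //.
  by apply/measurable_EFinP; exact: measurable_indic.
rewrite -(ae_eq_integral (fun w => (g w)%:E) g')//; last first.
  exists A; split => // w /= Hw; apply: contrapT => Aw; apply: Hw => _.
  by rewrite /g' indicE memNset// mule0 adde0.
apply: le_integral_nonmeasurable => w; rewrite /g'.
have [Aw|Aw] := pselect (A w).
  by rewrite indicE mem_set// mule1 addey// leey.
by rewrite indicE memNset// mule0 adde0 lee_fin hg// => /NA.
Qed.

Lemma mean_le_expectation (h g : Omega -> R) (N : set Omega) :
  bounded_rv g -> P.-negligible N -> (forall w, ~ N w -> (g w <= h w)%R) ->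
  (mean P g)%:E <= 'E_P[h].
Proof.
move=> bg [A [mA PA NA]] hg; rewrite unlock.
have -> : (mean P g)%:E = \int[P]_w (g w)%:E.
  rewrite /mean /Rintegral fineK//; apply: integrable_fin_num => //.
  exact: bounded_rv_integrable.
pose g' w := (g w)%:E + -oo * (\1_A w)%:E.
have mg : measurable_fun setT (fun w => (g w)%:E).
  by apply/measurable_EFinP; exact: bg.1.
have mg' : measurable_fun setT g'.
  apply: emeasurable_funD => //; apply: emeasurable_funM => //.
  by apply/measurable_EFinP; exact: measurable_indic.
rewrite -(ae_eq_integral (fun w => (g w)%:E) g')//; last first.
  exists A; split => // w /= Hw; apply: contrapT => Aw; apply: Hw => _.
  by rewrite /g' indicE memNset// mule0 adde0.
apply: le_integral_nonmeasurable => w; rewrite /g'.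
have [Aw|Aw] := pselect (A w).
  by rewrite indicE mem_set// mule1 addeNy// leNye.
by rewrite indicE memNset// mule0 adde0 lee_fin hg// => /NA.
Qed.

End ArbitraryIntegrands.

(** * Approximation by differences of convex functions *)

Section ConvexDifferences.
Context {R : realType} {d : nat}.
Implicit Types (f F G : 'rV[R]_d -> R) (x y z h : 'rV[R]_d).

(** Midpoint convexity is the form that pairing [z] with [- z] turns into the sub-mean-value
    property. *)
Definition convex_lipschitz F :=
  (exists2 L, 0 <= L & forall x y, `|F x - F y| <= L * enorm (x - y)) /\
  forall x h, F x + F x <= F (x + h) + F (x - h).

Lemma convex_lipschitz_cst c : convex_lipschitz (fun=> c).
Proof. by split=> //; exists 0 => // x y; rewrite subrr normr0 mul0r. Qed.

Lemma convex_lipschitzD F G : convex_lipschitz F -> convex_lipschitz G ->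
  convex_lipschitz (fun x => F x + G x).
Proof.
move=> [[L L0 HL] cF] [[M M0 HM] cG]; split=> [|x h].
  exists (L + M) => [|x y]; first exact: addr_ge0.
  by rewrite opprD addrACA mulrDl (le_trans (ler_normD _ _))// lerD.
by have := cF x h; have := cG x h; lra.
Qed.

Lemma convex_lipschitz_max F G : convex_lipschitz F -> convex_lipschitz G ->
  convex_lipschitz (fun x => Num.max (F x) (G x)).
Proof.
move=> [[L L0 HL] cF] [[M M0 HM] cG]; split=> [|x h].
  exists (L + M) => [|x y]; first exact: addr_ge0.
  have hF : `|F x - F y| <= (L + M) * enorm (x - y).
    by apply: le_trans (HL x y) _; rewrite ler_wpM2r ?enorm_ge0// lerDl.
  have hG : `|G x - G y| <= (L + M) * enorm (x - y).
    by apply: le_trans (HM x y) _; rewrite ler_wpM2r ?enorm_ge0// lerDr.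
  move: hF hG; rewrite !ler_distl => /andP[a1 a2] /andP[b1 b2].
  have m1 w : F w <= Num.max (F w) (G w) by rewrite le_max lexx.
  have m2 w : G w <= Num.max (F w) (G w) by rewrite le_max lexx orbT.
  have := m1 x; have := m2 x; have := m1 y; have := m2 y => ? ? ? ?.
  by apply/andP; split; [rewrite lerBlDr|]; rewrite ge_max; apply/andP; split; lra.
have [FG|FG] := leP (F x) (G x).
  apply: le_trans (cG x h) _; apply: lerD; by rewrite le_max lexx orbT.
by apply: le_trans (cF x h) _; apply: lerD; rewrite le_max lexx.
Qed.

Lemma convex_lipschitz_cone (L c : R) p : 0 <= L ->
  convex_lipschitz (fun x => c + L * enorm (x - p)).
Proof.
move=> L0; split=> [|x h].
  exists L => // x y; rewrite opprD addrACA subrr add0r -mulrBr normrM ger0_norm//.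
  rewrite ler_wpM2l// (le_trans (enorm_dist _ _))//.
  by rewrite opprB addrA subrK.
have : enorm (x - p) + enorm (x - p) <= enorm (x + h - p) + enorm (x - h - p).
  apply: le_trans (ler_enormD _ _).
  have -> : x + h - p + (x - h - p) = 2 *: (x - p).
    rewrite (addrAC x h) (addrAC x (- h)) addrACA subrr addr0.
    by rewrite scaler_nat mulr2n.
  by rewrite enormZ ger0_norm// mulrDl mul1r.
by move=> /(ler_wpM2l L0); rewrite !mulrDr; lra.
Qed.

Definition convex_difference G := exists F1 F2,
  [/\ convex_lipschitz F1, convex_lipschitz F2 & forall x, G x = F1 x - F2 x].

(** From [min (A - B) (A' - B') = (A + A') - max (B + A') (B' + A)]. *)
Lemma convex_difference_min G G' : convex_difference G -> convex_difference G' ->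
  convex_difference (fun x => Num.min (G x) (G' x)).
Proof.
move=> [A [B [cA cB HG]]] [A' [B' [cA' cB' HG']]].
exists (fun x => A x + A' x), (fun x => Num.max (B x + A' x) (B' x + A x)); split.
- exact: convex_lipschitzD.
- by apply: convex_lipschitz_max; exact: convex_lipschitzD.
move=> x; rewrite HG HG'; case: (leP (B x + A' x)) => h.
  by rewrite min_r; lra.
by rewrite min_l; lra.
Qed.

Lemma compact_unif_continuous (K : set 'rV[R]_d) f (eta : R) :
  compact K -> {within K, continuous f} -> 0 < eta ->
  exists2 delta : R, 0 < delta & forall x y, K x -> K y ->
    enorm (x - y) < delta -> `|f x - f y| <= eta.
Proof.
move=> cK cf eta0.
have loc x : exists e : R, 0 < e /\ (K x -> forall y, K y ->
    enorm (x - y) < e -> `|f x - f y| <= eta / 2).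
  have [Kx|nKx] := pselect (K x); last by exists 1.
  have : nbhs (f x) [set t | `|f x - t| <= eta / 2].
    apply/nbhs_ballP; exists (eta / 2); first by rewrite /= divr_gt0.
    by move=> t; rewrite -ball_normE /= => /ltW.
  move=> /(cf x) h; have {h} : nbhs_subspace (x : subspace K) (f @^-1` _) := h.
  rewrite -nbhs_subspace_in// => /nbhs_enorm_ball[e e0 He].
  by exists e; split=> // _ y Ky xy; exact: He.
have /choice[e He] := loc.
have e20 x : 0 < e x / 2 by rewrite divr_gt0//; have [] := He x.
move: cK; rewrite compact_cover.
move=> /(_ _ K (fun x => [set y | enorm (y - x) < e x / 2])).
case=> [x _|x Kx|D DK KD]; first exact: open_enorm_ball.
  by exists x => //=; rewrite subrr enorm0.
(* A Lebesgue number of the cover: halving the radii leaves room for [y] once [x] is near a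
   centre. *)
exists (\big[Num.min/1]_(x <- enum_fset D) (e x / 2)).
  by elim/big_ind: _ => // a b a0 b0; rewrite lt_min a0.
move=> x y Kx Ky xy; have [p /= Dp xp] := KD x Kx.
have Kp : K p by have := DK p Dp; rewrite inE.
have hp := (He p).2 Kp.
have xy' : enorm (x - y) < e p / 2.
  apply: lt_le_trans xy _; have : p \in enum_fset D by [].
  elim: (enum_fset D) => // q s IH; rewrite inE big_cons ge_min.
  by move=> /orP[/eqP->|/IH->]; rewrite ?lexx ?orbT.
have h1 : `|f p - f x| <= eta / 2.
  by apply: hp => //; rewrite enormBC; have := e20 p; move: xp; lra.
have h2 : `|f p - f y| <= eta / 2.
  apply: hp => //; have := ler_enorm_dist p y x; rewrite (enormBC p x).
  by move: xp xy'; lra.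
rewrite -(subrK (f p) (f x)) -addrA (le_trans (ler_normD _ _))// distrC.
by move: h1 h2; lra.
Qed.

(** A finite infimal convolution of [f] with the cone [L * enorm]: each translated cone is convex,
    and minima of differences of convex functions are again such differences. *)
Lemma approx_convex_difference (K : set 'rV[R]_d) f (eta : R) : K !=set0 ->
  compact K -> {within K, continuous f} -> 0 < eta ->
  exists2 G, convex_difference G & forall x, K x -> `|f x - G x| <= eta.
Proof.
move=> [p0 Kp0] cK cf eta0.
have eta2 : 0 < eta / 2 by rewrite divr_gt0.
have [delta delta0 Hd] := compact_unif_continuous cK cf eta2.
have [s sK Hs] := compact_net cK delta0.
pose M := \sum_(p <- s) `|f p| + eta.
have fM x : K x -> `|f x| <= M.
  move=> Kx; have /hasP[p ps xp] := Hs x Kx.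
  rewrite -(subrK (f p) (f x)) (le_trans (ler_normD _ _))// addrC lerD//.
    by rewrite (big_rem p ps)/= lerDl sumr_ge0.
  have := Hd x p Kx (sK p ps) xp; lra.
have M0 : 0 <= M := le_trans (normr_ge0 _) (fM p0 Kp0).
(* With this slope a cone has risen by at least [2 * M] at distance [delta] from its apex, hence
   lies above [f] there. *)
pose L := 2 * M / delta; have L0 : 0 <= L by rewrite divr_ge0 ?mulr_ge0// ltW.
have low x p : K x -> K p -> f x - eta / 2 <= f p + L * enorm (x - p).
  move=> Kx Kp; have [xp|xp] := ltP (enorm (x - p)) delta.
    have := Hd x p Kx Kp xp; rewrite ler_distl => /andP[_].
    have : 0 <= L * enorm (x - p) by rewrite mulr_ge0 ?enorm_ge0.
    lra.
  have : 2 * M <= L * enorm (x - p).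
    by rewrite /L mulrAC ler_pdivlMr// ler_wpM2l// mulr_ge0.
  have := fM x Kx; have := fM p Kp; rewrite !ler_norml => /andP[? ?] /andP[? ?].
  by lra.
(* A net so fine that the cone of a nearby net point has risen by at most [eta / 4]. *)
have tau0 : 0 < eta / 2 / (2 * (L + 1)) by rewrite !divr_gt0// mulr_gt0// ltr_wpDl.
have [s' s'K Hs'] := compact_net cK tau0.
(* The default value [M] of the minimum is an upper bound of [f] on [K]. *)
pose G x := foldr (fun p a => Num.min (f p + L * enorm (x - p)) a) M s'.
exists G.
  rewrite /G; elim: s' {s'K Hs' G} => [|p s' IH] /=.
    exists (fun=> M), (fun=> 0); split; try exact: convex_lipschitz_cst.
    by move=> x; rewrite subr0.
  apply: convex_difference_min => //.
  exists (fun x => f p + L * enorm (x - p)), (fun=> 0); split.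
  - exact: convex_lipschitz_cone.
  - exact: convex_lipschitz_cst.
  - by move=> x; rewrite subr0.
move=> x Kx; rewrite distrC ler_distl; apply/andP; split.
  rewrite /G; elim: s' s'K {Hs' G} => [|p s' IH] s'K /=.
    by have := fM x Kx; rewrite ler_norml => /andP[_]; lra.
  rewrite le_min IH => [|q qs]; last by apply: s'K; rewrite inE qs orbT.
  rewrite andbT; have := low x p Kx (s'K p (mem_head _ _)); lra.
have /hasP[p ps xp] := Hs' x Kx.
apply: (@le_trans _ _ (f p + L * enorm (x - p))).
  rewrite /G; elim: s' ps {s'K Hs' G} => //= q s' IH.
  rewrite inE ge_min => /orP[/eqP->|/IH->]; rewrite ?lexx ?orbT//.
have := low p x (s'K p ps) Kx; rewrite enormBC.
have : L * enorm (x - p) <= eta / 2 / 2.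
  apply: (@le_trans _ _ ((L + 1) * (eta / 2 / (2 * (L + 1))))).
    by rewrite ler_pM ?enorm_ge0 ?lerDl// ltW.
  rewrite le_eqVlt; apply/orP; left; apply/eqP; field.
  by rewrite gt_eqF// ltr_wpDl.
lra.
Qed.

End ConvexDifferences.

(** * Equality of the expectations for two ratios *)

Section LimitIndependence.
Context {R : realType} {d : nat} {disp : measure_display}
  {Omega : measurableType disp}.
Variables (P : probability Omega R) (theta : nat -> Omega -> 'rV[R]_d).
Hypotheses (theta_sphere : forall n, sphere_rv (theta n))
  (theta_unif : forall n, uniform_on_sphere P (theta n))
  (theta_indep : mutually_independent P theta).
Variable e0 : 'rV[R]_d.
Hypothesis e01 : enorm e0 = 1.
Variable V : set 'rV[R]_d.
Hypotheses (oV : open V) (bV : bounded_set V).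
Variable v : 'rV[R]_d.
Hypothesis Vv : V v.

Let dd := bdist V.
Let bV0 : boundary V !=set0.
Proof. by apply: (boundary_nonempty oV bV e01); exists v. Qed.
Let dd_ge0 := @bdist_ge0 R d V.
Let dd_lip := bdist_lip oV bV0.
Let v0 : 0 < dd v. Proof. exact: (bdist_gt0 oV bV0). Qed.
Let J := theta_mean P theta.
Let sJ : spherical_average J. Proof. exact: theta_mean_average. Qed.

Let dd_bounded : exists2 B, 0 <= B & forall x, 0 < dd x -> enorm x <= B.
Proof.
have [B HB] := bounded_set_enorm bV; exists B => [|x /bdist_in]; last exact: HB.
exact: le_trans (enorm_ge0 _) (HB v Vv).
Qed.

Lemma convex_lipschitz_sub F x rho : convex_lipschitz F ->
  F x <= sphere_mean J rho F x.
Proof.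
move=> [[L L0 HL] cF]; have Fl : loclip F := loclip_lipschitz HL.
have hl : loclip (fun z => F (x + rho *: z)) by loclip_tac.
have hl' : loclip (fun z => F (x + rho *: - z)) by loclip_tac.
have : F x + F x <= J (fun z => F (x + rho *: z) + F (x + rho *: - z)).
  apply: (savg_ge_cst sJ) => [|z _]; first exact: loclipD.
  by rewrite scalerN; exact: cF.
by rewrite (savgD sJ)// (savg_opp sJ hl) /sphere_mean; lra.
Qed.

(** Both sequences of means increase and are bounded above, and [jumps_le_jumps], used in both
    directions, gives them the same supremum. *)
Lemma convex_means_asymp r s F c : 0 < r < 1 -> 0 < s < 1 ->
  convex_lipschitz F -> 0 < c -> exists N0, forall n, (N0 <= n)%N ->
  `|mean P (fun w => F (position theta dd r v n w)) -
    mean P (fun w => F (position theta dd s v n w))| <= c.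
Proof.
move=> r01 s01 cF c0; have [B B0 dd_supp] := dd_bounded.
have [[L L0 HL] _] := cF; have Fl : loclip F := loclip_lipschitz HL.
have Fsub x rho : F x <= sphere_mean J rho F x by exact: convex_lipschitz_sub.
pose a q n := jumps J dd q n F v.
have aE q n : mean P (fun w => F (position theta dd q v n w)) = a q n.
  exact: mean_position.
have amono q : {homo a q : m n / (m <= n)%N >-> m <= n}.
  apply: homo_leq => [//|? ? ?|n]; first exact: le_trans.
  rewrite /a /jumps iterSr -!/(jumps _ _ _ _ _).
  apply: (ler_jumps sJ dd_lip) => //; first exact: (loclip_jump sJ dd_lip).
  by move=> x; exact: Fsub.
have aB q n : 0 < q < 1 -> a q n <= F 0 + L * B.
  move=> /andP[q0 q1].
  rewrite /a; apply: (jumps_le_cst sJ dd_ge0 dd_lip dd_supp n (ltW q0) q1 Fl) => [y yB|].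
    apply: le_trans (F_shift HL y 0) _.
    by rewrite subr0 lerD2l ler_wpM2l.
  exact: dd_supp.
have sup_le p q : 0 < p < 1 -> 0 < q < 1 -> forall e, 0 < e -> exists N0, forall n,
    (N0 <= n)%N -> a p n <= a q n + e.
  move=> p01 q01 e e_gt0.
  have sQ : has_sup (range (a p)).
    by split; [exists (a p 0%N), 0%N|exists (F 0 + L * B) => _ [n _ <-]; exact: aB].
  have e2 : 0 < e / 2 by rewrite divr_gt0.
  have [_ [m _ <-] hm] := sup_adherent e2 sQ.
  have [N HN] := jumps_le_jumps sJ e01 dd_ge0 dd_lip B0 dd_supp L0 HL Fsub m
    q01 p01 v0 e2.
  exists N => n Nn; have : a p n <= sup (range (a p)).
    by apply: ub_le_sup; [exact: sQ.2|exists n].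
  by have := amono q _ _ Nn; move: hm HN; rewrite /a; lra.
have [N1 H1] := sup_le r s r01 s01 c c0.
have [N2 H2] := sup_le s r s01 r01 c c0.
exists (maxn N1 N2) => n; rewrite geq_max => /andP[n1 n2].
by rewrite !aE ler_distl lerBlDr H1 ?H2.
Qed.

Lemma difference_means_asymp r s G c : 0 < r < 1 -> 0 < s < 1 ->
  convex_difference G -> 0 < c -> exists N0, forall n, (N0 <= n)%N ->
  `|mean P (fun w => G (position theta dd r v n w)) -
    mean P (fun w => G (position theta dd s v n w))| <= c.
Proof.
move=> r01 s01 [F1 [F2 [c1 c2 HG]]] c0; have c20 : 0 < c / 2 by rewrite divr_gt0.
have [N1 H1] := convex_means_asymp r01 s01 c1 c20.
have [N2 H2] := convex_means_asymp r01 s01 c2 c20.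
have l1 : loclip F1 by have [[L _ HL] _] := c1; exact: loclip_lipschitz HL.
have l2 : loclip F2 by have [[L _ HL] _] := c2; exact: loclip_lipschitz HL.
have mG q n : mean P (fun w => G (position theta dd q v n w)) =
    mean P (fun w => F1 (position theta dd q v n w)) -
    mean P (fun w => F2 (position theta dd q v n w)).
  under eq_fun do rewrite HG.
  have b F : loclip F -> bounded_rv (fun w => F (position theta dd q v n w)).
    by move=> Fl; exact: bounded_rv_position.
  rewrite meanD ?meanN//; [exact: b|exact: b|].
  by apply: bounded_rvN; exact: b.
exists (maxn N1 N2) => n; rewrite geq_max => /andP[/H1 + /H2].
rewrite !mG !ler_norml => /andP[? ?] /andP[? ?]; apply/andP; split; lra.
Qed.

(** Agreement of [h] with [f] of the limit up to a null set later absorbs the passage from [walk] to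
    [position]. The limit is within [e] of [X n] off the event [A]; on [A] the values of [G] differ
    by at most [K]. *)
Lemma expectation_limit_approx r (f G : 'rV[R]_d -> R) (h : Omega -> R) eta :
  0 < r < 1 -> convex_difference G ->
  (forall x, boundary V x -> `|f x - G x| <= eta) -> 0 < eta ->
  P.-negligible [set w |
    h w <> f (lim (position theta dd r v n w @[n --> \oo]))] ->
  exists N0, forall n, (N0 <= n)%N ->
    ((mean P (fun w => G (position theta dd r v n w)) - 2 * eta)%:E <= 'E_P[h] /\
    'E_P[h] <= (mean P (fun w => G (position theta dd r v n w)) + 2 * eta)%:E)%E.
Proof.
move=> /andP[r0 r1] [F1 [F2 [[[L1 L10 HL1] _] [[L2 L20 HL2] _] HG]]] fG eta0 hf.
have [B B0 dd_supp] := dd_bounded.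
pose L := L1 + L2; have L0 : 0 <= L by rewrite addr_ge0.
have GL x y : `|G x - G y| <= L * enorm (x - y).
  rewrite !HG opprD addrACA -opprD opprB mulrDl.
  rewrite (le_trans (ler_normD _ _))// lerD// ?HL1//.
  by rewrite enormBC distrC -[in X in X <= _]opprB normrN HL2.
have Gl : loclip G := loclip_lipschitz GL.
(* [L * e] and [K] times the probability of [A] are at most [eta / 2] each; together with the error
   [eta] of [G] on the boundary they give [2 * eta]. *)
pose e := eta / 2 / (L + 1).
have e_gt0 : 0 < e by rewrite divr_gt0 ?divr_gt0// ltr_wpDl.
have Le : L * e <= eta / 2.
  rewrite /e mulrA ler_pdivrMr ?ltr_wpDl// mulrC.
  by apply: ler_wpM2l; [rewrite divr_ge0// ltW|rewrite lerDl].
pose K := L * (B + B); have K0 : 0 <= K by rewrite mulr_ge0// addr_ge0.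
pose c := eta / 2 / (K + 1).
have c0 : 0 < c by rewrite divr_gt0 ?divr_gt0// ltr_wpDl.
have Kc : K * c <= eta / 2.
  rewrite /c mulrA ler_pdivrMr ?ltr_wpDl// mulrC.
  by apply: ler_wpM2l; [rewrite divr_ge0// ltW|rewrite lerDl].
have [N0 HN0] := probability_excursion_gt theta_sphere theta_unif theta_indep
  dd_ge0 dd_lip dd_supp r0 r1 v0 e_gt0 c0.
exists N0 => n N0n.
pose X k w := position theta dd r v k w.
pose A := excursion_gt theta dd r v n e.
have mA : measurable A by exact: measurable_excursion_gt.
have PA : mean P (\1_A) <= c.
  rewrite mean_indic// -lee_fin fineK; last exact: fin_num_measure.
  exact: HN0.
have bA : bounded_rv (\1_A : Omega -> R) by exact: bounded_rv_indic.
have bG : bounded_rv (fun w => G (X n w)) by exact: bounded_rv_position.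
have neg := negligibleU hf (walk_converges_ae theta_sphere theta_unif theta_indep
  dd_ge0 dd_lip dd_supp r0 r1 v0).
have XV k w : V (X k w).
  by apply: bdist_in; exact: position_pos.
have err w : ~ ([set w | h w <> f (lim (X n w @[n --> \oo]))] `|`
    [set w | ~ (cvg (X n w @[n --> \oo]) /\ dd (lim (X n w @[n --> \oo])) = 0)]) w ->
    `|h w - G (X n w)| <= eta + L * e + K * \1_A w.
  rewrite not_orP => -[/contrapT -> /contrapT[cX dX]].
  set Y := lim _ in dX *.
  have cY : closure V Y.
    by apply: (closed_cvg (closure V)) cX; [exact: closed_closure|
      apply: nearW => k; exact: subset_closure].
  have bY : boundary V Y by exact: bdist0_boundary.
  rewrite -(subrK (G Y) (f Y)) -addrA (le_trans (ler_normD _ _))//.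
  rewrite -addrA lerD ?fG//; apply: le_trans (GL _ _) _.
  have lim_le a : (forall k, (n <= k)%N -> enorm (X k w - X n w) <= a) ->
      enorm (Y - X n w) <= a.
    move=> Ha; have cl : (enorm (X k w - X n w) @[k --> \oo]) --> enorm (Y - X n w).
      apply: (@continuous_cvg _ _ _ _ _ (fun k => X k w) (fun y => enorm (y - X n w)) Y) => //.
      by apply: loclip_continuous; loclip_tac.
    rewrite -(cvg_lim _ cl)//; apply: limr_le.
      by apply/cvg_ex; exists (enorm (Y - X n w)).
    by exists n => // k /= nk; exact: Ha.
  have XB k : enorm (X k w) <= B by exact/dd_supp/position_pos.
  rewrite indicE; have [Aw|Aw] := pselect (A w).
    rewrite mem_set// mulr1; apply: (@le_trans _ _ K); last first.
      by rewrite lerDr mulr_ge0// ltW.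
    rewrite ler_wpM2l//; apply: lim_le => k _.
    by rewrite (le_trans (ler_enormB _ _))// lerD.
  rewrite memNset// mulr0 addr0 ler_wpM2l//; apply: lim_le => k nk.
  exact: excursion_gtPn Aw nk.
have bKA : bounded_rv (fun w => eta + L * e + K * \1_A w).
  apply: bounded_rvD; first exact: bounded_rv_cst.
  by apply: bounded_rvM => //; exact: bounded_rv_cst.
have mKA : mean P (fun w => eta + L * e + K * \1_A w) <= 2 * eta.
  rewrite meanD; [|exact: bounded_rv_cst|by apply: bounded_rvM => //; exact: bounded_rv_cst].
  rewrite mean_cst meanZ//; have := ler_wpM2l K0 PA; lra.
split.
  apply: (@le_trans _ _ (mean P (fun w => G (X n w) - (eta + L * e + K * \1_A w)))%:E).
    rewrite lee_fin meanD// ?meanN//; last exact: bounded_rvN.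
    by rewrite lerB.
  apply: mean_le_expectation neg _; first by apply: bounded_rvD => //; exact: bounded_rvN.
  by move=> w /err; rewrite ler_distl => /andP[].
apply: (@le_trans _ _ (mean P (fun w => G (X n w) + (eta + L * e + K * \1_A w)))%:E).
  apply: expectation_le_mean neg _; first exact: bounded_rvD.
  by move=> w /err; rewrite ler_distl => /andP[].
by rewrite lee_fin meanD// lerD2l.
Qed.

Lemma expectation_limit_independent r s (f : 'rV[R]_d -> R) (h h' : Omega -> R) :
  0 < r < 1 -> 0 < s < 1 -> {within boundary V, continuous f} ->
  P.-negligible [set w |
    h w <> f (lim (position theta dd r v n w @[n --> \oo]))] ->
  P.-negligible [set w |
    h' w <> f (lim (position theta dd s v n w @[n --> \oo]))] ->
  ('E_P[h] = 'E_P[h'])%E.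
Proof.
move=> r01 s01 cf hr hs.
have cB := compact_boundary oV bV.
have key eta : 0 < eta -> exists a b : R, [/\ `|a - b| <= eta,
    ((a - 2 * eta)%:E <= 'E_P[h] /\ 'E_P[h] <= (a + 2 * eta)%:E)%E &
    ((b - 2 * eta)%:E <= 'E_P[h'] /\ 'E_P[h'] <= (b + 2 * eta)%:E)%E].
  move=> eta0; have [G cG fG] := approx_convex_difference bV0 cB cf eta0.
  have [N1 H1] := expectation_limit_approx r01 cG fG eta0 hr.
  have [N2 H2] := expectation_limit_approx s01 cG fG eta0 hs.
  have [N3 H3] := difference_means_asymp r01 s01 cG eta0.
  pose n := maxn N1 (maxn N2 N3).
  exists (mean P (fun w => G (position theta dd r v n w))),
    (mean P (fun w => G (position theta dd s v n w))); split.
  - by apply: H3; rewrite /n !leq_max leqnn !orbT.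
  - by apply: H1; rewrite /n !leq_max leqnn.
  - by apply: H2; rewrite /n !leq_max leqnn !orbT.
(* One instance shows that both expectations are finite. *)
have [a [b [_ [a1 a2] [b1 b2]]]] := key 1 ltr01.
have fin (x : \bar R) (p q : R) : (p%:E <= x)%E -> (x <= q%:E)%E -> x \is a fin_num.
  by move=> px xq; rewrite fin_real// (lt_le_trans _ px) ?(le_lt_trans xq) ?ltNyr ?ltry.
have fh := fin _ _ _ a1 a2; have fh' := fin _ _ _ b1 b2.
rewrite -(fineK fh) -(fineK fh'); congr EFin.
(* [5] counts [1] for the gap between the two means and [2] for each expectation. *)
apply: (@eq_small_dist _ _ _ 5) => eta eta0.
have [a' [b' [ab]]] := key eta eta0.
rewrite -(fineK fh) -(fineK fh') !lee_fin => -[? ?] [? ?].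
by move: ab; rewrite !ler_norml => /andP[? ?]; apply/andP; split; lra.
Qed.

End LimitIndependence.

(** [edist_set] to the boundary and [bdist] agree on [V], so the identity is proved together with
    the fact that the walk stays in [V]. *)
Lemma walk_position (R : realType) (d : nat) (disp : measure_display)
    (Omega : measurableType disp) (theta : nat -> Omega -> 'rV[R]_d)
    (e0 v : 'rV[R]_d) (V : set 'rV[R]_d) (r : R) (w : Omega) :
  enorm e0 = 1 -> open V -> boundary V !=set0 -> V v -> 0 < r < 1 ->
  (forall n, enorm (theta n w) = 1) -> forall n,
  walk theta V r v n w =
  position (fun n w => to_sphere e0 (theta n w)) (bdist V) r v n w.
Proof.
move=> e01 oV bV0 Vv /andP[r0 r1] t1 n.
suff : walk theta V r v n w = position (fun n w => to_sphere e0 (theta n w))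
  (bdist V) r v n w /\ V (walk theta V r v n w) by case.
elim: n => [|n [IH Vn]]; first by [].
have step : walk theta V r v n.+1 w =
    position (fun n w => to_sphere e0 (theta n w)) (bdist V) r v n.+1 w.
  by rewrite /= /walk_step /= -IH bdistE// /to_sphere t1 eqxx.
split=> //; apply: bdist_in; rewrite step /= /walk_step /= -IH.
apply: lt_le_trans (dd_jump (@bdist_ge0 R d V) (bdist_lip oV bV0) _ (ltW r0) _).
  by rewrite mulr_gt0 ?subr_gt0// bdist_gt0.
exact: to_sphere1.
Qed.


Theorem proposition2p6 (R : realType) (d : nat) (hd : (0 < d)%N)
  (disp : measure_display) (Omega : measurableType disp)
  (P : probability Omega R)
  (theta : nat -> Omega -> 'rV[R]_d)
  (theta_meas : forall n, random_vector (theta n))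
  (theta_unif : forall n, uniform_on_sphere P (theta n))
  (theta_indep : mutually_independent P theta)
  (V : set 'rV[R]_d)
  (V_nonempty : V !=set0) (V_bounded : bounded_set V) (V_open : open V)
  (f : 'rV[R]_d -> R)
  (f_cont : {within boundary V, continuous f}) :
  forall (v : 'rV[R]_d), V v ->
  forall r s : R, 0 < r < 1 -> 0 < s < 1 ->
    ('E_P[fun w => f (walk_lim theta V r v w)] =
     'E_P[fun w => f (walk_lim theta V s v w)])%E.
Proof.
move=> v Vv r s r01 s01.
(* A unit vector, available because [d] is positive: the substitute direction for [to_sphere]. *)
pose e0 : 'rV[R]_d := delta_mx ord0 (Ordinal hd).
have e01 : enorm e0 = 1.
  rewrite enormE /dotp (bigD1 (Ordinal hd))//= big1 => [|i /negbTE i0].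
    by rewrite !mxE !eqxx mulr1 addr0 sqrtr1.
  by rewrite !mxE i0 mul0r.
pose theta' n w := to_sphere e0 (theta n w).
have sphere' n : sphere_rv (theta' n).
  split; first exact: random_vector_to_sphere.
  by move=> w; exact: to_sphere1.
have unif' n : uniform_on_sphere P (theta' n) by exact: uniform_to_sphere.
have indep' : mutually_independent P theta' by exact: indep_to_sphere.
have bV0 : boundary V !=set0 by exact: (boundary_nonempty V_open V_bounded e01 V_nonempty).
(* Outside this countable union of null events all directions lie on the sphere, and the two
   versions of the walk coincide for every ratio. *)
have off_sphere : P.-negligible (\bigcup_n theta n @^-1` ~` unit_sphere).
  apply: negligible_bigcup => n; exists (theta n @^-1` ~` unit_sphere); split=> //.
    by apply: theta_meas; apply: borelC; exact: borel_sphere.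
  exact: uniform_sphere_ae.
have lim_ae q : 0 < q < 1 -> P.-negligible [set w | f (walk_lim theta V q v w) <>
    f (lim (position theta' (bdist V) q v n w @[n --> \oo]))].
  move=> q01; apply: negligibleS off_sphere => w.
  apply: contra_notP => h; rewrite /walk_lim.
  suff -> : (fun n => walk theta V q v n w) =
      (fun n => position theta' (bdist V) q v n w) by [].
  apply/funext => n; apply: walk_position => // k.
  by apply: contrapT => hk; apply: h; exists k.
exact: (expectation_limit_independent sphere' unif' indep' e01 V_open V_bounded Vv
  r01 s01 f_cont (lim_ae r r01) (lim_ae s s01)).
Qed.
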